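(* Let $\alpha$ and $\beta$ be positive real numbers with $\alpha+\beta=1$. Then $$\zeta^\ast(s)=Z_\beta(s)+Z_\alpha(1-s)+\sum_{m=1}^{\infty}\sum_{n=1}^{\infty}c_\alpha(m)\,c_\beta(n)\Bigl(\frac{n}{m}\Bigr)^{\frac{s-\beta}{4}}K_{\frac{s-\beta}{2}}\bigl(2\pi\sqrt{mn}\bigr)$$ for any $s\in\mathbb{C}$ (as an identity of meromorphic functions of $s$). In particular, taking $\alpha=\beta=1/2$, $$\zeta^\ast(s)=Z_{1/2}(s)+Z_{1/2}(1-s)+\sum_{m=1}^{\infty}\sum_{n=1}^{\infty}c_{1/2}(m)\,c_{1/2}(n)\Bigl(\frac{n}{m}\Bigr)^{\frac{s}{4}-\frac18}K_{\frac{s}{2}-\frac14}\bigl(2\pi\sqrt{mn}\bigr)$$ for any $s\in\mathbb{C}$.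
   Context: $\zeta^\ast(s)=\pi^{-s/2}\Gamma(s/2)\zeta(s)$ is the completed Riemann zeta function. The theta series is $\theta(x)=\sum_{n=-\infty}^{\infty}e^{-\pi n^2x}$ for $x>0$. For a real number $\alpha>0$ the numbers $c_\alpha(m)$ $(m=1,2,3,\dots)$ are defined by the expansion $$\theta(x)^\alpha=\Bigl(1+2\sum_{n=1}^\infty e^{-\pi n^2x}\Bigr)^\alpha=\sum_{j=0}^\infty\binom{\alpha}{j}2^j\Bigl(\sum_{n=1}^\infty e^{-\pi n^2x}\Bigr)^j=1+\sum_{m=1}^\infty c_\alpha(m)e^{-\pi mx},$$ i.e. $c_\alpha(m)$ is the coefficient of $X^m$ in the formal power series $\bigl(1+2\sum_{n\ge1}X^{n^2}\bigr)^\alpha$. For $\alpha>0$, $$Z_\alpha(s)=\int_0^\infty\bigl(\theta(t^2)^\alpha-1\bigr)t^s\,\frac{dt}{t},$$ which converges absolutely for $\mathrm{Re}(s)>\alpha$ and is continued meromorphically to the whole complex plane (the same symbol denotes the continuation). $K_\nu$ is the $K$-Bessel function, $K_\nu(x)=\frac12\int_0^\infty e^{-\frac{x}{2}(t+\frac1t)}t^{-\nu}\frac{dt}{t}$ for $x>0$, $\nu\in\mathbb{C}$. *)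

(* Defs.v *)
(* Concrete real numbers of Stdlib, with Coquelicot. *)
From Stdlib Require Import Reals ClassicalEpsilon.
From Coquelicot Require Import Coquelicot.
Open Scope R_scope.

(* The principal power x^s = exp (s ln x), for a real base x > 0 and a complex exponent s. *)
Definition cpow (x : R) (s : C) : C :=
  (exp (Re s * ln x) * cos (Im s * ln x), exp (Re s * ln x) * sin (Im s * ln x)).

Definition CSeries (a : nat -> C) : C :=
  (Series (fun n => Re (a n)), Series (fun n => Im (a n))).

(* Improper integral over (0, +oo) of a complex-valued function of a real variable. *)
Definition CInt0oo (f : R -> C) : C :=
  @RInt_gen C_R_CompleteNormedModule f (at_right 0) (Rbar_locally p_infty).

(* The iterated sum over m, n >= 1 of a m n is l: each inner sum over n converges,
   and so does the outer sum over m. *)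
Definition is_double_series (a : nat -> nat -> C) (l : C) : Prop :=
  exists inner : nat -> C,
    (forall m : nat,
       is_series (K := C_AbsRing) (V := C_NormedModule)
         (fun n => a (S m) (S n)) (inner m)) /\
    is_series (K := C_AbsRing) (V := C_NormedModule) inner l.

Definition analytic_at (f : C -> C) (s : C) : Prop :=
  exists a : nat -> C,
    locally s (fun z =>
      is_pseries (K := C_AbsRing) (V := C_NormedModule) a (z - s)%C (f z)).

Definition entire (f : C -> C) : Prop := forall s : C, analytic_at f s.

Definition pole_at (f : C -> C) (s : C) : Prop :=
  exists (k : nat) (g : C -> C),
    analytic_at g s /\ g s <> 0 /\
    locally' s (fun z => f z = (g z / (z - s) ^ S k)%C).

(* Meromorphic functions on C are represented by total functions with the dummy
   value 0 at the poles, and no removable singularities; with this normalization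
   two meromorphic functions that agree on a nonempty open set are equal. *)
Definition meromorphic (f : C -> C) : Prop :=
  forall s : C, analytic_at f s \/ (pole_at f s /\ f s = 0).

(* The (unique, when it exists) meromorphic continuation to C of a function f that
   is given on the half-plane Re s > a. *)
Definition mero_continuation (a : R) (f : C -> C) : C -> C :=
  epsilon (inhabits (fun _ : C => RtoC 0))
    (fun F => meromorphic F /\ forall s : C, a < Re s -> F s = f s).

(* Euler's integral, defining Gamma for Re s > 0. *)
Definition Gamma_integral (s : C) : C :=
  CInt0oo (fun t => (RtoC (exp (- t)) * cpow t (s - 1))%C).

(* The Dirichlet series, defining zeta for Re s > 1. *)
Definition zeta_series (s : C) : C :=
  CSeries (fun n => cpow (INR (S n)) (- s)%C).

(* The completed zeta function pi^(-s/2) Gamma(s/2) zeta(s) on the whole plane: for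
   Re s > 1 the integral for Gamma(s/2) and the series for zeta(s) both converge.
   Continuing the product, rather than multiplying the dummy values of the factors,
   gives the correct values at s = -2, -4, ... where a pole of Gamma(s/2) meets
   a zero of zeta(s). *)
Definition zeta_star : C -> C :=
  mero_continuation 1
    (fun s => (cpow PI (- s / 2) * Gamma_integral (s / 2) * zeta_series s)%C).

(* The sum over all integers n, split into n >= 0 and n < 0. *)
Definition theta (x : R) : R :=
  Series (fun n => exp (- PI * (INR n) ^ 2 * x)) +
  Series (fun n => exp (- PI * (- INR (S n)) ^ 2 * x)).

Definition Z_theta (alpha : R) : C -> C :=
  mero_continuation alpha
    (fun s => CInt0oo (fun t =>
       (RtoC (Rpower (theta (t ^ 2)) alpha - 1) * cpow t s / RtoC t)%C)).

Fixpoint gbinom (alpha : R) (j : nat) : R :=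
  match j with
  | O => 1
  | S j' => gbinom alpha j' * (alpha - INR j') / INR (S j')
  end.

(* Coefficients of the formal power series sum_(n >= 1) X^(n^2). *)
Definition square_coef (k : nat) : R :=
  match k with
  | O => 0
  | _ => if Nat.eqb (Nat.sqrt k * Nat.sqrt k) k then 1 else 0
  end.

Fixpoint PS_pow (a : nat -> R) (j : nat) : nat -> R :=
  match j with
  | O => fun k => match k with O => 1 | _ => 0 end
  | S j' => PS_mult a (PS_pow a j')
  end.

(* The coefficient of X^m in (1 + 2 S)^alpha = sum_j binom(alpha, j) 2^j S^j with
   S = sum_(n >= 1) X^(n^2); only j <= m contribute, since X^j divides S^j. *)
Definition c_theta (alpha : R) (m : nat) : R :=
  sum_f_R0 (fun j => gbinom alpha j * 2 ^ j * PS_pow square_coef j m) m.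

Definition BesselK (nu : C) (x : R) : C :=
  (RtoC (1 / 2) *
   CInt0oo (fun t =>
     RtoC (exp (- (x / 2) * (t + 1 / t))) * cpow t (- nu) / RtoC t))%C.

(* Main.v *)
Require Import Defs.
From Stdlib Require Import Reals.
From Coquelicot Require Import Coquelicot.
From Stdlib Require Import Lra Lia Psatz Classical_Prop ClassicalEpsilon FunctionalExtensionality Factorial.
Open Scope R_scope.

(** Write theta(t^2)^alpha = t^(-alpha) theta(t^(-2))^alpha.  Subtracting from theta(t^2)^alpha - 1 the
    function t^(-alpha) - 1 on t < 1 leaves a remainder R_alpha that decays faster than any power of t at
    0 and at infinity, so Z_alpha(s) = (Mellin transform of R_alpha) + 1/(s-alpha) - 1/s, and the case
    alpha = 1 is zeta^*.  For alpha + beta = 1 the remainders satisfy a pointwise identity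
    R_1(t) = R_beta(t) + t^(-beta) (R_alpha(t) + (theta(t^2)^alpha - 1) (theta(t^(-2))^beta - 1)),
    whose Mellin transform is the formula; the last product, expanded in exponentials, gives the Bessel
    functions term by term.  All integrals are taken in the variable u = ln t.

    The binomial expansion of theta^alpha converges only for large x, so the identity
    theta(x)^alpha = sum_m c_alpha(m) e^(-pi m x) for all x > 0 needs the zero-freeness of theta in the
    unit disc.  It comes from the triple product, in the form of a differential equation
    q theta'(q) = L(q) theta(q) with explicit |L_k| <= 2 sum_(d | k) d, which also yields
    sum_m |c_alpha(m)| e^(-m y) <= e^(4 alpha / y); this suffices for the convergence of the double series.

    The functional equation of theta is obtained by Polya's method: sampling the expansion of
    cos^(2m) at the l-th roots of unity with l^2 ~ pi t m and letting m tend to infinity. *)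

(** * Integrals over the real line of complex-valued functions *)

(** In the variable u = ln t the measure dt/t becomes du, t -> 1/t becomes u -> -u, and the two ends
    of the half-line become symmetric. Every passage to a limit under the integral sign rests on one
    explicit estimate: if two integrands differ by at most eps_n K / (1 + u^2), their integrals
    differ by at most eps_n K PI ([isI_limit]). The Taylor series of the transforms, the Dirichlet
    series of zeta and the double series are all handled this way.

    The delicate point is the double series: the c_alpha(m) change sign, and the expansion of
    theta(x)^alpha degenerates as x -> 0. The majorant e^(4 alpha / y) is taken at y = pi x / 2,
    since half of the exponential decay must be kept for the rate of convergence; this leaves e^(8
    alpha / (pi x)), which competes with the factor e^(-pi / x) supplied by the other theta
    function. With alpha <= 1 the latter wins because 8 / pi < 8 / 3 and 8/3 + 1/6 + 1/6 = 3 < pi;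
    one sixth pays for the rate in the summation index, the other for the decay in u. A majorant
    e^(C alpha / y) would serve this argument for C < pi^2 / 2, and C = 4 is within that margin. *)

Definition contC (h : R -> C) : Prop :=
  forall u, continuous (T := R_UniformSpace) (U := C_R_CompleteNormedModule) h u.

Definition contR (h : R -> R) : Prop :=
  forall u, continuous (T := R_UniformSpace) (U := R_UniformSpace) h u.

Definition CRInt (h : R -> C) (a b : R) : C := @RInt C_R_CompleteNormedModule h a b.

(** The two ends go to infinity independently of each other. Continuity of h is part of the
    predicate so that every integral over a finite segment exists and splits additively. *)
Definition is_line_int (h : R -> C) (l : C) : Prop :=
  contC h /\
  forall eps : R, 0 < eps ->
    exists M : R, forall a b : R, a < - M -> M < b -> Cmod (CRInt h a b - l) < eps.

(** This majorant has the primitive K atan, of total variation K PI, so integrability and the bound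
    on the integral come from one explicit function. *)
Definition cauchy_dominated (h : R -> C) (K : R) : Prop :=
  forall u, Cmod (h u) <= K * / (1 + u ^ 2).

Lemma contC_pair (f g : R -> R) : contR f -> contR g -> contC (fun u => (f u, g u)).
Proof.
  intros Hf Hg u.
  apply (continuous_comp_2 (U := R_UniformSpace) (V := R_UniformSpace) f g (fun x y => (x, y) : C_R_CompleteNormedModule) u (Hf u) (Hg u)).
  apply (continuous_ext (fun p => p)). { intros [x y]; reflexivity. }
  apply continuous_id.
Qed.

Lemma contC_Re (h : R -> C) : contC h -> contR (fun u => Re (h u)).
Proof.
  intros H u. apply (continuous_comp h (fun p => fst p) u (H u)).
  apply (continuous_fst (U := R_UniformSpace) (V := R_UniformSpace)).
Qed.

Lemma contC_Im (h : R -> C) : contC h -> contR (fun u => Im (h u)).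
Proof.
  intros H u. apply (continuous_comp h (fun p => snd p) u (H u)).
  apply (continuous_snd (U := R_UniformSpace) (V := R_UniformSpace)).
Qed.

Lemma contR_plus (f g : R -> R) : contR f -> contR g -> contR (fun u => f u + g u).
Proof. intros Hf Hg u; apply (continuous_plus (V := R_NormedModule)); auto. Qed.

Lemma contR_mult (f g : R -> R) : contR f -> contR g -> contR (fun u => f u * g u).
Proof. intros Hf Hg u; apply (continuous_mult (K := R_AbsRing)); auto. Qed.

Lemma contR_minus (f g : R -> R) : contR f -> contR g -> contR (fun u => f u - g u).
Proof. intros Hf Hg u; apply (continuous_minus (V := R_NormedModule)); auto. Qed.

Lemma contR_const (c : R) : contR (fun _ => c).
Proof. intros u; apply continuous_const. Qed.

Lemma contR_id : contR (fun u => u).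
Proof. intros u; apply continuous_id. Qed.

Lemma contR_comp (f g : R -> R) : contR f -> contR g -> contR (fun u => g (f u)).
Proof. intros Hf Hg u; apply continuous_comp; auto. Qed.

Lemma contR_exp : contR exp.
Proof. intros u; apply continuous_exp. Qed.

Lemma contR_of_continuity (f : R -> R) : continuity f -> contR f.
Proof. intros H u; apply continuity_pt_filterlim, H. Qed.

Lemma contC_ext (f g : R -> C) : (forall u, f u = g u) -> contC f -> contC g.
Proof. intros E Hf. replace g with f by (apply functional_extensionality, E). exact Hf. Qed.

Lemma contC_plus (f g : R -> C) : contC f -> contC g -> contC (fun u => f u + g u)%C.
Proof.
  intros Hf Hg. apply contC_pair; apply contR_plus.
  1,2: apply contC_Re; assumption. 1,2: apply contC_Im; assumption.
Qed.

Lemma contC_mult (f g : R -> C) : contC f -> contC g -> contC (fun u => f u * g u)%C.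
Proof.
  intros Hf Hg. apply contC_pair; [apply contR_minus | apply contR_plus]; apply contR_mult.
  1, 2, 5, 8: apply contC_Re; assumption. all: apply contC_Im; assumption.
Qed.

Lemma contC_const (c : C) : contC (fun _ => c).
Proof. intros u; apply continuous_const. Qed.

Lemma contC_RtoC (f : R -> R) : contR f -> contC (fun u => RtoC (f u)).
Proof. intros H; apply contC_pair; [exact H | apply contR_const]. Qed.

Lemma contC_comp (f : R -> R) (g : R -> C) : contR f -> contC g -> contC (fun u => g (f u)).
Proof. intros Hf Hg u; apply continuous_comp; auto. Qed.

(** * Integrals over finite segments *)

Lemma ex_RI (h : R -> C) (a b : R) : contC h -> ex_RInt (V := C_R_CompleteNormedModule) h a b.
Proof. intros H; apply ex_RInt_continuous; intros; apply H. Qed.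

Lemma is_RI (h : R -> C) (a b : R) :
  contC h -> is_RInt (V := C_R_CompleteNormedModule) h a b (CRInt h a b).
Proof. intros H; apply (RInt_correct (V := C_R_CompleteNormedModule)), ex_RI, H. Qed.

Lemma RI_unique (h : R -> C) (a b : R) (l : C) :
  is_RInt (V := C_R_CompleteNormedModule) h a b l -> CRInt h a b = l.
Proof. apply (is_RInt_unique (V := C_R_CompleteNormedModule)). Qed.

Lemma RI_Chasles (h : R -> C) (a b c : R) : contC h -> (CRInt h a b + CRInt h b c)%C = CRInt h a c.
Proof. intros H; apply (RInt_Chasles (V := C_R_CompleteNormedModule)); apply ex_RI, H. Qed.

Lemma RI_swap (h : R -> C) (a b : R) : contC h -> CRInt h b a = (- CRInt h a b)%C.
Proof. intros H. symmetry. apply (opp_RInt_swap (V := C_R_CompleteNormedModule)), ex_RI, H. Qed.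

Lemma RI_plus (f g : R -> C) (a b : R) : contC f -> contC g ->
  CRInt (fun u => f u + g u)%C a b = (CRInt f a b + CRInt g a b)%C.
Proof. intros Hf Hg; apply RI_unique, (is_RInt_plus (V := C_R_CompleteNormedModule)); apply is_RI; assumption. Qed.

(** The integral takes its values in C as a module over R, so a complex factor is moved out through
    the real and imaginary parts. *)
Lemma RI_Cmult (c : C) (f : R -> C) (a b : R) : contC f ->
  CRInt (fun u => c * f u)%C a b = (c * CRInt f a b)%C.
Proof.
  intros Hf. apply RI_unique.
  assert (H : is_RInt (V := C_R_NormedModule) f a b (CRInt f a b)) by exact (is_RI f a b Hf).
  assert (H1 : is_RInt (V := R_NormedModule) (fun t => Re (f t)) a b (Re (CRInt f a b))) by
    exact (is_RInt_fct_extend_fst (U := R_NormedModule) (V := R_NormedModule) _ _ _ _ H).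
  assert (H2 : is_RInt (V := R_NormedModule) (fun t => Im (f t)) a b (Im (CRInt f a b))) by
    exact (is_RInt_fct_extend_snd (U := R_NormedModule) (V := R_NormedModule) _ _ _ _ H).
  apply (is_RInt_fct_extend_pair (U := R_NormedModule) (V := R_NormedModule)).
  - apply (is_RInt_minus (V := R_NormedModule)); apply (is_RInt_scal (V := R_NormedModule)); assumption.
  - apply (is_RInt_plus (V := R_NormedModule)); apply (is_RInt_scal (V := R_NormedModule)); assumption.
Qed.

Lemma norm_C_R (z : C) : norm (V := C_R_NormedModule) z = Cmod z.
Proof.
  change (sqrt (Rabs (fst z) ^ 2 + Rabs (snd z) ^ 2) = sqrt (fst z ^ 2 + snd z ^ 2)).
  now rewrite !pow2_abs.
Qed.

Lemma scal_C_R (c : R) (z : C) : scal (V := C_R_NormedModule) c z = (RtoC c * z)%C.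
Proof.
  change ((c * fst z, c * snd z) = (RtoC c * z)%C).
  unfold Cmult, RtoC; simpl. f_equal; ring.
Qed.

Lemma RI_dom (h : R -> C) (K a b : R) : contC h -> cauchy_dominated h K -> a <= b ->
  Cmod (CRInt h a b) <= K * (atan b - atan a).
Proof.
  intros Hc Hd Hab. rewrite <- norm_C_R.
  apply (norm_RInt_le (V := C_R_NormedModule) h (fun u => K * / (1 + u ^ 2)) a b).
  - exact Hab.
  - intros x _. rewrite norm_C_R. apply Hd.
  - apply is_RI, Hc.
  - apply (is_RInt_scal (V := R_NormedModule) (fun u => / (1 + u ^ 2)) a b K (atan b - atan a)).
    apply (is_RInt_derive (V := R_CompleteNormedModule) atan).
    + intros x _. apply is_derive_Reals. assert (H := derivable_pt_lim_atan x).
      unfold Rdiv in H. rewrite ?Rmult_1_l in H. exact H.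
    + intros x _. apply (continuous_comp (fun x => 1 + x ^ 2) Rinv).
      * apply (ex_derive_continuous (V := R_NormedModule)). auto_derive; trivial.
      * apply continuous_Rinv. nra.
Qed.

(** * Existence, bounds and linearity of integrals over the whole line *)

Lemma atan_tail (eps : R) : 0 < eps -> exists M, 0 <= M /\
  (forall b, M < b -> PI / 2 - atan b < eps) /\ (forall a, a < - M -> atan a + PI / 2 < eps).
Proof.
  intros He.
  set (d := Rmin (eps / 2) (PI / 4)).
  assert (Hpi := PI_RGT_0).
  assert (Hd : 0 < d) by (unfold d; apply Rmin_pos; lra).
  assert (Hd1 : d <= eps / 2) by apply Rmin_l.
  assert (Hd2 : d <= PI / 4) by apply Rmin_r.
  assert (Ht : atan (tan (PI / 2 - d)) = PI / 2 - d) by (apply atan_tan; lra).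
  assert (H0 : 0 <= tan (PI / 2 - d)) by (left; apply tan_gt_0; lra).
  exists (tan (PI / 2 - d)). split; [exact H0 |]. split.
  - intros b Hb. apply atan_increasing in Hb. rewrite Ht in Hb. lra.
  - intros a Ha. apply atan_increasing in Ha. rewrite atan_opp, Ht in Ha. lra.
Qed.

Lemma isI_exists (h : R -> C) (K : R) : contC h -> cauchy_dominated h K ->
  exists l, is_line_int h l.
Proof.
  intros Hc Hd.
  assert (HK : 0 <= K).
  { specialize (Hd 0). assert (H := Cmod_ge_0 (h 0)).
    replace (K * / (1 + 0 ^ 2)) with K in Hd by field. lra. }
  assert (Hcau : forall eps, 0 < eps -> exists M, forall a b a' b',
    a < - M -> M < b -> a' < - M -> M < b' -> Cmod (CRInt h a b - CRInt h a' b') < eps).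
  { intros eps He.
    destruct (atan_tail (eps / (2 * (K + 1)))) as [M [HM [H1 H2]]].
    { apply Rdiv_lt_0_compat; lra. }
    exists M. intros a b a' b' Ha Hb Ha' Hb'.
    assert (Haux : forall x y, Cmod (CRInt h x y) <= K * Rabs (atan y - atan x)).
    { intros x y. destruct (Rle_dec x y) as [Hxy | Hxy].
      - rewrite Rabs_pos_eq. apply RI_dom; assumption.
        destruct Hxy as [Hxy | ->]; [apply atan_increasing in Hxy |]; lra.
      - apply Rnot_le_lt in Hxy. rewrite RI_swap, Cmod_opp, Rabs_minus_sym, Rabs_pos_eq; trivial.
        apply RI_dom; trivial. lra. apply atan_increasing in Hxy; lra. }
    replace (CRInt h a b - CRInt h a' b')%C with (CRInt h a a' + CRInt h b' b)%C.
    2:{ rewrite <- (RI_Chasles h a a' b), <- (RI_Chasles h a' b' b) by assumption. ring. }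
    eapply Rle_lt_trans. apply Cmod_triangle.
    assert (B1 : Rabs (atan a' - atan a) < eps / (2 * (K + 1))).
    { assert (A1 := H2 a Ha). assert (A2 := H2 a' Ha').
      assert (T1 := proj1 (atan_bound a)). assert (T2 := proj1 (atan_bound a')).
      apply Rabs_def1; lra. }
    assert (B2 : Rabs (atan b - atan b') < eps / (2 * (K + 1))).
    { assert (A1 := H1 b Hb). assert (A2 := H1 b' Hb').
      assert (T1 := proj2 (atan_bound b)). assert (T2 := proj2 (atan_bound b')).
      apply Rabs_def1; lra. }
    assert (E : eps = 2 * (K + 1) * (eps / (2 * (K + 1)))) by (field; lra).
    assert (C1 := Haux a a'). assert (C2 := Haux b' b).
    assert (P1 := Rabs_pos (atan a' - atan a)). assert (P2 := Rabs_pos (atan b - atan b')).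
    nra. }
  destruct (proj1 (filterlim_locally_cauchy (U := C_R_CompleteNormedModule)
     (F := filter_prod (Rbar_locally m_infty) (Rbar_locally p_infty))
     (fun ab : R * R => CRInt h (fst ab) (snd ab)))) as [l Hl].
  { intros eps. destruct (Hcau eps (cond_pos eps)) as [M HM].
    exists (fun ab => fst ab < - M /\ M < snd ab). split.
    - apply (Filter_prod _ _ _ (fun a => a < - M) (fun b => M < b)).
      + exists (- M); trivial.
      + exists M; trivial.
      + intros a b H1 H2; split; assumption.
    - intros [a b] [a' b'] [H1 H2] [H3 H4]. apply C_NormedModule_mixin_compat1.
      apply HM; assumption. }
  exists l. split; [exact Hc |]. intros eps He.
  assert (H2 : 0 < eps / 2) by lra.
  destruct (Hcau (eps / 2) H2) as [M HM].
  (* Balls of C are squares; [Cmod] exceeds the maximum norm by a factor of at most sqrt 2, hence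
     the radius chosen here. *)
  assert (Hs : 0 < sqrt 2) by (apply sqrt_lt_R0; lra).
  assert (He2 : 0 < eps / 2 / sqrt 2) by (apply Rdiv_lt_0_compat; lra).
  assert (Hb := Hl _ (locally_ball (l : C_R_CompleteNormedModule) (mkposreal _ He2))).
  destruct Hb as [P Q [A HA] [B HB] HPQ].
  (* A single pair (a0, b0) beyond both thresholds links the limit along the filter to the explicit
     Cauchy modulus M. *)
  set (a0 := Rmin A (- M) - 1). set (b0 := Rmax B M + 1).
  assert (Ha0 : a0 < A /\ a0 < - M).
  { unfold a0. assert (T1 := Rmin_l A (- M)). assert (T2 := Rmin_r A (- M)). lra. }
  assert (Hb0 : B < b0 /\ M < b0).
  { unfold b0. assert (T1 := Rmax_l B M). assert (T2 := Rmax_r B M). lra. }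
  assert (H0 := HPQ a0 b0 (HA _ (proj1 Ha0)) (HB _ (proj1 Hb0))). simpl in H0.
  apply (C_NormedModule_mixin_compat2 l (CRInt h a0 b0) (mkposreal _ He2)) in H0. simpl in H0.
  replace (sqrt 2 * (eps / 2 / sqrt 2)) with (eps / 2) in H0 by (field; lra).
  exists M. intros a b Ha Hb.
  replace (CRInt h a b - l)%C with ((CRInt h a b - CRInt h a0 b0) + (CRInt h a0 b0 - l))%C by ring.
  eapply Rle_lt_trans. apply Cmod_triangle.
  assert (H3 := HM a b a0 b0 Ha Hb (proj2 Ha0) (proj2 Hb0)).
  change (minus (CRInt h a0 b0) l) with (CRInt h a0 b0 - l)%C in H0. lra.
Qed.

Lemma isI_bound (h : R -> C) (K : R) (l : C) : is_line_int h l -> cauchy_dominated h K -> Cmod l <= K * PI.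
Proof.
  intros [Hc Hl] Hd. apply Rnot_lt_le; intros Hlt.
  assert (HK : 0 <= K).
  { specialize (Hd 0). assert (H := Cmod_ge_0 (h 0)).
    replace (K * / (1 + 0 ^ 2)) with K in Hd by field. lra. }
  destruct (Hl (Cmod l - K * PI)) as [M HM]; [lra |].
  set (b := Rmax M 0 + 1).
  assert (Hb : M < b /\ 0 < b).
  { unfold b. assert (T1 := Rmax_l M 0). assert (T2 := Rmax_r M 0). lra. }
  specialize (HM (- b) b ltac:(lra) ltac:(lra)).
  assert (H1 := RI_dom h K (- b) b Hc Hd ltac:(lra)).
  assert (H2 : Cmod l <= Cmod (CRInt h (- b) b) + Cmod (CRInt h (- b) b - l)).
  { replace l with (CRInt h (- b) b + - (CRInt h (- b) b - l))%C at 1 by ring.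
    eapply Rle_trans. apply Cmod_triangle. rewrite Cmod_opp. lra. }
  assert (T1 := atan_bound b). assert (T2 := atan_bound (- b)). nra.
Qed.

Lemma isI_unique (h : R -> C) (l1 l2 : C) : is_line_int h l1 -> is_line_int h l2 -> l1 = l2.
Proof.
  intros [_ H1] [_ H2].
  assert (Hz : Cmod (l1 - l2) = 0).
  { apply Rle_antisym; [| apply Cmod_ge_0]. apply Rnot_lt_le; intros Hlt.
    destruct (H1 (Cmod (l1 - l2) / 2)) as [M1 HM1]; [lra |].
    destruct (H2 (Cmod (l1 - l2) / 2)) as [M2 HM2]; [lra |].
    set (b := Rmax M1 M2 + 1).
    assert (Hb : M1 < b /\ M2 < b).
    { unfold b. assert (T1 := Rmax_l M1 M2). assert (T2 := Rmax_r M1 M2). lra. }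
    specialize (HM1 (- b) b ltac:(lra) ltac:(lra)).
    specialize (HM2 (- b) b ltac:(lra) ltac:(lra)).
    assert (H : Cmod (l1 - l2) <= Cmod (CRInt h (- b) b - l2) + Cmod (CRInt h (- b) b - l1)).
    { replace (l1 - l2)%C with ((CRInt h (- b) b - l2) + - (CRInt h (- b) b - l1))%C by ring.
      eapply Rle_trans. apply Cmod_triangle. rewrite Cmod_opp. lra. }
    lra. }
  apply Cmod_eq_0 in Hz. replace l1 with ((l1 - l2) + l2)%C by ring. rewrite Hz. ring.
Qed.

Lemma isI_ext (f g : R -> C) (l : C) : (forall u, f u = g u) -> is_line_int f l -> is_line_int g l.
Proof. intros E H. replace g with f by (apply functional_extensionality, E). exact H. Qed.

Lemma isI_plus (f g : R -> C) (lf lg : C) : is_line_int f lf -> is_line_int g lg ->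
  is_line_int (fun u => f u + g u)%C (lf + lg)%C.
Proof.
  intros [Hf H1] [Hg H2]. split; [apply contC_plus; assumption |].
  intros eps He. destruct (H1 (eps / 2)) as [M1 HM1]; [lra |].
  destruct (H2 (eps / 2)) as [M2 HM2]; [lra |].
  exists (Rmax M1 M2). intros a b Ha Hb.
  assert (T1 := Rmax_l M1 M2). assert (T2 := Rmax_r M1 M2).
  specialize (HM1 a b ltac:(lra) ltac:(lra)). specialize (HM2 a b ltac:(lra) ltac:(lra)).
  rewrite RI_plus by assumption.
  replace (CRInt f a b + CRInt g a b - (lf + lg))%C with ((CRInt f a b - lf) + (CRInt g a b - lg))%C by ring.
  eapply Rle_lt_trans. apply Cmod_triangle. lra.
Qed.

Lemma isI_Cmult (c : C) (f : R -> C) (l : C) : is_line_int f l -> is_line_int (fun u => c * f u)%C (c * l)%C.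
Proof.
  intros [Hf H1]. split; [apply contC_mult; [apply contC_const | assumption] |].
  intros eps He. assert (Hc := Cmod_ge_0 c).
  destruct (H1 (eps / (Cmod c + 1))) as [M HM]; [apply Rdiv_lt_0_compat; lra |].
  exists M. intros a b Ha Hb. specialize (HM a b Ha Hb).
  rewrite RI_Cmult by assumption.
  replace (c * CRInt f a b - c * l)%C with (c * (CRInt f a b - l))%C by ring.
  rewrite Cmod_mult. assert (H0 := Cmod_ge_0 (CRInt f a b - l)).
  assert (E : eps = (Cmod c + 1) * (eps / (Cmod c + 1))) by (field; lra).
  rewrite E. nra.
Qed.

Lemma isI_minus (f g : R -> C) (lf lg : C) : is_line_int f lf -> is_line_int g lg ->
  is_line_int (fun u => f u - g u)%C (lf - lg)%C.
Proof.
  intros Hf Hg. replace (lf - lg)%C with (lf + (RtoC (-1)) * lg)%C by ring.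
  apply (isI_ext (fun u => f u + (RtoC (-1)) * g u)%C). { intros u. ring. }
  apply isI_plus, isI_Cmult; assumption.
Qed.

Lemma RI_comp_lin (f : R -> C) (c d a b : R) : contC f ->
  CRInt (fun v => RtoC c * f (c * v + d)%R)%C a b = CRInt f (c * a + d) (c * b + d).
Proof.
  intros Hf. apply RI_unique.
  eapply is_RInt_ext; [ | apply (is_RInt_comp_lin (V := C_R_NormedModule) f c d a b (CRInt f (c * a + d) (c * b + d)))].
  - intros x _. apply scal_C_R.
  - apply is_RI, Hf.
Qed.

Lemma isI_comp_lin (f : R -> C) (l : C) (c d : R) : 0 < c -> is_line_int f l ->
  is_line_int (fun v => RtoC c * f (c * v + d)%R)%C l.
Proof.
  intros Hc [Hf H]. split.
  { apply contC_mult; [apply contC_const |]. apply (contC_comp (fun v => c * v + d)); trivial.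
    apply contR_plus; [apply contR_mult; [apply contR_const | apply contR_id] | apply contR_const]. }
  intros eps He. destruct (H eps He) as [M HM].
  exists ((Rabs M + Rabs d) / c). intros a b Ha Hb.
  assert (T1 := Rle_abs M). assert (T2 := Rle_abs d). assert (T3 := Rle_abs (- d)). rewrite Rabs_Ropp in T3.
  rewrite RI_comp_lin by assumption. apply HM.
  - apply (Rmult_lt_compat_l c) in Ha; trivial.
    replace (c * - ((Rabs M + Rabs d) / c)) with (- (Rabs M + Rabs d)) in Ha by (field; lra). lra.
  - apply (Rmult_lt_compat_l c) in Hb; trivial.
    replace (c * ((Rabs M + Rabs d) / c)) with ((Rabs M + Rabs d)) in Hb by (field; lra). lra.
Qed.

Lemma isI_flip (f : R -> C) (l : C) : is_line_int f l -> is_line_int (fun v => f (- v)%R) l.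
Proof.
  intros [Hf H].
  assert (Hc : contC (fun v => f (- v))).
  { apply (contC_comp (fun v => - v)); trivial.
    intros u; apply (continuous_opp (V := R_NormedModule)), continuous_id. }
  split; [exact Hc |].
  intros eps He. destruct (H eps He) as [M HM]. exists M. intros a b Ha Hb.
  assert (E := RI_comp_lin f (-1) 0 a b Hf).
  replace (fun v => RtoC (-1) * f (-1 * v + 0)%R)%C with (fun v => RtoC (-1) * f (- v)%R)%C in E.
  2:{ apply functional_extensionality; intros v. do 2 f_equal. ring. }
  rewrite RI_Cmult in E by assumption.
  replace (CRInt (fun v => f (- v)) a b) with (CRInt f (- b) (- a)).
  - apply HM; lra.
  - rewrite RI_swap by assumption.
    replace (- b) with (-1 * b + 0) by ring. replace (- a) with (-1 * a + 0) by ring.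
    rewrite <- E. ring.
Qed.

(** Dominated convergence in quantitative form. Even the integrability of g comes from the estimate,
    applied to g - f 0; the rate eps is left arbitrary, and each use shows separately that it tends
    to 0. *)
Lemma isI_limit (f : nat -> R -> C) (l : nat -> C) (g : R -> C) (eps : nat -> R) (K : R) :
  (forall n, is_line_int (f n) (l n)) -> contC g ->
  (forall n u, Cmod (g u - f n u) <= eps n * (K * / (1 + u ^ 2))) ->
  exists L, is_line_int g L /\ forall n, Cmod (l n - L) <= eps n * (K * PI).
Proof.
  intros Hf Hg Hd.
  assert (HD : forall n, cauchy_dominated (fun u => g u - f n u)%C (eps n * K)).
  { intros n u. rewrite Rmult_assoc. apply Hd. }
  assert (HC : forall n, contC (fun u => g u - f n u)%C).
  { intros n. apply (contC_ext (fun u => g u + RtoC (-1) * f n u)%C). { intros; ring. }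
    apply contC_plus; trivial. apply contC_mult; [apply contC_const | apply (Hf n)]. }
  destruct (isI_exists _ _ (HC 0%nat) (HD 0%nat)) as [d Hdd].
  assert (HG : is_line_int g (l 0%nat + d)%C).
  { apply (isI_ext (fun u => f 0%nat u + (g u - f 0%nat u))%C). { intros; ring. }
    apply isI_plus; auto. }
  exists (l 0%nat + d)%C. split; [exact HG |].
  intros n. assert (H := isI_minus _ _ _ _ HG (Hf n)).
  assert (B := isI_bound _ _ _ H (HD n)).
  replace (l n - (l 0%nat + d))%C with (- (l 0%nat + d - l n))%C by ring.
  rewrite Cmod_opp. lra.
Qed.

(** The substitution u = ln t: a right neighbourhood of 0 corresponds to u below -M, and the factor
    1/t is the derivative of ln. *)
Lemma CInt0oo_isI (f h : R -> C) (l : C) : is_line_int h l ->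
  (forall t, 0 < t -> f t = (h (ln t) / RtoC t)%C) -> CInt0oo f = l.
Proof.
  intros [Hc Hl] E. unfold CInt0oo.
  apply (is_RInt_gen_unique (V := C_R_CompleteNormedModule)).
  intros P [eps HP].
  destruct (Hl eps (cond_pos eps)) as [M HM].
  apply (Filter_prod _ _ _ (fun a => 0 < a /\ a < exp (- M)) (fun b => exp M < b)).
  - exists (mkposreal _ (exp_pos (- M))). intros y Hy Hy0. split; trivial.
    change (Rabs (y - 0) < exp (- M)) in Hy. apply Rabs_def2 in Hy. lra.
  - exists (exp M). trivial.
  - intros a b [Ha0 Ha] Hb. simpl.
    assert (Hb0 : 0 < b) by (assert (T := exp_pos M); lra).
    exists (CRInt h (ln a) (ln b)). split.
    + apply (is_RInt_ext (fun t => scal (/ t) (h (ln t)) : C_R_NormedModule)).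
      * intros x Hx. assert (Hx0 : 0 < x) by (assert (T := Rmin_glb_lt a b 0 Ha0 Hb0); lra).
        rewrite E by assumption. unfold Cdiv. rewrite <- RtoC_inv by lra.
        rewrite Cmult_comm. apply scal_C_R.
      * apply (is_RInt_comp (V := C_R_CompleteNormedModule) h ln (fun t => / t)).
        { intros; apply Hc. }
        intros x Hx. assert (Hx0 : 0 < x) by (assert (T := Rmin_glb_lt a b 0 Ha0 Hb0); lra).
        split. apply is_derive_Reals, derivable_pt_lim_ln, Hx0.
        apply continuous_Rinv. lra.
    + apply HP, C_NormedModule_mixin_compat1. apply HM.
      * rewrite <- (ln_exp (- M)). apply ln_increasing; trivial.
      * rewrite <- (ln_exp M). apply ln_increasing; trivial. apply exp_pos.
Qed.

(** * The complex exponential and Mellin transforms of rapidly decaying functions *)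

Notation is_Cseries := (is_series (K := C_AbsRing) (V := C_NormedModule)).

Fixpoint Csum (a : nat -> C) (n : nat) : C :=
  match n with O => a O | S n' => (Csum a n' + a (S n'))%C end.

Lemma sum_n_Csum (a : nat -> C) (n : nat) : sum_n (G := C_AbsRing) a n = Csum a n.
Proof.
  induction n as [| n IH]; [exact (sum_O a) |]. rewrite sum_Sn, IH. reflexivity.
Qed.

Lemma Csum_ext (a b : nat -> C) (n : nat) : (forall k, a k = b k) -> Csum a n = Csum b n.
Proof. intros H; induction n as [| n IH]; simpl; rewrite ?IH, H; reflexivity. Qed.

Lemma Csum_Cmult (c : C) (a : nat -> C) (n : nat) : Csum (fun k => c * a k)%C n = (c * Csum a n)%C.
Proof. induction n as [| n IH]; simpl; rewrite ?IH; ring. Qed.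

Lemma is_series_C (a : nat -> C) (l : C) (eps : nat -> R) :
  (forall n, Cmod (Csum a n - l) <= eps n) -> is_lim_seq eps 0 ->
  is_Cseries a l.
Proof.
  intros H Hl P [d HP].
  assert (H0 : Rbar_lt 0 d) by apply cond_pos.
  assert (Hev := Hl (fun y => Rabs y < d)).
  destruct Hev as [N HN].
  { exists d. intros y Hy. change (Rabs (y - 0) < d) in Hy. now rewrite Rminus_0_r in Hy. }
  exists N. intros n Hn. apply HP, C_NormedModule_mixin_compat1.
  change (Cmod (sum_n (G := C_AbsRing) a n - l) < d). rewrite sum_n_Csum.
  specialize (H n). specialize (HN n Hn). assert (T := Rle_abs (eps n)). lra.
Qed.

Definition Cexp (z : C) : C := (exp (Re z) * cos (Im z), exp (Re z) * sin (Im z)).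

Lemma Cexp_plus (z w : C) : Cexp (z + w) = (Cexp z * Cexp w)%C.
Proof.
  unfold Cexp, Cplus, Cmult, Re, Im; simpl. rewrite exp_plus, cos_plus, sin_plus.
  f_equal; ring.
Qed.

Lemma Cexp_0 : Cexp 0 = RtoC 1.
Proof. unfold Cexp, RtoC; simpl. rewrite exp_0, cos_0, sin_0. f_equal; ring. Qed.

Lemma Cexp_RtoC (x : R) : Cexp (RtoC x) = RtoC (exp x).
Proof. unfold Cexp, RtoC; simpl. rewrite cos_0, sin_0. f_equal; ring. Qed.

Lemma Cmod_Cexp (z : C) : Cmod (Cexp z) = exp (Re z).
Proof.
  unfold Cmod, Cexp; simpl.
  replace (_ + _) with (exp (Re z) * exp (Re z) * ((sin (Im z))² + (cos (Im z))²)) by (unfold Rsqr; ring).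
  rewrite sin2_cos2, Rmult_1_r. apply sqrt_square. left; apply exp_pos.
Qed.

Lemma Cexp_neq_0 (z : C) : Cexp z <> 0.
Proof. apply Cmod_gt_0. rewrite Cmod_Cexp. apply exp_pos. Qed.

Lemma cpow_Cexp (x : R) (s : C) : cpow x s = Cexp (s * RtoC (ln x)).
Proof.
  unfold cpow, Cexp, Cmult, RtoC, Re, Im; simpl.
  replace (fst s * ln x - snd s * 0) with (fst s * ln x) by ring.
  replace (fst s * 0 + snd s * ln x) with (snd s * ln x) by ring. reflexivity.
Qed.

Lemma Cexp_bound (s : C) (u : R) : Cmod (Cexp (s * RtoC u)) <= exp (Cmod s * Rabs u).
Proof.
  rewrite Cmod_Cexp. unfold Cmult, RtoC, Re; simpl.
  replace (fst s * u - snd s * 0) with (Re s * u) by (unfold Re; ring).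
  assert (H : Re s * u <= Cmod s * Rabs u).
  { eapply Rle_trans. apply Rle_abs. rewrite Rabs_mult. apply Rmult_le_compat_r.
    apply Rabs_pos. apply re_le_Cmod. }
  destruct H as [H | ->]; [left; apply exp_increasing, H | lra].
Qed.

Lemma contC_Cexp (s : C) : contC (fun u => Cexp (s * RtoC u)).
Proof.
  unfold Cexp. apply contC_pair; intros u; apply (ex_derive_continuous (V := R_NormedModule));
  unfold Cmult, RtoC, Re, Im; simpl; auto_derive; trivial.
Qed.

(** * Derivatives along the real line and Taylor's bound for the complex exponential *)

Definition is_Cderive (f : R -> C) (t : R) (d : C) : Prop :=
  is_derive (fun x => Re (f x)) t (Re d) /\ is_derive (fun x => Im (f x)) t (Im d).

Lemma is_derive_eq (f : R -> R) (t d d' : R) : d = d' -> is_derive f t d -> is_derive f t d'.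
Proof. now intros ->. Qed.

Lemma isD_mult (f g : R -> C) (t : R) (df dg : C) : is_Cderive f t df -> is_Cderive g t dg ->
  is_Cderive (fun x => f x * g x)%C t (df * g t + f t * dg)%C.
Proof.
  intros [H1 H2] [H3 H4]; split; simpl.
  - assert (A := is_derive_mult _ _ _ _ _ H1 H3 Rmult_comm).
    assert (B := is_derive_mult _ _ _ _ _ H2 H4 Rmult_comm).
    eapply is_derive_eq; [| exact (is_derive_minus (V := R_NormedModule) _ _ _ _ _ A B)].
    unfold minus, plus, opp, mult; simpl. unfold Re, Im. ring.
  - assert (A := is_derive_mult _ _ _ _ _ H1 H4 Rmult_comm).
    assert (B := is_derive_mult _ _ _ _ _ H2 H3 Rmult_comm).
    eapply is_derive_eq; [| exact (is_derive_plus (V := R_NormedModule) _ _ _ _ _ A B)].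
    unfold plus, mult; simpl. unfold Re, Im. ring.
Qed.

Lemma isD_plus (f g : R -> C) (t : R) (df dg : C) : is_Cderive f t df -> is_Cderive g t dg ->
  is_Cderive (fun x => f x + g x)%C t (df + dg)%C.
Proof.
  intros [H1 H2] [H3 H4]; split; simpl; apply (is_derive_plus (V := R_NormedModule)); assumption.
Qed.

Lemma isD_Cexp (z : C) (t : R) : is_Cderive (fun x => Cexp (z * RtoC x)) t (z * Cexp (z * RtoC t))%C.
Proof.
  assert (E : forall x : R, Cexp (z * RtoC x) = (exp (fst z * x) * cos (snd z * x), exp (fst z * x) * sin (snd z * x))).
  { intros x. unfold Cexp, Cmult, RtoC, Re, Im; simpl. do 2 f_equal; f_equal; ring. }
  replace (fun x => Cexp (z * RtoC x)) with (fun x => (exp (fst z * x) * cos (snd z * x), exp (fst z * x) * sin (snd z * x))).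
  2:{ apply functional_extensionality; intros x; symmetry; apply E. }
  rewrite E. split; unfold Cmult, Re, Im; simpl; auto_derive; trivial; ring.
Qed.

Lemma isD_mono (z : C) (n : nat) (t : R) :
  is_Cderive (fun x => (z * RtoC x) ^ S n / RtoC (INR (fact (S n))))%C t
      (z * ((z * RtoC t) ^ n / RtoC (INR (fact n))))%C.
Proof.
  assert (Hp : forall (c : C) m, is_Cderive (fun x => c * RtoC (x ^ S m))%C t (c * RtoC (INR (S m) * t ^ m))%C).
  { intros c m. split; unfold Cmult, RtoC, Re, Im; cbn [fst snd].
    - apply (is_derive_ext (fun x => fst c * x ^ S m)). { intros x; cbn [fst snd]; match goal with |- ?p = ?q => change (@eq R p q) end; ring. }
      auto_derive; trivial. cbn [Nat.pred fst snd]. change (match m with O => 1 | S _ => INR m + 1 end) with (INR (S m)). ring.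
    - apply (is_derive_ext (fun x => snd c * x ^ S m)). { intros x; cbn [fst snd]; match goal with |- ?p = ?q => change (@eq R p q) end; ring. }
      auto_derive; trivial. cbn [Nat.pred fst snd]. change (match m with O => 1 | S _ => INR m + 1 end) with (INR (S m)). ring. }
  assert (Hn : INR (fact n) <> 0) by apply INR_fact_neq_0.
  assert (HS : INR (fact (S n)) <> 0) by apply INR_fact_neq_0.
  replace (fun x => (z * RtoC x) ^ S n / RtoC (INR (fact (S n))))%C
    with (fun x => (z ^ S n / RtoC (INR (fact (S n)))) * RtoC (x ^ S n))%C.
  - replace (z * ((z * RtoC t) ^ n / RtoC (INR (fact n))))%C
      with ((z ^ S n / RtoC (INR (fact (S n)))) * RtoC (INR (S n) * t ^ n))%C.
    + apply Hp.
    + rewrite Cpow_mult_l, RtoC_mult, RtoC_pow.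
      replace (fact (S n)) with (S n * fact n)%nat by reflexivity. rewrite mult_INR, RtoC_mult.
      cbn [Cpow]. field. split; intros E; apply RtoC_inj in E; [now apply Hn | now apply (not_0_INR (S n))].
  - apply functional_extensionality; intros x.
    rewrite Cpow_mult_l, RtoC_pow. unfold Cdiv. ring.
Qed.

Definition exp_taylor (n : nat) (z : C) : C := Csum (fun k => z ^ k / RtoC (INR (fact k)))%C n.

Lemma isD_const (c : C) (t : R) : is_Cderive (fun _ => c) t 0.
Proof. split; apply (is_derive_const (V := R_NormedModule)). Qed.

Lemma isD_Etay (z : C) (n : nat) (t : R) :
  is_Cderive (fun x => exp_taylor (S n) (z * RtoC x)) t (z * exp_taylor n (z * RtoC t))%C.
Proof.
  unfold exp_taylor. induction n as [| n IH].
  - cbn [Csum]. replace (z * ((z * RtoC t) ^ 0 / RtoC (INR (fact 0))))%C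
      with (0 + (z * ((z * RtoC t) ^ 0 / RtoC (INR (fact 0)))))%C by ring.
    apply (isD_plus (fun x => ((z * RtoC x) ^ 0 / RtoC (INR (fact 0)))%C)); [| apply (isD_mono z 0)].
    change (is_Cderive (fun _ => RtoC 1 / RtoC (INR (fact 0)))%C t 0). apply isD_const.
  - change (is_Cderive (fun x : R => Csum (fun k => (z * RtoC x) ^ k / RtoC (INR (fact k)))%C (S n)
        + (z * RtoC x) ^ S (S n) / RtoC (INR (fact (S (S n)))))%C t
      (z * (Csum (fun k => (z * RtoC t) ^ k / RtoC (INR (fact k)))%C n
        + (z * RtoC t) ^ S n / RtoC (INR (fact (S n)))))%C).
    rewrite Cmult_plus_distr_l. apply isD_plus; [exact IH |]. apply isD_mono.
Qed.

Lemma Etay_0 (n : nat) : exp_taylor n 0 = RtoC 1.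
Proof.
  unfold exp_taylor. induction n as [| n IH]; cbn [Csum].
  - simpl. field.
  - rewrite IH. cbn [Cpow]. unfold Cdiv. ring.
Qed.

(** In the derivative of x -> e^(-zx) T(zx), with T the Taylor polynomial, all terms cancel but the
    last one. The mean value theorem applies to real functions only, hence once to each component,
    which costs sqrt 2 <= 2. One factor e^|z| bounds e^(-zx), the other comes from multiplying back
    by e^z. *)
Lemma Cexp_taylor (n : nat) (z : C) :
  Cmod (Cexp z - exp_taylor (S n) z) <= 2 * exp (2 * Cmod z) * Cmod z ^ S (S n) / INR (fact (S n)).
Proof.
  set (M := exp (Cmod z) * Cmod z ^ S (S n) / INR (fact (S n))).
  assert (HF : 0 < INR (fact (S n))) by apply INR_fact_lt_0.
  set (g := fun x => (Cexp (- z * RtoC x) * exp_taylor (S n) (z * RtoC x))%C).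
  set (dg := fun x => ((- z * Cexp (- z * RtoC x)) * ((z * RtoC x) ^ S n / RtoC (INR (fact (S n)))))%C).
  assert (HD : forall t, is_Cderive g t (dg t)).
  { intros t.
    replace (dg t) with ((- z * Cexp (- z * RtoC t)) * exp_taylor (S n) (z * RtoC t)
      + Cexp (- z * RtoC t) * (z * exp_taylor n (z * RtoC t)))%C.
    - apply isD_mult. apply isD_Cexp. apply isD_Etay.
    - unfold dg. unfold exp_taylor. cbn [Csum]. ring. }
  assert (HB : forall t, 0 <= t <= 1 -> Cmod (dg t) <= M).
  { intros t Ht. unfold dg, M. rewrite !Cmod_mult, Cmod_opp, Cmod_div, Cmod_R.
    2:{ intros E; apply RtoC_inj in E; lra. }
    rewrite (Rabs_pos_eq (INR _)) by lra. rewrite Cmod_pow, Cmod_mult, Cmod_R, (Rabs_pos_eq t) by lra.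
    assert (A := Cexp_bound (- z) t). rewrite Cmod_opp, (Rabs_pos_eq t) in A by lra.
    assert (Hz := Cmod_ge_0 z).
    assert (A2 : exp (Cmod z * t) <= exp (Cmod z)).
    { destruct (Rle_lt_or_eq_dec (Cmod z * t) (Cmod z)) as [H | ->]; [nra | left; apply exp_increasing, H | lra]. }
    assert (A3 : (Cmod z * t) ^ S n <= Cmod z ^ S n) by (apply pow_incr; nra).
    assert (A4 : 0 <= (Cmod z * t) ^ S n) by (apply pow_le; nra).
    assert (A5 := Cmod_ge_0 (Cexp (- z * t))).
    replace (exp (Cmod z) * Cmod z ^ S (S n) / INR (fact (S n)))
      with ((Cmod z * exp (Cmod z)) * (Cmod z ^ S n / INR (fact (S n)))) by (change (Cmod z ^ S (S n)) with (Cmod z * Cmod z ^ S n); field; lra).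
    apply Rmult_le_compat.
    - apply Rmult_le_pos; assumption.
    - apply Rmult_le_pos; [assumption | left; apply Rinv_0_lt_compat; lra].
    - apply Rmult_le_compat_l; lra.
    - apply Rmult_le_compat_r; [left; apply Rinv_0_lt_compat; lra | assumption]. }
  assert (Hmvt : forall (p : C -> R), (p = Re \/ p = Im) -> Rabs (p (g 1) - p (g 0)) <= M).
  { intros p Hp.
    assert (Hd : forall t, is_derive (fun x => p (g x)) t (p (dg t))).
    { intros t. destruct (HD t) as [H1 H2]. destruct Hp as [-> | ->]; assumption. }
    destruct (MVT_gen (fun x => p (g x)) 0 1 (fun t => p (dg t))) as [c [Hc1 Hc2]].
    - intros x _. apply Hd.
    - intros x _. apply continuity_pt_filterlim.
      apply (ex_derive_continuous (V := R_NormedModule) (fun x => p (g x))). exists (p (dg x)); apply Hd.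
    - rewrite Hc2, Rminus_0_r, Rmult_1_r.
      rewrite Rmin_left, Rmax_right in Hc1 by lra.
      eapply Rle_trans; [| apply (HB c Hc1)].
      destruct Hp as [-> | ->]; [apply re_le_Cmod |].
      eapply Rle_trans; [| apply Rmax_Cmod]. apply Rmax_r. }
  assert (Hg0 : g 0 = RtoC 1).
  { unfold g. rewrite !Cmult_0_r, Cexp_0, Etay_0. ring. }
  assert (Hdiff : Cmod (g 1 - g 0) <= 2 * M).
  { eapply Rle_trans. apply Cmod_2Rmax.
    assert (H1 := Hmvt Re (or_introl eq_refl)). assert (H2 := Hmvt Im (or_intror eq_refl)).
    assert (HM : Rmax (Rabs (fst (g 1 - g 0)%C)) (Rabs (snd (g 1 - g 0)%C)) <= M).
    { apply Rmax_lub; [exact H1 | exact H2]. }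
    assert (HM0 : 0 <= M). { eapply Rle_trans; [apply Rabs_pos | exact H1]. }
    assert (Hs : sqrt 2 <= 2). { rewrite <- (sqrt_square 2) at 2 by lra. apply sqrt_le_1; lra. }
    assert (Hs0 := sqrt_pos 2).
    eapply Rle_trans. apply Rmult_le_compat_l; [exact Hs0 | exact HM]. nra. }
  replace (Cexp z - exp_taylor (S n) z)%C with (- (Cexp z * (g 1 - g 0)))%C.
  - rewrite Cmod_opp, Cmod_mult.
    assert (A := Cexp_bound z 1). rewrite Cmult_1_r, Rabs_R1, Rmult_1_r in A.
    assert (P1 := Cmod_ge_0 (Cexp z)). assert (P2 := Cmod_ge_0 (g 1 - g 0)).
    replace (2 * exp (2 * Cmod z) * Cmod z ^ S (S n) / INR (fact (S n))) with (exp (Cmod z) * (2 * M)).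
    + apply Rmult_le_compat; assumption.
    + unfold M. replace (2 * Cmod z) with (Cmod z + Cmod z) by ring. rewrite exp_plus. field. lra.
  - rewrite Hg0. unfold g. rewrite !Cmult_1_r.
    replace (Cexp z * (Cexp (- z) * exp_taylor (S n) z - 1))%C
      with (Cexp (z + - z) * exp_taylor (S n) z - Cexp z)%C by (rewrite Cexp_plus; ring).
    replace (z + - z)%C with (RtoC 0) by ring. rewrite Cexp_0. ring.
Qed.

(** * Rapidly decaying functions and their Mellin transforms *)

Definition rapid (phi : R -> R) : Prop :=
  contR phi /\ forall sigma : R, exists K, forall u, Rabs (phi u) * exp (sigma * Rabs u) <= K.

Lemma exp_le (x y : R) : x <= y -> exp x <= exp y.
Proof. intros [H | ->]; [left; apply exp_increasing, H | lra]. Qed.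

Lemma exp_quad (u : R) : 1 + u ^ 2 <= 2 * exp (Rabs u).
Proof.
  assert (H := exp_ge_taylor (Rabs u) 2 (Rabs_pos u)). simpl in H.
  assert (P := Rabs_pos u). assert (E : Rabs u * Rabs u = u * u) by (rewrite <- Rabs_mult; apply Rabs_pos_eq; nra).
  simpl. nra.
Qed.

Lemma rapid_dom (phi : R -> R) (sigma : R) : rapid phi ->
  exists K, forall u, Rabs (phi u) * exp (sigma * Rabs u) <= K * / (1 + u ^ 2).
Proof.
  intros [_ H]. destruct (H (sigma + 1)) as [K HK]. exists (2 * K). intros u.
  specialize (HK u). rewrite Rmult_plus_distr_r, exp_plus, Rmult_1_l in HK.
  assert (Q := exp_quad u). assert (P : 0 < 1 + u ^ 2) by nra.
  apply (Rmult_le_reg_r (1 + u ^ 2)); trivial. rewrite (Rmult_assoc (2 * K)), Rinv_l, Rmult_1_r by lra.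
  assert (P1 := Rabs_pos (phi u)). assert (P2 := exp_pos (sigma * Rabs u)).
  assert (P3 : 0 <= Rabs (phi u) * exp (sigma * Rabs u)) by nra. nra.
Qed.

Lemma rapid_weight_isI (phi : R -> R) (s : C) : rapid phi ->
  exists l, is_line_int (fun u => RtoC (phi u) * Cexp (s * RtoC u))%C l.
Proof.
  intros Hr. destruct (rapid_dom phi (Cmod s) Hr) as [K HK].
  apply (isI_exists _ K).
  - apply contC_mult; [apply contC_RtoC, Hr | apply contC_Cexp].
  - intros u. eapply Rle_trans; [| apply HK]. rewrite Cmod_mult, Cmod_R.
    apply Rmult_le_compat_l; [apply Rabs_pos | apply Cexp_bound].
Qed.

Definition mellin (phi : R -> R) (s : C) : C :=
  epsilon (inhabits (RtoC 0)) (is_line_int (fun u => RtoC (phi u) * Cexp (s * RtoC u))%C).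

Lemma Mel_spec (phi : R -> R) (s : C) : rapid phi ->
  is_line_int (fun u => RtoC (phi u) * Cexp (s * RtoC u))%C (mellin phi s).
Proof.
  intros H. unfold mellin. apply epsilon_spec. apply rapid_weight_isI, H.
Qed.

Lemma Mel_unique (phi : R -> R) (s l : C) : rapid phi ->
  is_line_int (fun u => RtoC (phi u) * Cexp (s * RtoC u))%C l -> mellin phi s = l.
Proof. intros Hr H. apply (isI_unique _ _ _ (Mel_spec phi s Hr) H). Qed.

Lemma pow_fact_le_exp (x : R) (n : nat) : 0 <= x -> x ^ n / INR (fact n) <= exp x.
Proof.
  intros Hx. eapply Rle_trans; [| apply (exp_ge_taylor x n Hx)].
  destruct n as [| n]; [simpl; lra |]. rewrite tech5.
  assert (H : 0 <= sum_f_R0 (fun k => x ^ k / INR (fact k)) n).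
  { apply cond_pos_sum. intros k. apply Rmult_le_pos; [apply pow_le, Hx | left; apply Rinv_0_lt_compat, INR_fact_lt_0]. }
  lra.
Qed.

Lemma rapid_mult_pow (phi : R -> R) (k : nat) : rapid phi -> rapid (fun u => phi u * u ^ k).
Proof.
  intros [Hc H]. split.
  - apply contR_mult; trivial. intros u. apply (ex_derive_continuous (V := R_NormedModule)). auto_derive; trivial.
  - intros sigma. destruct (H (sigma + 1)) as [K HK]. exists (K * INR (fact k)). intros u.
    rewrite Rabs_mult, <- RPow_abs.
    assert (P := pow_fact_le_exp (Rabs u) k (Rabs_pos u)).
    assert (F := INR_fact_lt_0 k).
    assert (P' : Rabs u ^ k <= exp (Rabs u) * INR (fact k)).
    { apply (Rmult_le_compat_r (INR (fact k))) in P; [| lra].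
      unfold Rdiv in P. rewrite Rmult_assoc, Rinv_l in P by lra. lra. }
    specialize (HK u). rewrite Rmult_plus_distr_r, exp_plus, Rmult_1_l in HK.
    assert (P1 := Rabs_pos (phi u)). assert (P2 := exp_pos (sigma * Rabs u)).
    assert (P3 : 0 <= Rabs (phi u) * exp (sigma * Rabs u)) by nra.
    apply Rle_trans with (Rabs (phi u) * exp (sigma * Rabs u) * (exp (Rabs u) * INR (fact k))).
    + replace (Rabs (phi u) * Rabs u ^ k * exp (sigma * Rabs u))
        with (Rabs (phi u) * exp (sigma * Rabs u) * Rabs u ^ k) by ring.
      apply Rmult_le_compat_l; assumption.
    + rewrite <- Rmult_assoc. apply Rmult_le_compat_r; [lra |]. rewrite Rmult_assoc. exact HK.
Qed.

Lemma is_pseries_C (a : nat -> C) (w l : C) :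
  is_Cseries (fun k => w ^ k * a k)%C l ->
  is_pseries (K := C_AbsRing) (V := C_NormedModule) a w l.
Proof.
  intros H. unfold is_pseries. eapply is_series_ext; [| exact H].
  reflexivity.
Qed.

(** The expansion at s0 is obtained by integrating the Taylor series of e^((z - s0) u) term by term:
    the k-th coefficient is the transform of phi u^k / k!, and u^k preserves rapid decay. *)
Lemma Mel_entire (phi : R -> R) : rapid phi -> entire (mellin phi).
Proof.
  intros Hr s0.
  exists (fun k => mellin (fun u => phi u * u ^ k)%R s0 / RtoC (INR (fact k)))%C.
  (* The estimate below holds for every z, so any radius serves. *)
  exists (mkposreal 1 Rlt_0_1). intros z _. apply is_pseries_C.
  set (w := (z - s0)%C).
  (* With x = |w u|, the remainder 2 e^(2x) x^(n+2) / (n+1)! is at most 2 * 2^(-(n+1)) e^(5x): 2x is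
     already in the exponent, x <= e^x adds one more, and (2x)^(n+1) / (n+1)! <= e^(2x) adds two
     while producing the geometric rate. *)
  destruct (rapid_dom phi (Cmod s0 + 5 * Cmod w) Hr) as [K HK].
  set (f := fun n u => (RtoC (phi u) * Cexp (s0 * RtoC u) * exp_taylor n (w * RtoC u))%C).
  set (a := fun k => (w ^ k * (mellin (fun u => phi u * u ^ k)%R s0 / RtoC (INR (fact k))))%C).
  assert (Hf : forall n, is_line_int (f n) (Csum a n)).
  { assert (Ha : forall k, is_line_int (fun u => RtoC (phi u) * Cexp (s0 * RtoC u) * ((w * RtoC u) ^ k / RtoC (INR (fact k))))%C (a k)).
    { intros k. assert (HF : INR (fact k) <> 0) by apply INR_fact_neq_0.
      replace (a k) with ((w ^ k / RtoC (INR (fact k))) * mellin (fun u => phi u * u ^ k)%R s0)%C.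
      2:{ unfold a. field. intros E; apply RtoC_inj in E; contradiction. }
      eapply isI_ext; [| apply isI_Cmult, Mel_spec, rapid_mult_pow, Hr].
      intros u. cbn beta. rewrite Cpow_mult_l, RtoC_mult, RtoC_pow. field.
      intros E; apply RtoC_inj in E; contradiction. }
    intros n. induction n as [| n IH]; unfold f, exp_taylor; cbn [Csum].
    - apply Ha.
    - eapply isI_ext; [| apply isI_plus; [exact IH | apply (Ha (S n))]].
      intros u. unfold f, exp_taylor. cbn beta. ring. }
  assert (HM := Mel_spec phi z Hr).
  destruct (isI_limit (fun n => f (S n)) (fun n => Csum a (S n)) (fun u => RtoC (phi u) * Cexp (z * RtoC u))%C
     (fun n => 2 * (/ 2) ^ S n) K) as [L [HL HL2]].
  - intros n; apply Hf.
  - apply HM.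
  - intros n u. unfold f.
    replace (z * RtoC u)%C with (s0 * RtoC u + w * RtoC u)%C by (unfold w; ring).
    rewrite Cexp_plus.
    replace (RtoC (phi u) * (Cexp (s0 * RtoC u) * Cexp (w * RtoC u)) - RtoC (phi u) * Cexp (s0 * RtoC u) * exp_taylor (S n) (w * RtoC u))%C
      with (RtoC (phi u) * (Cexp (s0 * RtoC u) * (Cexp (w * RtoC u) - exp_taylor (S n) (w * RtoC u))))%C by ring.
    rewrite !Cmod_mult, Cmod_R.
    assert (T := Cexp_taylor n (w * RtoC u)). rewrite Cmod_mult, Cmod_R in T.
    set (x := Cmod w * Rabs u) in *.
    assert (Hx : 0 <= x) by (apply Rmult_le_pos; [apply Cmod_ge_0 | apply Rabs_pos]).
    assert (HF := INR_fact_lt_0 (S n)).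
    assert (T2 : 2 * exp (2 * x) * x ^ S (S n) / INR (fact (S n)) <= 2 * (/ 2) ^ S n * exp (5 * x)).
    { assert (A := pow_fact_le_exp (2 * x) (S n) ltac:(lra)).
      assert (B : x <= exp x) by (assert (B := exp_ineq1_le x); lra).
      replace (5 * x) with (2 * x + x + 2 * x) by ring. rewrite !exp_plus.
      replace (2 * exp (2 * x) * x ^ S (S n) / INR (fact (S n)))
        with (2 * (/ 2) ^ S n * (exp (2 * x) * x * ((2 * x) ^ S n / INR (fact (S n))))).
      - apply Rmult_le_compat_l. { apply Rmult_le_pos; [lra | apply pow_le; lra]. }
        assert (E1 := exp_pos (2 * x)).
        assert (E3 : 0 <= (2 * x) ^ S n / INR (fact (S n))).
        { apply Rmult_le_pos; [apply pow_le; lra | left; apply Rinv_0_lt_compat; lra]. }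
        apply Rmult_le_compat; trivial. nra. apply Rmult_le_compat_l; lra.
      - assert (E2 : (/ 2) ^ S n * 2 ^ S n = 1) by (rewrite <- Rpow_mult_distr; replace (/ 2 * 2) with 1 by field; apply pow1).
        rewrite Rpow_mult_distr.
        replace (2 * (/ 2) ^ S n * (exp (2 * x) * x * (2 ^ S n * x ^ S n / INR (fact (S n)))))
          with (((/ 2) ^ S n * 2 ^ S n) * (2 * (exp (2 * x) * x * (x ^ S n / INR (fact (S n)))))) by (field; lra).
        rewrite E2. change (x ^ S (S n)) with (x * x ^ S n). field. lra. }
    specialize (HK u). rewrite Rmult_plus_distr_r, exp_plus in HK.
    replace (5 * Cmod w * Rabs u) with (5 * x) in HK by (unfold x; ring).
    assert (B := Cexp_bound s0 u).
    eapply Rle_trans.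
    { apply Rmult_le_compat_l; [apply Rabs_pos |].
      apply Rmult_le_compat; [apply Cmod_ge_0 | apply Cmod_ge_0 | exact B | eapply Rle_trans; [exact T | exact T2]]. }
    replace (Rabs (phi u) * (exp (Cmod s0 * Rabs u) * (2 * (/ 2) ^ S n * exp (5 * x))))
      with (2 * (/ 2) ^ S n * (Rabs (phi u) * (exp (Cmod s0 * Rabs u) * exp (5 * x)))) by ring.
    apply Rmult_le_compat_l; [| exact HK]. apply Rmult_le_pos; [lra | apply pow_le; lra].
  - rewrite (isI_unique _ _ _ HL HM) in HL2.
    apply is_series_C with (eps := fun n => match n with O => Cmod (Csum a 0 - mellin phi z) | S m => 2 * (/ 2) ^ S m * (K * PI) end).
    + intros [| n]; [apply Rle_refl | apply HL2].
    + apply is_lim_seq_incr_1.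
      replace (Finite 0) with (Rbar_mult (Rbar_mult 2 0) (K * PI)) by (simpl; f_equal; ring).
      apply (is_lim_seq_scal_r _ (K * PI)), (is_lim_seq_scal_l _ 2).
      apply (is_lim_seq_incr_1 (fun n => (/ 2) ^ n)), is_lim_seq_geom. rewrite Rabs_pos_eq; lra.
Qed.

(** * Analytic and meromorphic functions *)

Lemma locally_C_intro (s : C) (P : C -> Prop) (d : R) :
  0 < d -> (forall z, Cmod (z - s) < d -> P z) -> locally s P.
Proof.
  intros Hd H. assert (Hs : 0 < sqrt 2) by (apply sqrt_lt_R0; lra).
  assert (He : 0 < d / sqrt 2) by (apply Rdiv_lt_0_compat; lra).
  exists (mkposreal _ He). intros z Hz. apply H.
  apply (C_NormedModule_mixin_compat2 s z (mkposreal _ He)) in Hz. simpl in Hz.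
  replace (sqrt 2 * (d / sqrt 2)) with d in Hz by (field; lra). exact Hz.
Qed.

Lemma locally_C_elim (s : C) (P : C -> Prop) : locally s P ->
  exists d, 0 < d /\ forall z, Cmod (z - s) < d -> P z.
Proof.
  intros [d H]. exists d. split; [apply cond_pos |].
  intros z Hz. apply H, C_NormedModule_mixin_compat1, Hz.
Qed.

Notation is_Cpseries := (is_pseries (K := C_AbsRing) (V := C_NormedModule)).

Definition ps_near (a : nat -> C) (r : R) (F : C -> C) : Prop :=
  0 < r /\ forall w, Cmod w < r -> is_Cpseries a w (F w).

Lemma analytic_intro (f : C -> C) (s : C) (a : nat -> C) (r : R) :
  ps_near a r (fun w => f (s + w)%C) -> analytic_at f s.
Proof.
  intros [Hr H]. exists a. apply (locally_C_intro s _ r Hr).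
  intros z Hz. specialize (H _ Hz). simpl in H.
  replace (s + (z - s))%C with z in H by ring. exact H.
Qed.

Lemma analytic_elim (f : C -> C) (s : C) : analytic_at f s ->
  exists a r, ps_near a r (fun w => f (s + w)%C).
Proof.
  intros [a H]. apply locally_C_elim in H. destruct H as [r [Hr H]].
  exists a, r. split; [exact Hr |]. intros w Hw.
  specialize (H (s + w)%C). replace (s + w - s)%C with w in H by ring. auto.
Qed.

Lemma is_series_C_elim (a : nat -> C) (l : C) :
  is_Cseries a l ->
  forall eps, 0 < eps -> exists N, forall n, (N <= n)%nat -> Cmod (Csum a n - l) < eps.
Proof.
  intros H eps He.
  assert (Hl : locally (T := C_UniformSpace) l (fun z => Cmod (z - l) < eps)).
  { apply (locally_C_intro l _ eps He). trivial. }
  destruct (H _ Hl) as [N HN]. exists N. intros n Hn.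
  rewrite <- sum_n_Csum. apply (HN n Hn).
Qed.

Lemma psC_series (a : nat -> C) (w l : C) : is_Cpseries a w l ->
  is_Cseries (fun k => w ^ k * a k)%C l.
Proof. intros H; exact H. Qed.

Lemma series_terms_bounded (b : nat -> C) (l : C) :
  is_Cseries b l -> exists M, forall k, Cmod (b k) <= M.
Proof.
  intros H. destruct (is_series_C_elim b l H 1 Rlt_0_1) as [N HN].
  assert (Hfin : exists M, 2 <= M /\ forall k, (k <= N)%nat -> Cmod (b k) <= M).
  { clear. induction N as [| N [M [HM H]]].
    - exists (Rmax 2 (Cmod (b 0%nat))). split; [apply Rmax_l |]. intros k Hk.
      replace k with 0%nat by lia. apply Rmax_r.
    - exists (Rmax M (Cmod (b (S N)))). assert (T1 := Rmax_l M (Cmod (b (S N)))).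
      assert (T2 := Rmax_r M (Cmod (b (S N)))). split; [lra |]. intros k Hk.
      destruct (Nat.eq_dec k (S N)) as [-> | Hne]; [exact T2 |].
      specialize (H k ltac:(lia)). lra. }
  destruct Hfin as [M [HM H0]]. exists M. intros k.
  destruct (Nat.le_gt_cases k N) as [Hk | Hk]; [auto |].
  destruct k as [| k]; [lia |].
  replace (b (S k)) with ((Csum b (S k) - l) + - (Csum b k - l))%C by (simpl; ring).
  eapply Rle_trans. apply Cmod_triangle. rewrite Cmod_opp.
  assert (H1 := HN (S k) ltac:(lia)). assert (H2 := HN k ltac:(lia)). lra.
Qed.

Lemma C_eq_of_small (z w : C) : (forall eps, 0 < eps -> Cmod (z - w) < eps) -> z = w.
Proof.
  intros H. assert (Hz : Cmod (z - w) = 0).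
  { apply Rle_antisym; [| apply Cmod_ge_0]. apply Rnot_lt_le. intros Hlt. specialize (H _ Hlt). lra. }
  apply Cmod_eq_0 in Hz. replace z with ((z - w) + w)%C by ring. rewrite Hz. ring.
Qed.

Lemma Csub_neq_0 (z c : C) : z <> c -> (z - c)%C <> 0.
Proof. intros H E. apply H. replace z with ((z - c) + c)%C by ring. rewrite E. ring. Qed.

Lemma ps_near_continuous (a : nat -> C) (r : R) (F : C -> C) : ps_near a r F ->
  forall eps, 0 < eps -> exists d, 0 < d /\ d <= r /\
    forall w, Cmod w < d -> Cmod (F w - a 0%nat) < eps.
Proof.
  intros [Hr H] eps He.
  assert (Hw0 : Cmod (RtoC (r / 2)) < r) by (rewrite Cmod_R, Rabs_pos_eq; lra).
  destruct (series_terms_bounded _ _ (psC_series _ _ _ (H _ Hw0))) as [M HM].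
  assert (HM0 : 0 <= M). { eapply Rle_trans; [apply Cmod_ge_0 | apply (HM 0%nat)]. }
  (* With x = |w| / (r/2) <= 1/2 the terms are at most M x^k, so those past the constant one add up
     to at most 2 M x; the second bound on d makes this smaller than eps / 2. *)
  set (d := Rmin (r / 4) (r * eps / (8 * (M + 1)))).
  assert (Hd1 : d <= r / 4) by apply Rmin_l.
  assert (Hd2 : d <= r * eps / (8 * (M + 1))) by apply Rmin_r.
  assert (Hd : 0 < d).
  { apply Rmin_pos; [lra |]. apply Rdiv_lt_0_compat; [nra | lra]. }
  exists d. split; [exact Hd |]. split; [lra |].
  intros w Hw. set (x := Cmod w / (r / 2)).
  assert (Hx0 : 0 <= x) by (apply Rmult_le_pos; [apply Cmod_ge_0 | left; apply Rinv_0_lt_compat; lra]).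
  assert (Ex : Cmod w = x * (r / 2)) by (unfold x; field; lra).
  assert (Hx1 : x <= / 2) by nra.
  assert (Hterm : forall k, Cmod (w ^ k * a k) <= M * x ^ k).
  { intros k. specialize (HM k). rewrite Cmod_mult, Cmod_pow in HM |- *.
    rewrite Cmod_R, Rabs_pos_eq in HM by lra. rewrite Ex, Rpow_mult_distr.
    assert (P := pow_le x k Hx0). nra. }
  assert (Hpart : forall n, Cmod (Csum (fun k => w ^ k * a k)%C n - a 0%nat) <= M * x * (2 - 2 * (/ 2) ^ n)).
  { intros n. induction n as [| n IH]; cbn [Csum].
    - replace (w ^ 0 * a 0%nat - a 0%nat)%C with (RtoC 0) by (simpl; ring).
      rewrite Cmod_0. simpl. lra.
    - replace (Csum (fun k => w ^ k * a k) n + w ^ S n * a (S n) - a 0%nat)%C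
        with ((Csum (fun k => w ^ k * a k) n - a 0%nat) + w ^ S n * a (S n))%C by ring.
      eapply Rle_trans. apply Cmod_triangle.
      assert (T := Hterm (S n)). change (x ^ S n) with (x * x ^ n) in T.
      change ((/ 2) ^ S n) with (/ 2 * (/ 2) ^ n).
      assert (P : x ^ n <= (/ 2) ^ n) by (apply pow_incr; lra).
      assert (P2 : 0 <= M * x) by nra.
      assert (Q : M * (x * x ^ n) <= M * x * (/ 2) ^ n) by nra.
      lra. }
  destruct (is_series_C_elim _ _ (psC_series _ _ _ (H w ltac:(lra))) (eps / 2) ltac:(lra)) as [N HN].
  specialize (HN N (le_n N)). specialize (Hpart N).
  replace (F w - a 0%nat)%C with (- (Csum (fun k => w ^ k * a k)%C N - F w) + (Csum (fun k => w ^ k * a k)%C N - a 0%nat))%C by ring.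
  eapply Rle_lt_trans. apply Cmod_triangle. rewrite Cmod_opp.
  assert (P : 0 < (/ 2) ^ N) by (apply pow_lt; lra).
  assert (P2 : 0 <= M * x) by nra.
  assert (P3 : 2 * (M * x) < eps / 2).
  { assert (Hxd : x * (r / 2) < r * eps / (8 * (M + 1))) by lra.
    assert (Hxd2 : x < eps / (4 * (M + 1))).
    { apply (Rmult_lt_reg_r (r / 2)); [lra |].
      replace (eps / (4 * (M + 1)) * (r / 2)) with (r * eps / (8 * (M + 1))) by (field; lra). exact Hxd. }
    assert (E : eps = 4 * (M + 1) * (eps / (4 * (M + 1)))) by (field; lra).
    nra. }
  nra.
Qed.

Lemma ps_near_0 (a : nat -> C) (r : R) (F : C -> C) : ps_near a r F -> F 0 = a 0%nat.
Proof.
  intros H. apply C_eq_of_small. intros eps He.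
  destruct (ps_near_continuous a r F H eps He) as [d [Hd [_ H2]]]. apply H2. rewrite Cmod_0. exact Hd.
Qed.

Lemma analytic_continuous (f : C -> C) (s : C) : analytic_at f s ->
  forall eps, 0 < eps -> exists d, 0 < d /\ forall z, Cmod (z - s) < d -> Cmod (f z - f s) < eps.
Proof.
  intros Hf eps He. destruct (analytic_elim f s Hf) as [a [r H]].
  destruct (ps_near_continuous a r _ H eps He) as [d [Hd [_ H2]]].
  assert (E := ps_near_0 _ _ _ H). simpl in E. rewrite Cplus_0_r in E.
  exists d. split; [exact Hd |]. intros z Hz. specialize (H2 (z - s)%C Hz).
  rewrite <- E in H2. replace (s + (z - s))%C with z in H2 by ring. exact H2.
Qed.

(** Division by w. At w = 0 the quotient would be a dummy value and is replaced by [a 1], so that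
    the shifted series represents it on the whole disc. *)
Lemma ps_near_shift (a : nat -> C) (r : R) (F : C -> C) : ps_near a r F ->
  exists G, ps_near (fun k => a (S k)) r G /\ forall w : C, w <> 0 -> G w = ((F w - a 0%nat) / w)%C.
Proof.
  intros [Hr H].
  exists (fun w => if excluded_middle_informative (w = RtoC 0) then a 1%nat else ((F w - a 0%nat) / w)%C).
  split; [split; [exact Hr |] |].
  - intros w Hw. destruct (excluded_middle_informative (w = RtoC 0)) as [-> | Hne].
    + apply (is_pseries_0 (K := C_AbsRing) (V := C_NormedModule) (fun k => a (S k))).
    + assert (E := is_pseries_decr_1 (K := C_AbsRing) (V := C_NormedModule) a w (/ w)%C (F w) (Cinv_l w Hne) (H w Hw)).
      assert (E2 : ((F w - a 0%nat) / w)%C = scal (K := C_Ring) (V := C_NormedModule) (/ w)%C (plus (G := C_NormedModule) (F w) (opp (G := C_NormedModule) (a 0%nat)))).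
      { unfold Cdiv. rewrite Cmult_comm. reflexivity. }
      rewrite E2. exact E.
  - intros w Hw. destruct (excluded_middle_informative (w = RtoC 0)); [contradiction | reflexivity].
Qed.

(** Zeros that accumulate at the centre force the constant term to vanish by continuity, and
    division by w passes them on to the next coefficient. *)
Lemma ps_near_zeros (a : nat -> C) (r : R) (F : C -> C) : ps_near a r F ->
  (forall d, 0 < d -> exists w : C, w <> 0 /\ Cmod w < d /\ F w = 0) -> forall k, a k = 0.
Proof.
  intros H Hz k. revert a F H Hz. induction k as [| k IH]; intros a F H Hz.
  - apply C_eq_of_small. intros eps He.
    destruct (ps_near_continuous a r F H eps He) as [d [Hd [_ H2]]].
    destruct (Hz d Hd) as [w [_ [Hw Ew]]]. specialize (H2 w Hw). rewrite Ew in H2.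
    replace (a 0%nat - 0)%C with (- (0 - a 0%nat))%C by ring. now rewrite Cmod_opp.
  - assert (E0 : a 0%nat = 0).
    { apply C_eq_of_small. intros eps He.
      destruct (ps_near_continuous a r F H eps He) as [d [Hd [_ H2]]].
      destruct (Hz d Hd) as [w [_ [Hw Ew]]]. specialize (H2 w Hw). rewrite Ew in H2.
      replace (a 0%nat - 0)%C with (- (0 - a 0%nat))%C by ring. now rewrite Cmod_opp. }
    destruct (ps_near_shift a r F H) as [G [HG1 HG2]].
    apply (IH (fun k => a (S k)) G HG1). intros d Hd.
    destruct (Hz d Hd) as [w [Hw0 [Hw Ew]]]. exists w. repeat split; trivial.
    rewrite HG2, Ew, E0 by assumption. unfold Cdiv. ring.
Qed.

Lemma ps_near_identity (a : nat -> C) (r : R) (F : C -> C) : ps_near a r F ->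
  (forall d, 0 < d -> exists w : C, w <> 0 /\ Cmod w < d /\ F w = 0) ->
  forall w, Cmod w < r -> F w = 0.
Proof.
  intros H Hz w Hw. assert (Ha := ps_near_zeros a r F H Hz).
  destruct H as [_ H]. apply C_eq_of_small. intros eps He.
  destruct (is_series_C_elim _ _ (psC_series _ _ _ (H w Hw)) eps He) as [N HN].
  specialize (HN N (le_n N)).
  assert (E : Csum (fun k => w ^ k * a k)%C N = 0).
  { clear HN. induction N as [| N IH]; cbn [Csum]; rewrite Ha, ?IH; ring. }
  rewrite E in HN. replace (F w - 0)%C with (- (0 - F w))%C by ring. now rewrite Cmod_opp.
Qed.

Lemma analytic_plus (f g : C -> C) (s : C) : analytic_at f s -> analytic_at g s ->
  analytic_at (fun z => f z + g z)%C s.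
Proof.
  intros Hf Hg. destruct (analytic_elim f s Hf) as [a [r1 [Hr1 H1]]].
  destruct (analytic_elim g s Hg) as [b [r2 [Hr2 H2]]].
  apply (analytic_intro _ s (PS_plus a b) (Rmin r1 r2)). split; [apply Rmin_pos; assumption |].
  intros w Hw. assert (T1 := Rmin_l r1 r2). assert (T2 := Rmin_r r1 r2).
  apply (is_pseries_plus (K := C_AbsRing) (V := C_NormedModule)); [apply H1 | apply H2]; lra.
Qed.

Lemma analytic_opp (f : C -> C) (s : C) : analytic_at f s -> analytic_at (fun z => - f z)%C s.
Proof.
  intros Hf. destruct (analytic_elim f s Hf) as [a [r1 [Hr1 H1]]].
  apply (analytic_intro _ s (PS_opp a) r1). split; [assumption |].
  intros w Hw. apply (is_pseries_opp (K := C_AbsRing) (V := C_NormedModule)), H1, Hw.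
Qed.

Lemma analytic_mult_shift (f : C -> C) (s : C) : analytic_at f s ->
  analytic_at (fun z => (z - s) * f z)%C s.
Proof.
  intros Hf. destruct (analytic_elim f s Hf) as [a [r1 [Hr1 H1]]].
  apply (analytic_intro _ s (PS_incr_1 a) r1). split; [assumption |].
  intros w Hw. replace (s + w - s)%C with w by ring.
  apply (is_pseries_incr_1 (K := C_AbsRing) (V := C_NormedModule) a w (f (s + w)%C)), H1, Hw.
Qed.

Lemma analytic_mult_pow (f : C -> C) (s : C) (k : nat) : analytic_at f s ->
  analytic_at (fun z => (z - s) ^ k * f z)%C s.
Proof.
  intros Hf. induction k as [| k IH].
  - replace (fun z => (z - s) ^ 0 * f z)%C with f; [exact Hf |].
    apply functional_extensionality; intros z; simpl; ring.
  - replace (fun z => (z - s) ^ S k * f z)%C with (fun z => (z - s) * ((z - s) ^ k * f z))%C.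
    + apply (analytic_mult_shift _ _ IH).
    + apply functional_extensionality; intros z; simpl; ring.
Qed.

Lemma analytic_const (c s : C) : analytic_at (fun _ => c) s.
Proof.
  apply (analytic_intro _ s (fun k => match k with O => c | _ => RtoC 0 end) 1). split; [lra |].
  intros w _. apply is_pseries_C, (is_series_C _ _ (fun _ => 0)); [| apply is_lim_seq_const].
  intros n. replace (Csum _ n) with c.
  - replace (c - c)%C with (RtoC 0) by ring. rewrite Cmod_0. lra.
  - induction n as [| n IH]; cbn [Csum]; [simpl; ring | rewrite <- IH; ring].
Qed.

Lemma analytic_local (f g : C -> C) (s : C) (r : R) : 0 < r ->
  (forall z, Cmod (z - s) < r -> f z = g z) -> analytic_at f s -> analytic_at g s.
Proof.
  intros Hr E Hf. destruct (analytic_elim f s Hf) as [a [r1 [Hr1 H1]]].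
  apply (analytic_intro _ s a (Rmin r r1)). split; [apply Rmin_pos; assumption |].
  intros w Hw. assert (T1 := Rmin_l r r1). assert (T2 := Rmin_r r r1).
  rewrite <- E; [apply H1; lra |]. replace (s + w - s)%C with w by ring. lra.
Qed.

Lemma analytic_inv (c s : C) : s <> c -> analytic_at (fun z => / (z - c))%C s.
Proof.
  intros Hsc. set (q := (s - c)%C).
  assert (Hq : q <> 0) by apply Csub_neq_0, Hsc.
  assert (Hq0 : 0 < Cmod q) by now apply Cmod_gt_0.
  apply (analytic_intro _ s (fun k => (- / q) ^ k * / q)%C (Cmod q / 2)). split; [lra |].
  intros w Hw. set (x := (w * - / q)%C).
  assert (Hx : Cmod x <= / 2).
  { unfold x. rewrite Cmod_mult, Cmod_opp, Cmod_inv by assumption.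
    apply (Rmult_le_reg_r (Cmod q)); trivial. rewrite Rmult_assoc, Rinv_l by lra. lra. }
  assert (H1x : / 2 <= Cmod (1 - x)).
  { assert (T := Cmod_triangle (1 - x) x). replace (1 - x + x)%C with (RtoC 1) in T by ring.
    rewrite Cmod_1 in T. lra. }
  assert (H1x0 : (1 - x)%C <> 0) by (apply Cmod_gt_0; lra).
  assert (Eq : (/ (s + w - c))%C = (/ q * / (1 - x))%C).
  { replace (s + w - c)%C with (q * (1 - x))%C by (unfold x, q; field; exact Hq).
    field. split; assumption. }
  rewrite Eq. apply is_pseries_C, (is_series_C _ _ (fun n => Cmod (/ q) * (2 * (/ 2) ^ S n))).
  - intros n.
    replace (Csum (fun k => w ^ k * ((- / q) ^ k * / q))%C n) with (/ q * Csum (fun k => x ^ k)%C n)%C.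
    2:{ rewrite <- Csum_Cmult. apply Csum_ext. intros k. unfold x. rewrite Cpow_mult_l. ring. }
    assert (Eg : Csum (fun k => x ^ k)%C n = ((1 - x ^ S n) * / (1 - x))%C).
    { induction n as [| n IH]; cbn [Csum].
      - replace (x ^ 1)%C with x by (simpl; ring). replace (x ^ 0)%C with (RtoC 1) by reflexivity.
        field. exact H1x0.
      - rewrite IH. replace (x ^ S (S n))%C with (x * x ^ S n)%C by reflexivity. field. exact H1x0. }
    rewrite Eg.
    replace (/ q * ((1 - x ^ S n) * / (1 - x)) - / q * / (1 - x))%C with (/ q * (- (x ^ S n * / (1 - x))))%C by ring.
    rewrite Cmod_mult, Cmod_opp, Cmod_mult, Cmod_pow, Cmod_inv by assumption.
    rewrite (Cmod_inv (1 - x)) by assumption.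
    apply Rmult_le_compat_l; [left; apply Rinv_0_lt_compat, Hq0 |].
    rewrite Rmult_comm. apply Rmult_le_compat.
    + left; apply Rinv_0_lt_compat; lra.
    + apply pow_le, Cmod_ge_0.
    + replace 2 with (/ / 2) by field. apply Rinv_le_contravar; lra.
    + apply pow_incr. split; [apply Cmod_ge_0 | exact Hx].
  - replace (Finite 0) with (Rbar_mult (Cmod (/ q)) (Rbar_mult 2 0)) by (simpl; f_equal; ring).
    apply (is_lim_seq_scal_l _ (Cmod (/ q))), (is_lim_seq_scal_l _ 2).
    apply (is_lim_seq_incr_1 (fun n => (/ 2) ^ n)), is_lim_seq_geom. rewrite Rabs_pos_eq; lra.
Qed.

(** * Poles, the identity theorem and uniqueness of the meromorphic continuation *)

Lemma pole_elim (f : C -> C) (s : C) : pole_at f s ->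
  exists k g r, 0 < r /\ analytic_at g s /\ g s <> 0 /\
    forall z, z <> s -> Cmod (z - s) < r -> (f z * (z - s) ^ S k)%C = g z.
Proof.
  intros [k [g [Hg [Hn H]]]].
  apply (locally_C_elim s (fun z => z <> s -> f z = (g z / (z - s) ^ S k)%C)) in H.
  destruct H as [r [Hr H]].
  exists k, g, r. repeat split; trivial. intros z Hz Hzr. rewrite H by assumption.
  field. apply Cpow_nz, Csub_neq_0, Hz.
Qed.

Lemma pole_intro (f g : C -> C) (c kappa : C) (r : R) : 0 < r -> kappa <> 0 -> analytic_at g c ->
  (forall z, z <> c -> Cmod (z - c) < r -> f z = (g z + kappa / (z - c))%C) -> pole_at f c.
Proof.
  intros Hr Hk Hg H.
  (* The exponent in [pole_at] is [S k], so 0 stands for a simple pole. *)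
  exists 0%nat, (fun z => (z - c) * g z + kappa)%C. split; [| split].
  - apply analytic_plus; [apply analytic_mult_shift, Hg | apply analytic_const].
  - replace ((c - c) * g c + kappa)%C with kappa by ring. exact Hk.
  - apply (locally_C_intro c _ r Hr). intros z Hz Hne. rewrite H by assumption.
    replace ((z - c) ^ 1)%C with (z - c)%C by (simpl; ring). field. apply Csub_neq_0, Hne.
Qed.

Lemma meromorphic_local (f : C -> C) (s : C) : meromorphic f ->
  exists k g r, 0 < r /\ analytic_at g s /\
    forall z, z <> s -> Cmod (z - s) < r -> (f z * (z - s) ^ k)%C = g z.
Proof.
  intros Hf. destruct (Hf s) as [H | [H _]].
  - exists 0%nat, f, 1. repeat split; [lra | exact H |]. intros z _ _. simpl. ring.
  - destruct (pole_elim f s H) as [k [g [r [H1 [H2 [_ H3]]]]]]. exists (S k), g, r. auto.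
Qed.

(** Near p the function f is bounded by some B; multiplied by a positive power of z - p it tends to
    0, whereas the numerator of a pole has a nonzero limit. *)
Lemma pole_not_analytic (f g : C -> C) (p : C) (r : R) : 0 < r -> analytic_at f p -> pole_at g p ->
  (forall z, z <> p -> Cmod (z - p) < r -> f z = g z) -> False.
Proof.
  intros Hr Hf Hg E. destruct (pole_elim g p Hg) as [k [h [r2 [Hr2 [Hh [Hh0 H2]]]]]].
  apply Hh0. apply C_eq_of_small. intros eps He.
  destruct (analytic_continuous f p Hf 1 Rlt_0_1) as [d1 [Hd1 H1]].
  destruct (analytic_continuous h p Hh (eps / 2) ltac:(lra)) as [d2 [Hd2 H3]].
  set (B := Cmod (f p) + 1). assert (HB : 0 < B) by (assert (T := Cmod_ge_0 (f p)); unfold B; lra).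
  set (t := Rmin (Rmin (Rmin r r2) (Rmin d1 d2)) (Rmin 1 (eps / 2 / B)) / 2).
  assert (He2 : 0 < eps / 2 / B) by (apply Rdiv_lt_0_compat; lra).
  assert (Ht : 0 < t) by (unfold t; repeat apply Rmin_pos || apply Rdiv_lt_0_compat; trivial; lra).
  assert (Hle : 2 * t <= r /\ 2 * t <= r2 /\ 2 * t <= d1 /\ 2 * t <= d2 /\ 2 * t <= 1 /\ 2 * t <= eps / 2 / B).
  { unfold t. replace (2 * (Rmin (Rmin (Rmin r r2) (Rmin d1 d2)) (Rmin 1 (eps / 2 / B)) / 2)) with (Rmin (Rmin (Rmin r r2) (Rmin d1 d2)) (Rmin 1 (eps / 2 / B))) by field.
    assert (T1 := Rmin_l (Rmin (Rmin r r2) (Rmin d1 d2)) (Rmin 1 (eps / 2 / B))).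
    assert (T2 := Rmin_r (Rmin (Rmin r r2) (Rmin d1 d2)) (Rmin 1 (eps / 2 / B))).
    assert (T3 := Rmin_l (Rmin r r2) (Rmin d1 d2)). assert (T4 := Rmin_r (Rmin r r2) (Rmin d1 d2)).
    assert (T5 := Rmin_l r r2). assert (T6 := Rmin_r r r2). assert (T7 := Rmin_l d1 d2). assert (T8 := Rmin_r d1 d2).
    assert (T9 := Rmin_l 1 (eps / 2 / B)). assert (T10 := Rmin_r 1 (eps / 2 / B)). repeat split; lra. }
  set (z := (p + RtoC t)%C).
  assert (Ez : (z - p)%C = RtoC t) by (unfold z; ring).
  assert (Hzm : Cmod (z - p) = t) by (rewrite Ez, Cmod_R, Rabs_pos_eq; lra).
  assert (Hzp : z <> p).
  { intros Hzp. rewrite Hzp in Hzm. replace (p - p)%C with (RtoC 0) in Hzm by ring. rewrite Cmod_0 in Hzm. lra. }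
  assert (Hh2 := H2 z Hzp ltac:(lra)). rewrite <- E in Hh2 by (trivial; lra).
  assert (Hfz : Cmod (f z) <= B).
  { replace (f z) with ((f z - f p) + f p)%C by ring. eapply Rle_trans. apply Cmod_triangle.
    assert (T := H1 z ltac:(lra)). unfold B. lra. }
  assert (Hhz : Cmod (h z) <= B * t).
  { rewrite <- Hh2, Cmod_mult, Cmod_pow, Hzm. apply Rmult_le_compat; trivial.
    apply Cmod_ge_0. apply pow_le; lra. simpl.
    assert (P : t ^ k <= 1). { replace 1 with (1 ^ k) by apply pow1. apply pow_incr; lra. }
    nra. }
  assert (H4 := H3 z ltac:(lra)).
  assert (HBt : B * t < eps / 2).
  { assert (E2 : eps / 2 = B * (eps / 2 / B)) by (field; lra). rewrite E2. apply Rmult_lt_compat_l; lra. }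
  replace (h p - 0)%C with (- (h z - h p) + h z)%C by ring.
  eapply Rle_lt_trans. apply Cmod_triangle. rewrite Cmod_opp. lra.
Qed.

(** Clearing both denominators gives an analytic function with zeros accumulating at p, which
    settles the punctured disc. At p itself the normalization decides: two analytic values agree by
    continuity, two poles share the dummy value 0, and the mixed cases are excluded by
    [pole_not_analytic]. *)
Lemma meromorphic_identity_local (F G : C -> C) (p : C) : meromorphic F -> meromorphic G ->
  (forall d, 0 < d -> exists z : C, z <> p /\ Cmod (z - p) < d /\ F z = G z) ->
  exists d, 0 < d /\ forall z, Cmod (z - p) < d -> F z = G z.
Proof.
  intros HF HG Hacc.
  destruct (meromorphic_local F p HF) as [k [f [r1 [Hr1 [Hf H1]]]]].
  destruct (meromorphic_local G p HG) as [j [g [r2 [Hr2 [Hg H2]]]]].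
  set (h := fun z => ((z - p) ^ j * f z + - ((z - p) ^ k * g z))%C).
  assert (Hh : analytic_at h p).
  { apply analytic_plus; [| apply analytic_opp]; apply analytic_mult_pow; assumption. }
  assert (Hform : forall z, z <> p -> Cmod (z - p) < Rmin r1 r2 ->
     h z = ((z - p) ^ j * (z - p) ^ k * (F z - G z))%C).
  { intros z Hz Hr. assert (T1 := Rmin_l r1 r2). assert (T2 := Rmin_r r1 r2).
    unfold h. rewrite <- H1, <- H2 by (trivial; lra). ring. }
  destruct (analytic_elim h p Hh) as [a [r3 Hps]].
  assert (Hzero : forall w, Cmod w < r3 -> h (p + w)%C = 0).
  { apply (ps_near_identity a r3 (fun w => h (p + w)%C) Hps). intros d Hd.
    assert (Hmin : 0 < Rmin d (Rmin r1 r2)) by (repeat apply Rmin_pos; trivial).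
    destruct (Hacc _ Hmin) as [z [Hz [Hzd HzE]]].
    assert (T1 := Rmin_l d (Rmin r1 r2)). assert (T2 := Rmin_r d (Rmin r1 r2)).
    exists (z - p)%C. split; [apply Csub_neq_0, Hz |]. split; [lra |].
    replace (p + (z - p))%C with z by ring. rewrite Hform, HzE by (trivial; lra). ring. }
  destruct Hps as [Hr3 _].
  set (d := Rmin r3 (Rmin r1 r2)).
  assert (Hd : 0 < d) by (unfold d; repeat apply Rmin_pos; trivial).
  assert (T1 := Rmin_l r3 (Rmin r1 r2)). assert (T2 := Rmin_r r3 (Rmin r1 r2)). fold d in T1, T2.
  assert (Hpunct : forall z, z <> p -> Cmod (z - p) < d -> F z = G z).
  { intros z Hz Hzd. specialize (Hzero (z - p)%C ltac:(lra)).
    replace (p + (z - p))%C with z in Hzero by ring. rewrite Hform in Hzero by (trivial; lra).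
    assert (Hj := Cpow_nz (z - p) j (Csub_neq_0 z p Hz)). assert (Hk := Cpow_nz (z - p) k (Csub_neq_0 z p Hz)).
    assert (Hjk := Cmult_neq_0 _ _ Hj Hk).
    replace (F z) with (((z - p) ^ j * (z - p) ^ k * (F z - G z)) / ((z - p) ^ j * (z - p) ^ k) + G z)%C.
    - rewrite Hzero. unfold Cdiv. ring.
    - field. split; assumption. }
  exists d. split; [exact Hd |]. intros z Hz.
  destruct (excluded_middle_informative (z = p)) as [-> | Hne]; [| auto].
  destruct (HF p) as [AF | [PF EF]]; destruct (HG p) as [AG | [PG EG]].
  - apply C_eq_of_small. intros eps He.
    destruct (analytic_continuous F p AF (eps / 2) ltac:(lra)) as [d1 [Hd1 C1]].
    destruct (analytic_continuous G p AG (eps / 2) ltac:(lra)) as [d2 [Hd2 C2]].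
    set (t := Rmin d (Rmin d1 d2) / 2).
    assert (Ht : 0 < t) by (unfold t; apply Rdiv_lt_0_compat; repeat apply Rmin_pos; lra).
    assert (U1 := Rmin_l d (Rmin d1 d2)). assert (U2 := Rmin_r d (Rmin d1 d2)).
    assert (U3 := Rmin_l d1 d2). assert (U4 := Rmin_r d1 d2).
    assert (Hzm : Cmod (p + RtoC t - p) = t).
    { replace (p + RtoC t - p)%C with (RtoC t) by ring. rewrite Cmod_R, Rabs_pos_eq; lra. }
    assert (Hzp : (p + RtoC t)%C <> p).
    { intros Hzp. rewrite Hzp in Hzm. replace (p - p)%C with (RtoC 0) in Hzm by ring. rewrite Cmod_0 in Hzm. lra. }
    assert (Ht2 : t < d /\ t < d1 /\ t < d2) by (unfold t in *; repeat split; lra).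
    assert (E := Hpunct _ Hzp ltac:(lra)). assert (V1 := C1 (p + RtoC t)%C ltac:(lra)).
    assert (V2 := C2 (p + RtoC t)%C ltac:(lra)). rewrite E in V1.
    replace (F p - G p)%C with (- (G (p + RtoC t)%C - F p) + (G (p + RtoC t)%C - G p))%C by ring.
    eapply Rle_lt_trans. apply Cmod_triangle. rewrite Cmod_opp. lra.
  - exfalso. exact (pole_not_analytic F G p d Hd AF PG Hpunct).
  - exfalso. apply (pole_not_analytic G F p d Hd AG PF). intros y H3 H4. symmetry; auto.
  - congruence.
Qed.

(** The argument runs along the horizontal line through s. If F and G differed on it, let X be the
    supremum of the real parts where they do; they agree to the right of X, hence around X,
    contradicting the choice of X. *)
Lemma meromorphic_identity (F G : C -> C) (a : R) : meromorphic F -> meromorphic G ->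
  (forall s, a < Re s -> F s = G s) -> forall s, F s = G s.
Proof.
  intros HF HG E s. apply Classical_Prop.NNPP. intros Hne.
  set (y := Im s). set (B := fun x : R => F (x, y) <> G (x, y)).
  assert (Hbd : bound B).
  { exists a. intros x Hx. apply Rnot_lt_le. intros Hlt. apply Hx, E, Hlt. }
  assert (Hex : exists x, B x).
  { exists (Re s). unfold B. intros E2. apply Hne. destruct s as [s1 s2]. exact E2. }
  destruct (completeness B Hbd Hex) as [X [HX1 HX2]].
  destruct (meromorphic_identity_local F G (X, y) HF HG) as [d [Hd H]].
  - intros d Hd. exists (X + d / 2, y).
    assert (Em : (((X + d / 2)%R, y) - (X, y))%C = RtoC (d / 2)) by (unfold Cminus, Cplus, Copp, RtoC; simpl; f_equal; ring).
    split; [| split].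
    + intros Heq. injection Heq. lra.
    + rewrite Em, Cmod_R, Rabs_pos_eq; lra.
    + apply Classical_Prop.NNPP. intros Hn. specialize (HX1 _ Hn). lra.
  - assert (HX3 : X <= X - d / 2); [| lra].
    apply HX2. intros x Hx. apply Rnot_lt_le. intros Hlt. apply Hx, H.
    assert (Em : ((x, y) - (X, y))%C = RtoC (x - X)) by (unfold Cminus, Cplus, Copp, RtoC; simpl; f_equal; ring).
    rewrite Em, Cmod_R. specialize (HX1 x Hx). apply Rabs_def1; lra.
Qed.

Lemma mero_continuation_eq (a : R) (f E : C -> C) : meromorphic E ->
  (forall s, a < Re s -> E s = f s) -> forall s, mero_continuation a f s = E s.
Proof.
  intros HE Hf.
  assert (HS : meromorphic (mero_continuation a f) /\ forall s, a < Re s -> mero_continuation a f s = f s).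
  { unfold mero_continuation. apply epsilon_spec. exists E. auto. }
  destruct HS as [H1 H2].
  apply (meromorphic_identity _ _ a H1 HE). intros s Hs. rewrite H2, Hf; trivial.
Qed.

(** * Theta series and a finite Poisson summation formula *)

(** The sum over k < n: the empty sum is available and [rsum_split] has no boundary term, in
    contrast with [sum_n] and [sum_f_R0], which include their last index. *)
Fixpoint rsum (a : nat -> R) (n : nat) : R :=
  match n with O => 0 | S n' => rsum a n' + a n' end.

Lemma sum_n_rsum (a : nat -> R) (n : nat) : sum_n a n = rsum a (S n).
Proof.
  induction n as [| n IH]; [rewrite sum_O; simpl; ring |]. rewrite sum_Sn, IH. reflexivity.
Qed.

Lemma rsum_ext (a b : nat -> R) (n : nat) : (forall k, (k < n)%nat -> a k = b k) -> rsum a n = rsum b n.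
Proof. induction n as [| n IH]; intros H; simpl; trivial. rewrite IH, (H n) by (intros; auto with arith). ring. Qed.

Lemma rsum_plus (a b : nat -> R) (n : nat) : rsum (fun k => a k + b k) n = rsum a n + rsum b n.
Proof. induction n as [| n IH]; simpl; [ring |]. rewrite IH. ring. Qed.

Lemma rsum_scal (c : R) (a : nat -> R) (n : nat) : rsum (fun k => c * a k) n = c * rsum a n.
Proof. induction n as [| n IH]; simpl; [ring |]. rewrite IH. ring. Qed.

Lemma rsum_first (a : nat -> R) (n : nat) : rsum a (S n) = a 0%nat + rsum (fun k => a (S k)) n.
Proof. induction n as [| n IH]; [simpl; ring |]. change (rsum a (S (S n))) with (rsum a (S n) + a (S n)). rewrite IH. simpl. ring. Qed.

Lemma rsum_le (a b : nat -> R) (n : nat) : (forall k, (k < n)%nat -> a k <= b k) -> rsum a n <= rsum b n.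
Proof. induction n as [| n IH]; intros H; simpl; [lra |]. apply Rplus_le_compat; auto with arith. Qed.

Lemma rsum_zero (a : nat -> R) (n : nat) : (forall k, (k < n)%nat -> a k = 0) -> rsum a n = 0.
Proof. induction n as [| n IH]; intros H; simpl; trivial. rewrite IH, H by auto with arith. ring. Qed.

Lemma rsum_nonneg (a : nat -> R) (n : nat) : (forall k, (k < n)%nat -> 0 <= a k) -> 0 <= rsum a n.
Proof. induction n as [| n IH]; intros H; simpl; [lra |]. apply Rplus_le_le_0_compat; auto with arith. Qed.

Lemma rsum_abs (a : nat -> R) (n : nat) : Rabs (rsum a n) <= rsum (fun k => Rabs (a k)) n.
Proof.
  induction n as [| n IH]; simpl; [rewrite Rabs_R0; lra |].
  eapply Rle_trans. apply Rabs_triang. lra.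
Qed.

Lemma rsum_split (a : nat -> R) (n m : nat) : rsum a (n + m) = rsum a n + rsum (fun k => a (n + k)%nat) m.
Proof. induction m as [| m IH]; [rewrite Nat.add_0_r; simpl; ring |]. rewrite Nat.add_succ_r. simpl. rewrite IH. ring. Qed.

Lemma rsum_exchange (a : nat -> nat -> R) (n m : nat) :
  rsum (fun i => rsum (a i) m) n = rsum (fun j => rsum (fun i => a i j) n) m.
Proof.
  induction n as [| n IH]; simpl.
  - symmetry; apply rsum_zero; trivial.
  - rewrite IH, <- rsum_plus. reflexivity.
Qed.

Lemma ex_series_dom (a M : nat -> R) : (forall k, Rabs (a k) <= M k) -> ex_series M -> ex_series a.
Proof. intros H HM. apply (ex_series_le (K := R_AbsRing) (V := R_CompleteNormedModule) a M); trivial. Qed.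

Lemma ex_series_geom_scal (c q : R) : 0 <= q < 1 -> ex_series (fun n => c * q ^ n).
Proof.
  intros Hq. apply (ex_series_scal_l (K := R_AbsRing) c (fun n => q ^ n)).
  exists (/ (1 - q)). apply is_series_geom. rewrite Rabs_pos_eq; lra.
Qed.

Lemma Series_split (a : nat -> R) (n : nat) : ex_series a ->
  Series a = rsum a n + Series (fun k => a (n + k)%nat).
Proof.
  intros H. destruct n as [| n]; [simpl rsum; rewrite Rplus_0_l; reflexivity |].
  rewrite (Series_incr_n a (S n)) by (auto with arith). f_equal.
  simpl Nat.pred. rewrite <- sum_n_rsum. symmetry. apply sum_n_Reals.
Qed.

Lemma Series_finite (a : nat -> R) (n : nat) : (forall k, (n <= k)%nat -> a k = 0) -> Series a = rsum a n.
Proof.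
  intros H. apply is_series_unique.
  assert (Hl : is_lim_seq (sum_n a) (rsum a n)); [| exact Hl].
  apply (is_lim_seq_ext_loc (fun _ => rsum a n)); [| apply is_lim_seq_const].
  exists n. intros k Hk. rewrite sum_n_rsum. replace (S k) with (n + (S k - n))%nat by lia.
  rewrite rsum_split, (rsum_zero (fun i => a (n + i)%nat)); [ring |]. intros; apply H; lia.
Qed.

Lemma Series_nonneg (a : nat -> R) : (forall k, 0 <= a k) -> ex_series a -> 0 <= Series a.
Proof.
  intros H Ha. apply Rle_trans with (Series (fun _ : nat => 0)).
  - rewrite (Series_finite _ 0) by trivial. simpl. lra.
  - apply Series_le; [| exact Ha]. intros k. split; [lra | apply H].
Qed.

Lemma is_series_rsum (a : nat -> R) (l : R) : is_series a l <-> is_lim_seq (rsum a) l.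
Proof.
  split; intros H.
  - apply is_lim_seq_incr_1. apply (is_lim_seq_ext (sum_n a)); [apply sum_n_rsum | exact H].
  - apply is_lim_seq_incr_1 in H.
    assert (Hl : is_lim_seq (sum_n a) l); [| exact Hl].
    apply (is_lim_seq_ext (fun n => rsum a (S n))); [intros; symmetry; apply sum_n_rsum | exact H].
Qed.

Lemma Series_le_dom (a M : nat -> R) : (forall k, Rabs (a k) <= M k) -> ex_series M ->
  Rabs (Series a) <= Series M.
Proof.
  intros H HM. assert (Ha : ex_series (fun k => Rabs (a k))).
  { apply (ex_series_dom _ M); trivial. intros k. rewrite Rabs_Rabsolu. apply H. }
  eapply Rle_trans. apply Series_Rabs; exact Ha. apply Series_le; trivial.
  intros k. split; [apply Rabs_pos | apply H].
Qed.

Lemma Series_tail_lim (M : nat -> R) : ex_series M ->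
  is_lim_seq (fun n => Series (fun k => M (n + k)%nat)) 0.
Proof.
  intros H. destruct H as [l Hl].
  apply (is_lim_seq_ext (fun n => l - rsum M n)).
  - intros n. assert (E := Series_split M n (ex_intro _ l Hl)).
    rewrite (is_series_unique _ _ Hl) in E. lra.
  - apply is_series_rsum in Hl.
    replace (Finite 0) with (Finite (l - l)) by (f_equal; ring).
    apply is_lim_seq_minus'; [apply is_lim_seq_const | exact Hl].
Qed.

Lemma rsum_lim (f : nat -> nat -> R) (g : nat -> R) (K : nat) :
  (forall k, is_lim_seq (fun n => f n k) (g k)) -> is_lim_seq (fun n => rsum (f n) K) (rsum g K).
Proof.
  intros H. induction K as [| K IH]; simpl; [apply is_lim_seq_const |].
  apply is_lim_seq_plus'; auto.
Qed.

Lemma tannery (f : nat -> nat -> R) (g M : nat -> R) :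
  (forall k, is_lim_seq (fun n => f n k) (g k)) -> (forall n k, Rabs (f n k) <= M k) -> ex_series M ->
  is_lim_seq (fun n => Series (f n)) (Series g).
Proof.
  intros Hf Hd HM.
  assert (Hg : forall k, Rabs (g k) <= M k).
  { intros k. assert (A := is_lim_seq_abs _ _ (Hf k)). simpl in A.
    exact (is_lim_seq_le _ _ _ _ (fun n => Hd n k) A (is_lim_seq_const (M k))). }
  apply is_lim_seq_spec. intros eps. assert (He := cond_pos eps).
  assert (Ht := Series_tail_lim M HM). apply is_lim_seq_spec in Ht.
  assert (He3 : 0 < eps / 3) by lra.
  destruct (Ht (mkposreal _ He3)) as [K HK]. specialize (HK K (le_n K)). simpl in HK.
  assert (Hr := rsum_lim f g K Hf). apply is_lim_seq_spec in Hr.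
  destruct (Hr (mkposreal _ He3)) as [N HN]. exists N. intros n Hn. specialize (HN n Hn). simpl in HN.
  assert (HMK : ex_series (fun k => M (K + k)%nat)) by (apply ex_series_incr_n, HM).
  rewrite (Series_split (f n) K) by (apply (ex_series_dom _ M); auto).
  rewrite (Series_split g K) by (apply (ex_series_dom _ M); auto).
  assert (T1 := Series_le_dom (fun k => f n (K + k)%nat) _ (fun k => Hd n (K + k)%nat) HMK).
  assert (T2 := Series_le_dom (fun k => g (K + k)%nat) _ (fun k => Hg (K + k)%nat) HMK).
  rewrite Rminus_0_r in HK. apply Rabs_def2 in HK. apply Rabs_def2 in HN.
  apply Rabs_le_between in T1. apply Rabs_le_between in T2.
  apply Rabs_def1; lra.
Qed.

Definition gauss (x : R) (n : nat) : R := exp (- PI * INR (S n) ^ 2 * x).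

Lemma sq_ge (n : nat) : INR n + 1 <= INR (S n) ^ 2.
Proof. rewrite S_INR. assert (H := pos_INR n). nra. Qed.

Lemma exp_INR_pow (x : R) (n : nat) : exp (INR n * x) = exp x ^ n.
Proof.
  induction n as [| n IH]; [simpl; rewrite Rmult_0_l; apply exp_0 |].
  rewrite S_INR, Rmult_plus_distr_r, exp_plus, IH, Rmult_1_l. simpl. ring.
Qed.

Lemma exp_neg_lt_1 (x : R) : 0 < x -> exp (- x) < 1.
Proof. intros H. rewrite <- exp_0. apply exp_increasing. lra. Qed.

Lemma exp_sq_geom (c : R) (n : nat) : 0 < c -> exp (- c * INR (S n) ^ 2) <= exp (- c) * exp (- c) ^ n.
Proof.
  intros Hc. rewrite <- exp_INR_pow, <- exp_plus. apply exp_le. assert (H := sq_ge n). nra.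
Qed.

Lemma ex_series_exp_sq (c : R) : 0 < c -> ex_series (fun n => exp (- c * INR (S n) ^ 2)).
Proof.
  intros Hc. apply (ex_series_dom _ (fun n => exp (- c) * exp (- c) ^ n)).
  - intros n. rewrite Rabs_pos_eq by (left; apply exp_pos). apply exp_sq_geom, Hc.
  - apply ex_series_geom_scal. split; [left; apply exp_pos | apply exp_neg_lt_1, Hc].
Qed.

Lemma gauss_eq (x : R) (n : nat) : gauss x n = exp (- (PI * x) * INR (S n) ^ 2).
Proof. unfold gauss. f_equal. ring. Qed.

Lemma ex_series_gauss (x : R) : 0 < x -> ex_series (gauss x).
Proof.
  intros Hx. apply (ex_series_ext (fun n => exp (- (PI * x) * INR (S n) ^ 2))).
  - intros n; symmetry; apply gauss_eq.
  - apply ex_series_exp_sq. apply Rmult_lt_0_compat; [apply PI_RGT_0 | exact Hx].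
Qed.

Lemma theta_gauss (x : R) : 0 < x -> theta x = 1 + 2 * Series (gauss x).
Proof.
  intros Hx. unfold theta.
  assert (Hex : ex_series (fun n => exp (- PI * INR n ^ 2 * x))).
  { apply ex_series_incr_1. apply ex_series_gauss, Hx. }
  rewrite (Series_incr_1 _ Hex).
  replace (exp (- PI * INR 0 ^ 2 * x)) with 1.
  2:{ simpl. replace (- PI * (0 * (0 * 1)) * x) with 0 by ring. now rewrite exp_0. }
  rewrite (Series_ext (fun n => exp (- PI * (- INR (S n)) ^ 2 * x)) (gauss x)).
  - unfold gauss. ring.
  - intros n. unfold gauss. do 2 f_equal. ring.
Qed.

Lemma Series_gauss_pos (x : R) : 0 < x -> 0 < Series (gauss x).
Proof.
  intros Hx. rewrite (Series_split _ 1 (ex_series_gauss x Hx)). simpl.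
  assert (H1 : 0 < gauss x 0) by apply exp_pos.
  assert (H2 : 0 <= Series (fun k => gauss x (S k))); [| lra].
  apply Series_nonneg; [intros; left; apply exp_pos |].
  apply (ex_series_incr_1 (gauss x)), ex_series_gauss, Hx.
Qed.

Lemma theta_gt_1 (x : R) : 0 < x -> 1 < theta x.
Proof. intros Hx. rewrite theta_gauss by assumption. assert (H := Series_gauss_pos x Hx). lra. Qed.

Lemma theta_bound (x : R) : 0 < x -> theta x - 1 <= 2 * exp (- PI * x) / (1 - exp (- PI * x)).
Proof.
  intros Hx. rewrite theta_gauss by assumption.
  assert (Hc : 0 < PI * x) by (apply Rmult_lt_0_compat; [apply PI_RGT_0 | exact Hx]).
  replace (- PI * x) with (- (PI * x)) by ring.
  assert (Hq := exp_neg_lt_1 _ Hc). assert (Hq0 := exp_pos (- (PI * x))).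
  assert (H : Series (gauss x) <= Series (fun n => exp (- (PI * x)) * exp (- (PI * x)) ^ n)).
  { apply Series_le.
    - intros n. split; [left; apply exp_pos |]. rewrite gauss_eq. apply exp_sq_geom, Hc.
    - apply ex_series_geom_scal. lra. }
  rewrite Series_scal_l, Series_geom in H by (rewrite Rabs_pos_eq; lra).
  unfold Rdiv. lra.
Qed.

(** * Binomial coefficients, powers of the cosine and sums over roots of unity *)

Fixpoint binom (n k : nat) : R :=
  match n, k with
  | _, O => 1
  | O, S _ => 0
  | S n', S k' => binom n' k' + binom n' (S k')
  end.

Lemma bin_0 (n : nat) : binom n 0 = 1.
Proof. destruct n; reflexivity. Qed.

Lemma bin_out (n : nat) : forall k, (n < k)%nat -> binom n k = 0.
Proof.
  induction n as [| n IH]; intros [| k] Hk; try lia; simpl; trivial.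
  rewrite !IH by lia. ring.
Qed.

Lemma bin_ratio (n : nat) : forall k, binom n (S k) * INR (S k) = binom n k * (INR n - INR k).
Proof.
  induction n as [| n IH]; intros k.
  - destruct k as [| k]; simpl binom; [simpl; ring | ring].
  - destruct k as [| k].
    + change (binom (S n) 1) with (binom n 0 + binom n 1). assert (H := IH 0%nat).
      rewrite !bin_0 in *. rewrite (S_INR n).
      change (INR 1) with 1 in *. change (INR 0) with 0 in *. lra.
    + change (binom (S n) (S (S k))) with (binom n (S k) + binom n (S (S k))).
      change (binom (S n) (S k)) with (binom n k + binom n (S k)).
      assert (H1 := IH k). assert (H2 := IH (S k)). rewrite !S_INR in *. nra.
Qed.

Lemma bin_pascal_sum (g : nat -> R) (n : nat) :
  rsum (fun j => binom (S n) j * g j) (S (S n)) = rsum (fun j => binom n j * (g j + g (S j))) (S n).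
Proof.
  rewrite rsum_first.
  rewrite (rsum_ext (fun k => binom (S n) (S k) * g (S k)) (fun k => binom n k * g (S k) + binom n (S k) * g (S k))).
  2:{ intros; simpl; ring. }
  rewrite rsum_plus.
  rewrite (rsum_ext (fun j => binom n j * (g j + g (S j))) (fun j => binom n j * g (S j) + binom n j * g j)) by (intros; ring).
  rewrite rsum_plus, (rsum_first (fun j => binom n j * g j)), !bin_0.
  change (rsum (fun k => binom n (S k) * g (S k)) (S n)) with (rsum (fun k => binom n (S k) * g (S k)) n + binom n (S n) * g (S n)).
  rewrite (bin_out n (S n)) by lia. ring.
Qed.

Lemma cos_pow_sum (n : nat) (x : R) :
  2 ^ n * cos x ^ n = rsum (fun j => binom n j * cos ((INR n - 2 * INR j) * x)) (S n).
Proof.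
  induction n as [| n IH].
  - simpl. replace ((0 - 2 * 0) * x) with 0 by ring. rewrite cos_0. ring.
  - rewrite bin_pascal_sum.
    replace (2 ^ S n * cos x ^ S n) with (2 * cos x * (2 ^ n * cos x ^ n)) by (simpl; ring).
    rewrite IH, <- rsum_scal. apply rsum_ext. intros k _.
    replace ((INR (S n) - 2 * INR k) * x) with ((INR n - 2 * INR k) * x + x) by (rewrite S_INR; ring).
    replace ((INR (S n) - 2 * INR (S k)) * x) with ((INR n - 2 * INR k) * x - x) by (rewrite !S_INR; ring).
    rewrite cos_plus, cos_minus. ring.
Qed.

Lemma rsum_center (F : nat -> R) (m k : nat) : (k <= m)%nat ->
  rsum (fun i => F (m - k + i)%nat) (2 * k + 1) = F m + rsum (fun r => F (m + S r)%nat + F (m - S r)%nat) k.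
Proof.
  induction k as [| k IH]; intros Hk.
  - simpl. replace (m - 0 + 0)%nat with m by lia. ring.
  - replace (2 * S k + 1)%nat with (S (S (2 * k + 1))) by lia.
    rewrite rsum_first.
    change (rsum (fun r => F (m + S r)%nat + F (m - S r)%nat) (S k))
      with (rsum (fun r => F (m + S r)%nat + F (m - S r)%nat) k + (F (m + S k)%nat + F (m - S k)%nat)).
    rewrite <- Rplus_assoc, <- IH by lia.
    replace (m - S k + 0)%nat with (m - S k)%nat by lia.
    change (rsum (fun i => F (m - S k + S i)%nat) (S (2 * k + 1)))
      with (rsum (fun i => F (m - S k + S i)%nat) (2 * k + 1) + F (m - S k + S (2 * k + 1))%nat).
    replace (m - S k + S (2 * k + 1))%nat with (m + S k)%nat by lia.
    rewrite (rsum_ext (fun i => F (m - S k + S i)%nat) (fun i => F (m - k + i)%nat)).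
    + ring.
    + intros i _. f_equal. lia.
Qed.

(** The quotient of binom (2m) (m + r) by binom (2m) m, as the product of the r successive quotients
    (m - i) / (m + i + 1). The factor with i = m vanishes, so the value is 0 for r > m. *)
Fixpoint binom_ratio (m r : nat) : R :=
  match r with
  | O => 1
  | S r' => binom_ratio m r' * ((INR m - INR r') / (INR m + INR r' + 1))
  end.

(** The mean value of cos^(2m) over a period. *)
Definition central_weight (m : nat) : R := binom (2 * m) m / 4 ^ m.

Lemma bin_rho_up (m r : nat) : binom (2 * m) (m + r) = binom (2 * m) m * binom_ratio m r.
Proof.
  induction r as [| r IH]; [rewrite Nat.add_0_r; simpl; ring |].
  assert (H := bin_ratio (2 * m) (m + r)). rewrite IH in H.
  replace (m + S r)%nat with (S (m + r)) by lia. simpl binom_ratio.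
  rewrite S_INR, mult_INR, plus_INR in H. simpl (INR 2) in H.
  assert (P1 := pos_INR m). assert (P2 := pos_INR r).
  apply (Rmult_eq_reg_r (INR m + INR r + 1)); [| lra]. rewrite H. field. lra.
Qed.

Lemma bin_rho_down (m r : nat) : (r <= m)%nat -> binom (2 * m) (m - r) = binom (2 * m) m * binom_ratio m r.
Proof.
  induction r as [| r IH]; intros Hr; [rewrite Nat.sub_0_r; simpl; ring |].
  assert (H := bin_ratio (2 * m) (m - S r)). replace (S (m - S r)) with (m - r)%nat in H by lia.
  rewrite IH in H by lia. simpl binom_ratio.
  rewrite !minus_INR, mult_INR, (S_INR r) in H by lia. replace (INR 2) with 2 in H by (simpl; lra).
  assert (P1 := pos_INR m). assert (P2 := pos_INR r).
  apply (Rmult_eq_reg_r (INR m + INR r + 1)); [| lra].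
  transitivity (binom (2 * m) m * binom_ratio m r * (INR m - INR r)); [rewrite H; ring | field; lra].
Qed.

Lemma rho_out (m r : nat) : (m < r)%nat -> binom_ratio m r = 0.
Proof.
  induction r as [| r IH]; intros Hr; [lia |]. simpl.
  destruct (Nat.eq_dec m r) as [-> | Hne].
  - replace (INR r - INR r) with 0 by ring. unfold Rdiv. ring.
  - rewrite IH by lia. ring.
Qed.

(** The terms past m vanish, so the sum may be lengthened at will; [polya_identity] lengthens it to
    a multiple of the number of sample points. *)
Lemma cos_pow_rho (m N : nat) (x : R) : (m <= N)%nat ->
  cos x ^ (2 * m) = central_weight m * (1 + 2 * rsum (fun r => binom_ratio m (S r) * cos (2 * INR (S r) * x)) N).
Proof.
  intros HR. replace N with (m + (N - m))%nat by lia. rewrite rsum_split.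
  rewrite (rsum_zero (fun k => binom_ratio m (S (m + k)) * _)).
  2:{ intros k _. rewrite rho_out by lia. ring. }
  assert (H := cos_pow_sum (2 * m) x). rewrite pow_mult in H. replace (2 ^ 2) with 4 in H by ring.
  assert (H4 : 4 ^ m <> 0) by (apply pow_nonzero; lra).
  apply (Rmult_eq_reg_l (4 ^ m)); trivial. rewrite H.
  unfold central_weight. replace (4 ^ m * (binom (2 * m) m / 4 ^ m * (1 + 2 * (rsum (fun r => binom_ratio m (S r) * cos (2 * INR (S r) * x)) m + 0))))
    with (binom (2 * m) m + rsum (fun r => (2 * binom (2 * m) m) * (binom_ratio m (S r) * cos (2 * INR (S r) * x))) m)
    by (rewrite rsum_scal; field; trivial).
  assert (HC := rsum_center (fun j => binom (2 * m) j * cos ((INR (2 * m) - 2 * INR j) * x)) m m (le_n m)).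
  replace (S (2 * m)) with (2 * m + 1)%nat by lia.
  rewrite (rsum_ext _ (fun i => binom (2 * m) (m - m + i) * cos ((INR (2 * m) - 2 * INR (m - m + i)) * x))).
  2:{ intros k _. replace (m - m + k)%nat with k by lia. reflexivity. }
  rewrite HC. f_equal.
  - rewrite mult_INR. simpl (INR 2). replace (((1 + 1) * INR m - 2 * INR m) * x) with 0 by ring. rewrite cos_0. ring.
  - apply rsum_ext. intros k Hk. rewrite bin_rho_up, bin_rho_down by lia.
    rewrite plus_INR, minus_INR, mult_INR by lia. simpl (INR 2).
    replace (((1 + 1) * INR m - 2 * (INR m + INR (S k))) * x) with (- (2 * INR (S k) * x)) by ring.
    replace (((1 + 1) * INR m - 2 * (INR m - INR (S k))) * x) with (2 * INR (S k) * x) by ring.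
    rewrite cos_neg. ring.
Qed.

Lemma dirichlet_kernel (L : nat) (a : R) :
  sin (a / 2) * (1 + 2 * rsum (fun n => cos (INR (S n) * a)) L) = sin ((INR L + / 2) * a).
Proof.
  induction L as [| L IH].
  - simpl. replace ((0 + / 2) * a) with (a / 2) by field. ring.
  - change (rsum (fun n => cos (INR (S n) * a)) (S L)) with (rsum (fun n => cos (INR (S n) * a)) L + cos (INR (S L) * a)).
    replace (sin (a / 2) * (1 + 2 * (rsum (fun n => cos (INR (S n) * a)) L + cos (INR (S L) * a))))
      with (sin (a / 2) * (1 + 2 * rsum (fun n => cos (INR (S n) * a)) L) + 2 * sin (a / 2) * cos (INR (S L) * a)) by ring.
    rewrite IH, S_INR.
    replace ((INR L + / 2) * a) with ((INR L + 1) * a - a / 2) by field.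
    replace ((INR L + 1 + / 2) * a) with ((INR L + 1) * a + a / 2) by field.
    rewrite sin_minus, sin_plus. ring.
Qed.

(** The sum of the r-th powers of all roots of unity of the odd order 2L + 1, with conjugate roots
    paired; oddness leaves only the root 1 unpaired. *)
Definition dirichlet_sum (L r : nat) : R :=
  1 + 2 * rsum (fun n => cos (2 * INR r * (PI * INR (S n) / INR (2 * L + 1)))) L.

Lemma INR_odd (L : nat) : INR (2 * L + 1) = 2 * INR L + 1.
Proof. rewrite plus_INR, mult_INR. simpl. ring. Qed.

Lemma Dsum_multiple (L q : nat) : dirichlet_sum L (q * (2 * L + 1)) = INR (2 * L + 1).
Proof.
  assert (P := pos_INR L). unfold dirichlet_sum.
  rewrite (rsum_ext _ (fun _ => 1)).
  - replace (rsum (fun _ => 1) L) with (INR L).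
    + rewrite INR_odd. ring.
    + clear. induction L as [| L IH]; [reflexivity |]. rewrite S_INR. simpl. rewrite <- IH. ring.
  - intros n _. rewrite mult_INR.
    replace (2 * (INR q * INR (2 * L + 1)) * (PI * INR (S n) / INR (2 * L + 1))) with (0 + 2 * INR (q * S n) * PI).
    + rewrite cos_period. apply cos_0.
    + rewrite mult_INR. field. rewrite INR_odd. lra.
Qed.

Lemma sin_multiple (q : nat) : sin (INR q * PI) = 0.
Proof. apply sin_eq_0_1. exists (Z.of_nat q). now rewrite INR_IZR_INZ. Qed.

(** The closed form of the Dirichlet kernel has the numerator sin (integer times PI) = 0, and its
    denominator is nonzero because 2L + 1 does not divide the exponent. *)
Lemma Dsum_other (L q i : nat) : (0 < i < 2 * L + 1)%nat -> dirichlet_sum L (q * (2 * L + 1) + i) = 0.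
Proof.
  intros Hi. assert (P := pos_INR L). set (l := (2 * L + 1)%nat) in *.
  assert (Hl : 0 < INR l) by (unfold l; rewrite INR_odd; lra).
  set (a := 2 * INR (q * l + i) * PI / INR l).
  assert (Hk := dirichlet_kernel L a).
  replace ((INR L + / 2) * a) with (INR (q * l + i) * PI) in Hk.
  2:{ unfold a. replace (INR l) with (2 * INR L + 1) by (unfold l; rewrite INR_odd; ring). field. lra. }
  rewrite sin_multiple in Hk.
  assert (Hs : sin (a / 2) <> 0).
  { intros E. apply sin_eq_0_0 in E. destruct E as [k Hk2]. unfold a in Hk2.
    assert (E : INR (q * l + i) = IZR k * INR l).
    { assert (HPI := PI_RGT_0). apply (Rmult_eq_reg_r (PI / INR l)).
      - replace (IZR k * INR l * (PI / INR l)) with (IZR k * PI) by (field; lra). rewrite <- Hk2. field. lra.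
      - apply Rgt_not_eq, Rdiv_lt_0_compat; lra. }
    rewrite !INR_IZR_INZ, <- mult_IZR in E. apply eq_IZR in E.
    rewrite Znat.Nat2Z.inj_add, Znat.Nat2Z.inj_mul in E.
    assert (Z.of_nat i = (k - Z.of_nat q) * Z.of_nat l)%Z by lia.
    assert (0 < k - Z.of_nat q)%Z by nia. nia. }
  apply Rmult_integral in Hk. destruct Hk as [Hk | Hk]; [contradiction |].
  unfold dirichlet_sum. fold l. rewrite <- Hk. f_equal. f_equal. apply rsum_ext. intros n _. f_equal. unfold a. field. lra.
Qed.

Lemma Dsum_sum (h : nat -> R) (L K : nat) :
  rsum (fun r => h (S r) * dirichlet_sum L (S r)) (K * (2 * L + 1))
  = INR (2 * L + 1) * rsum (fun k => h (S k * (2 * L + 1))%nat) K.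
Proof.
  induction K as [| K IH]; [simpl; ring |].
  replace (S K * (2 * L + 1))%nat with (K * (2 * L + 1) + (2 * L + 1))%nat by lia.
  rewrite rsum_split, IH.
  assert (E : forall f, rsum f (2 * L + 1) = rsum f (2 * L) + f (2 * L)%nat) by (intros; rewrite Nat.add_1_r; reflexivity).
  rewrite E. clear E.
  change (rsum (fun k => h (S k * (2 * L + 1))%nat) (S K)) with
    (rsum (fun k => h (S k * (2 * L + 1))%nat) K + h (S K * (2 * L + 1))%nat).
  rewrite Rmult_plus_distr_l. f_equal.
  rewrite rsum_zero.
  - replace (S (K * (2 * L + 1) + 2 * L)) with (S K * (2 * L + 1))%nat by lia.
    rewrite Dsum_multiple. ring.
  - intros i Hi. replace (S (K * (2 * L + 1) + i)) with (K * (2 * L + 1) + S i)%nat by lia.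
    rewrite Dsum_other by lia. ring.
Qed.

(** Summing the expansion of cos^(2m) over the sample points keeps only the frequencies divisible by
    2L + 1. This is a finite Poisson summation: powers of cosines become Gaussians on the left,
    quotients of binomial coefficients do so on the right. *)
Lemma polya_identity (m L : nat) :
  1 + 2 * rsum (fun n => cos (PI * INR (S n) / INR (2 * L + 1)) ^ (2 * m)) L
  = INR (2 * L + 1) * central_weight m * (1 + 2 * rsum (fun k => binom_ratio m (S k * (2 * L + 1))%nat) m).
Proof.
  set (l := (2 * L + 1)%nat). set (K := (m * l)%nat).
  assert (HK : (m <= K)%nat) by (unfold K, l; nia).
  assert (H0 := cos_pow_rho m K 0 HK). rewrite cos_0, pow1 in H0.
  rewrite (rsum_ext _ (fun n => central_weight m * (1 + 2 * rsum (fun r => binom_ratio m (S r) * cos (2 * INR (S r) * (PI * INR (S n) / INR l))) K)))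
    by (intros; apply cos_pow_rho, HK).
  rewrite rsum_scal, rsum_plus, rsum_scal, rsum_exchange.
  rewrite (rsum_ext (fun r => binom_ratio m (S r) * cos (2 * INR (S r) * 0)) (fun r => binom_ratio m (S r))) in H0.
  2:{ intros; rewrite Rmult_0_r, cos_0. ring. }
  rewrite H0 at 1.
  replace (rsum (fun _ => 1) L) with (INR L).
  2:{ clear. induction L as [| L IH]; [reflexivity |]. rewrite S_INR. simpl. rewrite <- IH. ring. }
  assert (HD := Dsum_sum (binom_ratio m) L m). fold l in HD. fold K in HD.
  rewrite (rsum_ext _ (fun r => binom_ratio m (S r) + 2 * rsum (fun n => binom_ratio m (S r) * cos (2 * INR (S r) * (PI * INR (S n) / INR l))) L)) in HD.
  2:{ intros r _. unfold dirichlet_sum. fold l. rewrite rsum_scal. ring. }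
  rewrite rsum_plus, rsum_scal in HD.
  assert (El : INR l = 2 * INR L + 1) by (unfold l; apply INR_odd).
  replace (INR l * central_weight m * (1 + 2 * rsum (fun k => binom_ratio m (S k * l)%nat) m))
    with (central_weight m * (INR l + 2 * (INR l * rsum (fun k => binom_ratio m (S k * l)%nat) m))) by ring.
  rewrite <- HD, El. ring.
Qed.

(** * The functional equation of theta *)

Lemma cos_quad_bounds (x : R) : -2 <= x <= 2 ->
  1 - x ^ 2 / 2 <= cos x <= 1 - x ^ 2 / 2 + x ^ 4 / 24.
Proof.
  intros [H1 H2]. destruct (pre_cos_bound x 0 H1 H2) as [L U].
  unfold cos_approx, cos_term in L, U. simpl in L, U. lra.
Qed.

Lemma exp_le_one_minus (y : R) : 0 <= y < 1 -> exp (- (y / (1 - y))) <= 1 - y.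
Proof.
  intros Hy. assert (H := exp_ineq1_le (y / (1 - y))).
  rewrite exp_Ropp. apply Rle_trans with (/ / (1 - y)); [| rewrite Rinv_inv; lra]. apply Rinv_le_contravar.
  - apply Rinv_0_lt_compat; lra.
  - apply Rle_trans with (1 + y / (1 - y)); [apply Req_le; field; lra | exact H].
Qed.

Lemma cos_pow_upper (m : nat) (x : R) : 0 <= x <= 2 -> 0 <= cos x ->
  cos x ^ (2 * m) <= exp (- (INR m * x ^ 2 * (1 - x ^ 2 / 12))).
Proof.
  intros Hx Hc. destruct (cos_quad_bounds x) as [_ U]; [lra |].
  assert (H := exp_ineq1_le (- (x ^ 2 / 2 - x ^ 4 / 24))).
  assert (H2 : cos x ^ (2 * m) <= exp (- (x ^ 2 / 2 - x ^ 4 / 24)) ^ (2 * m)) by (apply pow_incr; lra).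
  eapply Rle_trans; [exact H2 |]. rewrite <- exp_INR_pow. apply Req_le. f_equal.
  rewrite mult_INR. simpl (INR 2). field.
Qed.

Lemma cos_pow_lower (m : nat) (x : R) : 0 <= x <= 1 ->
  exp (- (INR m * x ^ 2 / (1 - x ^ 2 / 2))) <= cos x ^ (2 * m).
Proof.
  intros Hx. destruct (cos_quad_bounds x) as [L _]; [lra |].
  assert (Hy : 0 <= x ^ 2 / 2 < 1) by nra.
  assert (H := exp_le_one_minus _ Hy).
  assert (H2 : exp (- (x ^ 2 / 2 / (1 - x ^ 2 / 2))) ^ (2 * m) <= cos x ^ (2 * m)).
  { apply pow_incr. split; [left; apply exp_pos | lra]. }
  eapply Rle_trans; [| exact H2]. rewrite <- exp_INR_pow. apply Req_le. f_equal.
  rewrite mult_INR. simpl (INR 2). field. lra.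
Qed.

Lemma rho_nonneg (m r : nat) : 0 <= binom_ratio m r.
Proof.
  destruct (Nat.le_gt_cases r m) as [Hr | Hr]; [| rewrite rho_out by lia; lra].
  induction r as [| r IH]; simpl; [lra |].
  assert (P1 := pos_INR m). assert (P2 := pos_INR r). assert (P3 := le_INR r m ltac:(lia)).
  apply Rmult_le_pos; [apply IH; lia |]. apply Rmult_le_pos; [lra |]. left. apply Rinv_0_lt_compat. lra.
Qed.

(** Each factor is 1 - (2i + 1) / (m + i + 1) <= exp (-(2i + 1) / (m + R0)), and the numbers 2i + 1
    with i < r add up to r^2. The denominator m + R0 is frozen during the induction so that the
    exponents can be added. *)
Lemma rho_upper_aux (m R0 r : nat) : (r <= R0)%nat -> (R0 <= m)%nat -> (0 < m)%nat ->
  binom_ratio m r <= exp (- (INR r ^ 2 / (INR m + INR R0))).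
Proof.
  intros Hr HR Hm. assert (P0 := lt_0_INR m Hm). assert (P3 := pos_INR R0).
  induction r as [| r IH].
  - simpl. replace (- (0 * (0 * 1) / (INR m + INR R0))) with 0 by (field; lra). rewrite exp_0. lra.
  - specialize (IH ltac:(lia)). cbn [binom_ratio].
    assert (P1 := pos_INR r). assert (P2 := le_INR (S r) R0 Hr). assert (P4 := le_INR R0 m HR). rewrite S_INR in *.
    replace (- ((INR r + 1) ^ 2 / (INR m + INR R0)))
      with (- (INR r ^ 2 / (INR m + INR R0)) + - ((2 * INR r + 1) / (INR m + INR R0))) by (field; lra).
    rewrite exp_plus. apply Rmult_le_compat; [apply rho_nonneg | | exact IH |].
    + apply Rmult_le_pos; [lra | left; apply Rinv_0_lt_compat; lra].
    + assert (H := exp_ineq1_le (- ((2 * INR r + 1) / (INR m + INR R0)))).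
      eapply Rle_trans; [| exact H].
      replace ((INR m - INR r) / (INR m + INR r + 1)) with (1 + - ((2 * INR r + 1) / (INR m + INR r + 1))) by (field; lra).
      apply Rplus_le_compat_l, Ropp_le_contravar, Rmult_le_compat_l; [lra |].
      apply Rinv_le_contravar; lra.
Qed.

Lemma rho_upper (m r : nat) : (r <= m)%nat -> (0 < m)%nat -> binom_ratio m r <= exp (- (INR r ^ 2 / (INR m + INR r))).
Proof. intros; apply rho_upper_aux; trivial. Qed.

Lemma rho_dom (m r : nat) : (0 < m)%nat -> binom_ratio m r <= exp (- (INR r ^ 2 / (2 * INR m))).
Proof.
  intros Hm. destruct (Nat.le_gt_cases r m) as [Hr | Hr].
  - eapply Rle_trans. apply rho_upper; trivial. apply exp_le, Ropp_le_contravar.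
    assert (P0 := lt_0_INR m Hm). assert (P1 := pos_INR r). assert (P2 := le_INR r m Hr).
    apply Rmult_le_compat_l; [apply pow2_ge_0 |]. apply Rinv_le_contravar; lra.
  - rewrite rho_out by assumption. left; apply exp_pos.
Qed.

Lemma rho_lower (m r : nat) : (r < m)%nat -> exp (- (INR r ^ 2 / (INR m - INR r))) <= binom_ratio m r.
Proof.
  (* Here too the denominator m - r stays fixed while k runs up to r, so that the exponents add
     up. *)
  intros Hrm. assert (G : forall k, (k <= r)%nat -> exp (- (INR k ^ 2 / (INR m - INR r))) <= binom_ratio m k); [| apply G, le_n].
  assert (P1 := lt_INR r m Hrm). assert (P3 := pos_INR r).
  intros k. induction k as [| k IH]; intros Hk.
  - simpl. replace (- (0 * (0 * 1) / (INR m - INR r))) with 0 by (field; lra). rewrite exp_0. lra.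
  - specialize (IH ltac:(lia)). cbn [binom_ratio].
    assert (P2 := le_INR (S k) r Hk). assert (P4 := pos_INR k). rewrite S_INR in *.
    replace (- ((INR k + 1) ^ 2 / (INR m - INR r)))
      with (- (INR k ^ 2 / (INR m - INR r)) + - ((2 * INR k + 1) / (INR m - INR r))) by (field; lra).
    rewrite exp_plus. apply Rmult_le_compat; [left; apply exp_pos | left; apply exp_pos | exact IH |].
    rewrite exp_Ropp.
    replace ((INR m - INR k) / (INR m + INR k + 1)) with (/ (1 + (2 * INR k + 1) / (INR m - INR k))) by (field; lra).
    assert (Hle : (2 * INR k + 1) / (INR m - INR k) <= (2 * INR k + 1) / (INR m - INR r)).
    { apply Rmult_le_compat_l; [lra |]. apply Rinv_le_contravar; lra. }
    assert (H := exp_ineq1_le ((2 * INR k + 1) / (INR m - INR k))).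
    assert (H2 := exp_le _ _ Hle).
    assert (H3 : 0 < (2 * INR k + 1) / (INR m - INR k)) by (apply Rdiv_lt_0_compat; lra).
    apply Rinv_le_contravar; lra.
Qed.

Lemma is_lim_seq_INR_S : is_lim_seq (fun n => / INR (S n)) 0.
Proof.
  replace (Finite 0) with (Rbar_inv p_infty) by reflexivity.
  apply is_lim_seq_inv; [| discriminate].
  apply (is_lim_seq_incr_1 INR), is_lim_seq_INR.
Qed.

Lemma is_lim_seq_exp (u : nat -> R) (l : R) : is_lim_seq u l -> is_lim_seq (fun n => exp (u n)) (exp l).
Proof.
  intros H. apply (is_lim_seq_continuous exp u l); [| exact H].
  apply derivable_continuous_pt, derivable_pt_exp.
Qed.

Lemma cos_pow_limit (x : nat -> R) (lam : R) : (forall n, 0 <= x n) -> is_lim_seq x 0 ->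
  is_lim_seq (fun n => INR (S n) * x n ^ 2) lam ->
  is_lim_seq (fun n => cos (x n) ^ (2 * S n)) (exp (- lam)).
Proof.
  intros H0 Hx Hl.
  assert (Hx2 : is_lim_seq (fun n => x n ^ 2) 0).
  { replace (Finite 0) with (Finite (0 * (0 * 1))) by (f_equal; ring).
    apply is_lim_seq_mult'; [exact Hx |]. apply is_lim_seq_mult'; [exact Hx | apply is_lim_seq_const]. }
  assert (Hup : is_lim_seq (fun n => exp (- (INR (S n) * x n ^ 2 * (1 - x n ^ 2 / 12)))) (exp (- lam))).
  { apply is_lim_seq_exp. replace (- lam) with (- (lam * (1 - 0 * / 12))) by field.
    apply (is_lim_seq_opp _ (lam * (1 - 0 * / 12))). apply is_lim_seq_mult'; [exact Hl |].
    apply is_lim_seq_minus'; [apply is_lim_seq_const |]. apply is_lim_seq_mult'; [exact Hx2 | apply is_lim_seq_const]. }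
  assert (Hlo : is_lim_seq (fun n => exp (- (INR (S n) * x n ^ 2 / (1 - x n ^ 2 / 2)))) (exp (- lam))).
  { apply is_lim_seq_exp. replace (- lam) with (- (lam / (1 - 0 * / 2))) by field.
    apply (is_lim_seq_opp _ (lam / (1 - 0 * / 2))). apply is_lim_seq_div'; [exact Hl | | lra].
    apply is_lim_seq_minus'; [apply is_lim_seq_const |]. apply is_lim_seq_mult'; [exact Hx2 | apply is_lim_seq_const]. }
  refine (is_lim_seq_le_le_loc _ _ _ _ _ Hlo Hup).
  apply is_lim_seq_spec in Hx. destruct (Hx (mkposreal 1 Rlt_0_1)) as [N HN]. exists N.
  intros n Hn. specialize (HN n Hn). simpl in HN. rewrite Rminus_0_r in HN. apply Rabs_def2 in HN.
  specialize (H0 n). split; [apply cos_pow_lower; lra | apply cos_pow_upper; [lra |]].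
  destruct (cos_quad_bounds (x n)) as [L _]; [lra |]. nra.
Qed.

Lemma rho_limit (r : nat -> nat) (mu : R) : 0 <= mu ->
  is_lim_seq (fun n => INR (r n) ^ 2 / INR (S n)) mu ->
  is_lim_seq (fun n => binom_ratio (S n) (r n)) (exp (- mu)).
Proof.
  intros Hmu Hl.
  (* The square of r/m is r^2/m times 1/m, so r/m tends to 0; this merges the denominators m + r and
     m - r of the two bounds in the limit. *)
  assert (Hs : is_lim_seq (fun n => INR (r n) / INR (S n)) 0).
  { apply (is_lim_seq_ext (fun n => sqrt (INR (r n) ^ 2 / INR (S n) * / INR (S n)))).
    - intros n. assert (P := lt_0_INR (S n) ltac:(lia)). assert (P2 := pos_INR (r n)).
      replace (INR (r n) ^ 2 / INR (S n) * / INR (S n)) with ((INR (r n) / INR (S n)) ^ 2) by (field; lra).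
      apply sqrt_pow2. apply Rmult_le_pos; [lra | left; apply Rinv_0_lt_compat; lra].
    - rewrite <- sqrt_0. apply is_lim_seq_continuous; [apply continuity_pt_sqrt; lra |].
      replace (Finite 0) with (Finite (mu * 0)) by (f_equal; ring).
      apply is_lim_seq_mult'; [exact Hl | apply is_lim_seq_INR_S]. }
  assert (Hup : is_lim_seq (fun n => exp (- (INR (r n) ^ 2 / (INR (S n) + INR (r n))))) (exp (- mu))).
  { apply is_lim_seq_exp. replace (- mu) with (- (mu / (1 + 0))) by field.
    apply (is_lim_seq_ext (fun n => - (INR (r n) ^ 2 / INR (S n) / (1 + INR (r n) / INR (S n))))).
    - intros n. assert (P := lt_0_INR (S n) ltac:(lia)). assert (P2 := pos_INR (r n)). field. lra.
    - apply (is_lim_seq_opp _ (mu / (1 + 0))). apply is_lim_seq_div'; [exact Hl | | lra].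
      apply is_lim_seq_plus'; [apply is_lim_seq_const | exact Hs]. }
  assert (Hev : exists N, forall n, (N <= n)%nat -> (r n < S n)%nat).
  { apply is_lim_seq_spec in Hs. destruct (Hs (mkposreal 1 Rlt_0_1)) as [N HN]. exists N.
    intros n Hn. specialize (HN n Hn). simpl in HN. rewrite Rminus_0_r in HN. apply Rabs_def2 in HN.
    apply INR_lt. assert (P := lt_0_INR (S n) ltac:(lia)).
    apply (Rmult_lt_reg_r (/ INR (S n))); [apply Rinv_0_lt_compat; exact P |].
    rewrite Rinv_r by lra. apply HN. }
  destruct Hev as [N HN].
  assert (Hlo : is_lim_seq (fun n => exp (- (INR (r n) ^ 2 / (INR (S n) - INR (r n))))) (exp (- mu))).
  { apply is_lim_seq_exp. replace (- mu) with (- (mu / (1 - 0))) by field.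
    apply (is_lim_seq_ext_loc (fun n => - (INR (r n) ^ 2 / INR (S n) / (1 - INR (r n) / INR (S n))))).
    - exists N. intros n Hn. assert (P := lt_0_INR (S n) ltac:(lia)). assert (P2 := lt_INR _ _ (HN n Hn)). field. lra.
    - apply (is_lim_seq_opp _ (mu / (1 - 0))). apply is_lim_seq_div'; [exact Hl | | lra].
      apply is_lim_seq_minus'; [apply is_lim_seq_const | exact Hs]. }
  refine (is_lim_seq_le_le_loc _ _ _ _ _ Hlo Hup).
  exists N. intros n Hn. specialize (HN n Hn). split; [apply rho_lower | apply rho_upper]; lia.
Qed.

Lemma odd_near (y : R) : 0 <= y -> exists L : nat, y - 1 <= INR (2 * L + 1) <= y + 1.
Proof.
  intros Hy. destruct (nfloor_ex (y / 2)) as [L HL]; [lra |].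
  exists L. rewrite INR_odd. lra.
Qed.

(** The odd number l = 2L + 1 is taken within 1 of sqrt (PI t m), m = n + 1. The two inequalities
    valid for every n are there to dominate the two sides of [polya_identity] in [tannery]. *)
Lemma polya_sequence (t : R) : 0 < t -> exists L : nat -> nat,
  is_lim_seq (fun n => INR (2 * L n + 1) ^ 2 / INR (S n)) (PI * t) /\
  (forall n, INR (2 * L n + 1) ^ 2 <= (2 * PI * t + 2) * INR (S n)) /\
  (forall n, PI * t / 4 * INR (S n) <= INR (2 * L n + 1) ^ 2).
Proof.
  intros Ht. assert (HPI := PI_RGT_0). assert (HPt : 0 < PI * t) by nra.
  destruct (choice (fun n L => sqrt (PI * t * INR (S n)) - 1 <= INR (2 * L + 1) <= sqrt (PI * t * INR (S n)) + 1)) as [L HL].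
  { intros n. apply odd_near, sqrt_pos. }
  assert (Hsq : forall n, sqrt (PI * t * INR (S n)) ^ 2 = PI * t * INR (S n)).
  { intros n. apply pow2_sqrt. assert (P := lt_0_INR (S n) ltac:(lia)). nra. }
  assert (Hone : forall n, 1 <= INR (S n)) by (intros n; rewrite S_INR; assert (P := pos_INR n); lra).
  exists L. split; [| split].
  (* With s = sqrt (PI t m), |l - s| <= 1 gives |l^2 - s^2| <= 2s + 1, which divided by m is at most
     (2 sqrt (PI t) + 1) / sqrt m. *)
  - assert (Hb : is_lim_seq (fun n => (2 * sqrt (PI * t) + 1) * sqrt (/ INR (S n))) 0).
    { replace (Finite 0) with (Finite ((2 * sqrt (PI * t) + 1) * 0)) by (f_equal; ring).
      apply is_lim_seq_mult'; [apply is_lim_seq_const |]. rewrite <- sqrt_0.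
      apply is_lim_seq_continuous; [apply continuity_pt_sqrt; lra | apply is_lim_seq_INR_S]. }
    assert (Hlo : is_lim_seq (fun n => PI * t - (2 * sqrt (PI * t) + 1) * sqrt (/ INR (S n))) (PI * t)).
    { replace (Finite (PI * t)) with (Finite (PI * t - 0)) by (f_equal; ring).
      apply is_lim_seq_minus'; [apply is_lim_seq_const | exact Hb]. }
    assert (Hup : is_lim_seq (fun n => PI * t + (2 * sqrt (PI * t) + 1) * sqrt (/ INR (S n))) (PI * t)).
    { replace (Finite (PI * t)) with (Finite (PI * t + 0)) by (f_equal; ring).
      apply is_lim_seq_plus'; [apply is_lim_seq_const | exact Hb]. }
    refine (is_lim_seq_le_le _ _ _ _ _ Hlo Hup). intros n.
    specialize (HL n). specialize (Hsq n). specialize (Hone n).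
    set (m := INR (S n)) in *. set (l := INR (2 * L n + 1)) in *.
    assert (E1 : sqrt (PI * t * m) = sqrt (PI * t) * sqrt m) by (apply sqrt_mult; lra).
    assert (S1 := sqrt_lt_R0 (PI * t) HPt). assert (S2 : 1 <= sqrt m) by (rewrite <- sqrt_1; apply sqrt_le_1; lra).
    assert (E2 : sqrt m * sqrt m = m) by (apply sqrt_sqrt; lra).
    rewrite sqrt_inv.
    assert (Hl0 : 0 <= l) by apply pos_INR.
    rewrite E1 in *. set (p := sqrt (PI * t)) in *. set (q := sqrt m) in *.
    assert (Hp2 : p * p = PI * t) by (apply sqrt_sqrt; lra).
    assert (D1 : - (2 * p * q + 1) <= l ^ 2 - PI * t * m <= 2 * p * q + 1).
    { rewrite <- Hsq. assert (Hpq : 0 < p * q) by nra. assert (Hl2 : l * l <= (p * q + 1) * (p * q + 1)) by nra.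
      split; [| nra]. destruct (Rle_dec 1 (p * q)) as [H | H]; nra. }
    assert (Em : (2 * p + 1) * / q = (2 * p + 1) * q / m) by (rewrite <- E2; field; lra).
    rewrite Em.
    assert (Dm : 2 * p * q + 1 <= (2 * p + 1) * q) by nra.
    split; apply (Rmult_le_reg_r m); try lra.
    + replace ((PI * t - (2 * p + 1) * q / m) * m) with (PI * t * m - (2 * p + 1) * q) by (field; lra).
      replace (l ^ 2 / m * m) with (l ^ 2) by (field; lra). lra.
    + replace ((PI * t + (2 * p + 1) * q / m) * m) with (PI * t * m + (2 * p + 1) * q) by (field; lra).
      replace (l ^ 2 / m * m) with (l ^ 2) by (field; lra). lra.
  - intros n. specialize (HL n). specialize (Hsq n). specialize (Hone n). assert (Hp := pos_INR (2 * L n + 1)).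
    assert (Hs := sqrt_pos (PI * t * INR (S n))). set (s := sqrt (PI * t * INR (S n))) in *. set (l := INR (2 * L n + 1)) in *.
    assert (Hl2 : l * l <= (s + 1) * (s + 1)) by (apply Rmult_le_compat; lra).
    assert (Hs2 := Rle_0_sqr (s - 1)). unfold Rsqr in Hs2.
    replace (l ^ 2) with (l * l) by ring. replace (s ^ 2) with (s * s) in Hsq by ring. lra.
  - intros n. specialize (HL n). specialize (Hsq n). specialize (Hone n).
    (* From l >= 1 and l >= s - 1 follows l >= s / 2, hence the constant PI t / 4. *)
    assert (Hp : 1 <= INR (2 * L n + 1)) by (rewrite INR_odd; assert (Hp := pos_INR (L n)); lra).
    assert (Hs := sqrt_pos (PI * t * INR (S n))).
    replace (PI * t / 4 * INR (S n)) with ((sqrt (PI * t * INR (S n)) / 2) ^ 2).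
    + apply pow_incr. split; lra.
    + rewrite <- (Rmult_1_l (PI * t / 4 * INR (S n))). unfold Rdiv. rewrite Rpow_mult_distr, Hsq. field.
Qed.

(** The left side of [polya_identity] tends to theta (1/t), the sum on the right to theta t, and l
    is asymptotic to sqrt (PI t m). What remains is the weight, whose limit is thereby computed for
    each t although the sequence itself does not depend on t. *)
Lemma polya_limit (t : R) : 0 < t ->
  is_lim_seq (fun n => sqrt (INR (S n)) * central_weight (S n)) (theta (/ t) / (theta t * sqrt (PI * t))).
Proof.
  intros Ht. destruct (polya_sequence t Ht) as [L [Hl [Hub Hlb]]].
  assert (HPI := PI_RGT_0). assert (HPt : 0 < PI * t) by nra.
  set (l := fun n => (2 * L n + 1)%nat) in *.
  assert (Hl1 : forall n, 1 <= INR (l n)).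
  { intros n. unfold l. rewrite INR_odd. assert (Hp := pos_INR (L n)). lra. }
  assert (Hm : forall n, 0 < INR (S n)) by (intros n; apply lt_0_INR; lia).
  (* The finite sum is continued by zero beyond L n to become a series; for fixed k the cut is
     eventually passed. *)
  set (f := fun n k => if (k <? L n)%nat then cos (PI * INR (S k) / INR (l n)) ^ (2 * S n) else 0).
  assert (HF : is_lim_seq (fun n => Series (f n)) (Series (gauss (/ t)))).
  (* At the sample point x = PI k / l, the upper bound on l^2 gives m x^2 >= c k^2. The sample
     points are at most PI / 2, where the correction 1 - x^2 / 12 is at least 1/2; hence the rate c
     / 2. *)
  { set (c := PI ^ 2 / (2 * PI * t + 2)).
    assert (Hc : 0 < c) by (apply Rdiv_lt_0_compat; nra).
    apply (tannery _ _ (fun k => exp (- (c / 2) * INR (S k) ^ 2))).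
    - intros k.
      assert (Hlinf : is_lim_seq (fun n => INR (S n) / INR (l n) ^ 2) (/ (PI * t))).
      { apply (is_lim_seq_ext (fun n => / (INR (l n) ^ 2 / INR (S n)))).
        - intros n. specialize (Hl1 n). specialize (Hm n). field. lra.
        - apply (is_lim_seq_inv _ (Finite (PI * t)) Hl). intros E. injection E. lra. }
      assert (Hx : is_lim_seq (fun n => PI * INR (S k) / INR (l n)) 0).
      { apply (is_lim_seq_ext (fun n => PI * INR (S k) * sqrt (INR (S n) / INR (l n) ^ 2 * / INR (S n)))).
        - intros n. specialize (Hl1 n). specialize (Hm n).
          replace (INR (S n) / INR (l n) ^ 2 * / INR (S n)) with ((/ INR (l n)) ^ 2) by (field; lra).
          rewrite sqrt_pow2 by (left; apply Rinv_0_lt_compat; lra). reflexivity.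
        - replace (Finite 0) with (Finite (PI * INR (S k) * 0)) by (f_equal; ring).
          apply is_lim_seq_mult'; [apply is_lim_seq_const |]. rewrite <- sqrt_0.
          apply is_lim_seq_continuous; [apply continuity_pt_sqrt; lra |].
          replace (Finite 0) with (Finite (/ (PI * t) * 0)) by (f_equal; ring).
          apply is_lim_seq_mult'; [exact Hlinf | apply is_lim_seq_INR_S]. }
      apply (is_lim_seq_ext_loc (fun n => cos (PI * INR (S k) / INR (l n)) ^ (2 * S n))).
      + apply is_lim_seq_spec in Hx. assert (Hpos : 0 < PI / 4) by lra.
        destruct (Hx (mkposreal _ Hpos)) as [N HN]. exists N. intros n Hn. specialize (HN n Hn). simpl in HN.
        unfold f. destruct (Nat.ltb_spec k (L n)) as [H | H]; [reflexivity | exfalso].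
        rewrite Rminus_0_r in HN. apply Rabs_def2 in HN. destruct HN as [HN _].
        apply le_INR in H. specialize (Hl1 n).
        assert (E : PI * INR (S k) < PI / 4 * INR (l n)).
        { apply (Rmult_lt_compat_r (INR (l n))) in HN; [| lra]. unfold Rdiv in HN at 1.
          rewrite (Rmult_assoc (PI * _)), Rinv_l in HN by lra. simpl in HN |- *. lra. }
        unfold l in E. rewrite INR_odd, S_INR in E. assert (Q := pos_INR k). nra.
      + rewrite gauss_eq. replace (- (PI * / t) * INR (S k) ^ 2) with (- ((PI * INR (S k)) ^ 2 * / (PI * t))) by (field; lra).
        apply cos_pow_limit; [| exact Hx |].
        * intros n. specialize (Hl1 n). apply Rmult_le_pos; [apply Rmult_le_pos; [lra | apply pos_INR] | left; apply Rinv_0_lt_compat; lra].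
        * apply (is_lim_seq_ext (fun n => (PI * INR (S k)) ^ 2 * (INR (S n) / INR (l n) ^ 2))).
          -- intros n. specialize (Hl1 n). field. lra.
          -- apply is_lim_seq_mult'; [apply is_lim_seq_const | exact Hlinf].
    - intros n k. unfold f. destruct (Nat.ltb_spec k (L n)) as [H | H]; [| rewrite Rabs_R0; left; apply exp_pos].
      specialize (Hl1 n). specialize (Hm n). specialize (Hub n). change (INR (2 * L n + 1)) with (INR (l n)) in Hub.
      assert (HL : INR (S k) <= INR (L n)) by (apply le_INR; lia).
      assert (HlL : INR (l n) = 2 * INR (L n) + 1) by apply INR_odd.
      assert (Q := pos_INR (S k)).
      set (x := PI * INR (S k) / INR (l n)).
      assert (Hxl : x * INR (l n) = PI * INR (S k)) by (unfold x; field; lra).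
      assert (Hx0 : 0 <= x) by (apply Rmult_le_pos; [nra | left; apply Rinv_0_lt_compat; lra]).
      assert (Hx1 : x <= PI / 2) by (apply (Rmult_le_reg_r (INR (l n))); [lra |]; rewrite Hxl; nra).
      assert (HP4 := PI_4).
      rewrite Rabs_pos_eq.
      + eapply Rle_trans. apply cos_pow_upper; [lra | apply cos_ge_0; lra].
        apply exp_le. assert (Hxx : x ^ 2 / 12 <= / 2) by nra.
        assert (Hmx : c * INR (S k) ^ 2 <= INR (S n) * x ^ 2).
        { apply (Rmult_le_reg_r (INR (l n) ^ 2)); [nra |].
          replace (INR (S n) * x ^ 2 * INR (l n) ^ 2) with (INR (S n) * (x * INR (l n)) ^ 2) by ring.
          rewrite Hxl.
          apply Rle_trans with (c * INR (S k) ^ 2 * ((2 * PI * t + 2) * INR (S n))).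
          - apply Rmult_le_compat_l; [| exact Hub]. apply Rmult_le_pos; [lra | apply pow2_ge_0].
          - apply Req_le. unfold c. field. lra. }
        assert (Hcc : 0 <= c * INR (S k) ^ 2) by (apply Rmult_le_pos; [lra | apply pow2_ge_0]). nra.
      + rewrite pow_mult. apply pow_le, pow2_ge_0.
    - apply ex_series_exp_sq. lra. }
  set (g := fun n k => binom_ratio (S n) (S k * l n)%nat).
  assert (HG : is_lim_seq (fun n => Series (g n)) (Series (gauss t))).
  (* The rate PI t / 8 comes from the lower bound l^2 >= (PI t / 4) m inserted in r^2 / (2m) with r
     = k l. *)
  { apply (tannery _ _ (fun k => exp (- (PI * t / 8) * INR (S k) ^ 2))).
    - intros k. rewrite gauss_eq. replace (- (PI * t) * INR (S k) ^ 2) with (- (INR (S k) ^ 2 * (PI * t))) by ring.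
      apply rho_limit; [apply Rmult_le_pos; [apply pow2_ge_0 | lra] |].
      apply (is_lim_seq_ext (fun n => INR (S k) ^ 2 * (INR (l n) ^ 2 / INR (S n)))).
      + intros n. specialize (Hm n). rewrite mult_INR. field. lra.
      + apply is_lim_seq_mult'; [apply is_lim_seq_const | exact Hl].
    - intros n k. unfold g. rewrite Rabs_pos_eq by apply rho_nonneg.
      eapply Rle_trans. apply rho_dom; lia. apply exp_le. rewrite mult_INR.
      specialize (Hlb n). specialize (Hm n). change (INR (2 * L n + 1)) with (INR (l n)) in Hlb.
      assert (H1 : PI * t / 8 <= INR (l n) ^ 2 / (2 * INR (S n))).
      { apply (Rmult_le_reg_r (2 * INR (S n))); [lra |].
        replace (INR (l n) ^ 2 / (2 * INR (S n)) * (2 * INR (S n))) with (INR (l n) ^ 2) by (field; lra). lra. }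
      replace ((INR (S k) * INR (l n)) ^ 2 / (2 * INR (S n))) with (INR (S k) ^ 2 * (INR (l n) ^ 2 / (2 * INR (S n)))) by (field; lra).
      assert (Q := pow2_ge_0 (INR (S k))). nra.
    - apply ex_series_exp_sq. lra. }
  assert (Hid : forall n, 1 + 2 * Series (f n) = INR (l n) * central_weight (S n) * (1 + 2 * Series (g n))).
  { intros n. rewrite (Series_finite (f n) (L n)), (Series_finite (g n) (S n)).
    - transitivity (INR (2 * L n + 1) * central_weight (S n) * (1 + 2 * rsum (fun k => binom_ratio (S n) (S k * (2 * L n + 1))%nat) (S n))); [| reflexivity].
      rewrite <- (polya_identity (S n) (L n)). do 2 f_equal. apply rsum_ext. intros k Hk. unfold f.
      destruct (Nat.ltb_spec k (L n)) as [H | H]; [reflexivity | lia].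
    - intros k Hk. apply rho_out. unfold l. nia.
    - intros k Hk. unfold f. destruct (Nat.ltb_spec k (L n)) as [H | H]; [lia | reflexivity]. }
  assert (Hg1 : forall n, 1 <= 1 + 2 * Series (g n)).
  { intros n. rewrite (Series_finite (g n) (S n)) by (intros k Hk; apply rho_out; unfold l; nia).
    assert (Hp : 0 <= rsum (g n) (S n)).
    { apply rsum_nonneg. intros; apply rho_nonneg. }
    lra. }
  assert (Hti : 0 < / t) by (apply Rinv_0_lt_compat, Ht).
  apply (is_lim_seq_ext (fun n => (1 + 2 * Series (f n)) / ((1 + 2 * Series (g n)) * sqrt (INR (l n) ^ 2 / INR (S n))))).
  { intros n. rewrite Hid. specialize (Hg1 n). specialize (Hl1 n). specialize (Hm n).
    rewrite sqrt_div_alt, sqrt_pow2 by lra. assert (Hs := sqrt_lt_R0 _ Hm). field. lra. }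
  assert (Hth := theta_gt_1 t Ht). assert (Hsq := sqrt_lt_R0 _ HPt).
  rewrite (theta_gauss (/ t)), (theta_gauss t) in * by assumption.
  apply is_lim_seq_div'.
  - apply is_lim_seq_plus'; [apply is_lim_seq_const |]. apply is_lim_seq_mult'; [apply is_lim_seq_const | exact HF].
  - apply is_lim_seq_mult'.
    + apply is_lim_seq_plus'; [apply is_lim_seq_const |]. apply is_lim_seq_mult'; [apply is_lim_seq_const | exact HG].
    + apply is_lim_seq_continuous; [apply continuity_pt_sqrt; lra | exact Hl].
  - nra.
Qed.

(** The limits of [polya_limit] for t and for 1 are limits of the same sequence. At t = 1 the theta
    values cancel and the limit is 1 / sqrt PI, which fixes the constant. *)
Lemma theta_functional (t : R) : 0 < t -> theta (/ t) = sqrt t * theta t.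
Proof.
  intros Ht. assert (H1 := polya_limit t Ht). assert (H2 := polya_limit 1 Rlt_0_1).
  assert (E := is_lim_seq_unique _ _ H1). rewrite (is_lim_seq_unique _ _ H2) in E.
  injection E as E. rewrite Rinv_1 in E.
  assert (T1 := theta_gt_1 1 Rlt_0_1). assert (T2 := theta_gt_1 t Ht).
  assert (HPI := PI_RGT_0). rewrite Rmult_1_r, (sqrt_mult PI t) in E by lra.
  assert (S1 := sqrt_lt_R0 PI HPI). assert (S2 := sqrt_lt_R0 t Ht).
  assert (E2 : theta 1 / (theta 1 * sqrt PI) = / sqrt PI) by (field; lra). rewrite E2 in E.
  apply (Rmult_eq_reg_r (/ (theta t * (sqrt PI * sqrt t)))).
  - change (theta (/ t) / (theta t * (sqrt PI * sqrt t)) = sqrt t * theta t * / (theta t * (sqrt PI * sqrt t))).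
    rewrite <- E. field. lra.
  - apply Rinv_neq_0_compat, Rgt_not_eq. repeat apply Rmult_lt_0_compat; lra.
Qed.

(** * Formal power series *)

Definition fadd (a b : nat -> R) : nat -> R := fun n => a n + b n.
Definition fopp (a : nat -> R) : nat -> R := fun n => - a n.
Definition fsub (a b : nat -> R) : nat -> R := fun n => a n - b n.
Definition fmul (a b : nat -> R) : nat -> R := fun n => rsum (fun k => a k * b (n - k)%nat) (S n).
Definition fmono (c : R) (m : nat) : nat -> R := fun n => if Nat.eqb n m then c else 0.
Definition fzero : nat -> R := fun _ => 0.
Definition fone : nat -> R := fmono 1 0.
(** The Euler derivation X d/dX, which is a derivation like d/dX but keeps the index in place. *)
Definition fD (a : nat -> R) : nat -> R := fun n => INR n * a n.

Lemma rsum_rev (f : nat -> R) (n : nat) : rsum f (S n) = rsum (fun k => f (n - k)%nat) (S n).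
Proof.
  induction n as [| n IH]; [reflexivity |].
  rewrite (rsum_first (fun k => f (S n - k)%nat)).
  change (rsum f (S (S n))) with (rsum f (S n) + f (S n)). rewrite IH, Nat.sub_0_r, Rplus_comm.
  f_equal.
Qed.

Lemma rsum_triangle (F : nat -> nat -> R) (n : nat) :
  rsum (fun k => rsum (fun i => F i k) (S k)) (S n)
  = rsum (fun i => rsum (fun j => F i (i + j)%nat) (S (n - i))) (S n).
Proof.
  induction n as [| n IH]; [reflexivity |].
  change (rsum (fun k => rsum (fun i => F i k) (S k)) (S (S n)))
    with (rsum (fun k => rsum (fun i => F i k) (S k)) (S n) + rsum (fun i => F i (S n)) (S (S n))).
  rewrite IH.
  set (A := fun i => rsum (fun j => F i (i + j)%nat) (S (S n - i))).
  change (rsum A (S (S n))) with (rsum A (S n) + A (S n)).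
  change (rsum (fun i => F i (S n)) (S (S n))) with (rsum (fun i => F i (S n)) (S n) + F (S n) (S n)).
  rewrite <- Rplus_assoc, <- rsum_plus. f_equal.
  - apply rsum_ext. intros i Hi. unfold A. replace (S n - i)%nat with (S (n - i)) by lia.
    change (rsum (fun j => F i (i + j)%nat) (S (S (n - i))))
      with (rsum (fun j => F i (i + j)%nat) (S (n - i)) + F i (i + S (n - i))%nat).
    do 2 f_equal. lia.
  - unfold A. rewrite Nat.sub_diag. simpl. rewrite Nat.add_0_r. ring.
Qed.

Lemma fmul_comm (a b : nat -> R) : fmul a b = fmul b a.
Proof.
  apply functional_extensionality; intros n. unfold fmul. rewrite rsum_rev.
  apply rsum_ext. intros k Hk. replace (n - (n - k))%nat with k by lia. ring.
Qed.

Lemma fmul_assoc (a b c : nat -> R) : fmul a (fmul b c) = fmul (fmul a b) c.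
Proof.
  apply functional_extensionality; intros n. unfold fmul.
  rewrite (rsum_ext (fun k => rsum (fun i => a i * b (k - i)%nat) (S k) * c (n - k)%nat)
    (fun k => rsum (fun i => a i * b (k - i)%nat * c (n - k)%nat) (S k))).
  2:{ intros k _. rewrite Rmult_comm, <- rsum_scal. apply rsum_ext; intros; ring. }
  rewrite (rsum_triangle (fun i k => a i * b (k - i)%nat * c (n - k)%nat)).
  apply rsum_ext. intros i Hi. rewrite <- rsum_scal. apply rsum_ext. intros j Hj.
  replace (i + j - i)%nat with j by lia. replace (n - (i + j))%nat with (n - i - j)%nat by lia. ring.
Qed.

Lemma fmul_mono (c : R) (m : nat) (a : nat -> R) (n : nat) :
  fmul (fmono c m) a n = if Nat.leb m n then c * a (n - m)%nat else 0.
Proof.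
  unfold fmul, fmono. destruct (Nat.leb_spec m n) as [H | H].
  - replace (S n) with (m + S (n - m))%nat by lia. rewrite rsum_split, rsum_first, Nat.add_0_r, Nat.eqb_refl.
    rewrite !rsum_zero; [ring | |].
    + intros k Hk. destruct (Nat.eqb_spec (m + S k) m); [lia | ring].
    + intros k Hk. destruct (Nat.eqb_spec k m); [lia | ring].
  - apply rsum_zero. intros k Hk. destruct (Nat.eqb_spec k m); [lia | ring].
Qed.

Lemma fmul_one (a : nat -> R) : fmul fone a = a.
Proof.
  apply functional_extensionality; intros n. unfold fone. rewrite fmul_mono, Nat.sub_0_r. simpl. ring.
Qed.

Lemma fmul_add_l (a b c : nat -> R) : fmul (fadd a b) c = fadd (fmul a c) (fmul b c).
Proof.
  apply functional_extensionality; intros n. unfold fmul, fadd. rewrite <- rsum_plus.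
  apply rsum_ext; intros; ring.
Qed.

(** By functional extensionality the laws hold for Leibniz equality, so [ring] applies to products
    of series and [rewrite] works inside them. *)
Lemma fps_ring : ring_theory fzero fone fadd fmul fsub fopp (@eq (nat -> R)).
Proof.
  constructor; intros; try (apply functional_extensionality; intros n; unfold fzero, fadd, fsub, fopp; ring).
  - apply fmul_one.
  - apply fmul_comm.
  - apply fmul_assoc.
  - apply fmul_add_l.
Qed.

Add Ring fps_ring : fps_ring.

Lemma fmul_const (c : R) (a : nat -> R) (n : nat) : fmul (fmono c 0) a n = c * a n.
Proof. rewrite fmul_mono, Nat.sub_0_r. reflexivity. Qed.

Lemma fD_mul (a b : nat -> R) : fD (fmul a b) = fadd (fmul (fD a) b) (fmul a (fD b)).
Proof.
  apply functional_extensionality; intros n. unfold fD, fadd, fmul. rewrite <- rsum_plus, <- rsum_scal.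
  apply rsum_ext. intros k Hk. rewrite minus_INR by lia. ring.
Qed.

Lemma fD_add (a b : nat -> R) : fD (fadd a b) = fadd (fD a) (fD b).
Proof. apply functional_extensionality; intros n. unfold fD, fadd. ring. Qed.

Lemma fD_mono (c : R) (m : nat) : fD (fmono c m) = fmono (INR m * c) m.
Proof.
  apply functional_extensionality; intros n. unfold fD, fmono.
  destruct (Nat.eqb_spec n m) as [-> |]; ring.
Qed.

Lemma fmono_mul (c d : R) (m n : nat) : fmul (fmono c m) (fmono d n) = fmono (c * d) (m + n).
Proof.
  apply functional_extensionality; intros k. rewrite fmul_mono. unfold fmono.
  destruct (Nat.leb_spec m k); destruct (Nat.eqb_spec k (m + n)); destruct (Nat.eqb_spec (k - m) n); try lia; ring.
Qed.

Lemma PS_mult_fmul (a b : nat -> R) : PS_mult a b = fmul a b.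
Proof.
  apply functional_extensionality; intros n. unfold PS_mult, fmul.
  rewrite <- sum_n_rsum. symmetry. apply sum_n_Reals.
Qed.

(* geom_ratio c m is X^m / (1 + c X^m). *)
Definition geom_ratio (c : R) (m : nat) : nat -> R := fun k =>
  if Nat.eqb k 0 then 0 else if Nat.eqb (k mod m) 0 then (- c) ^ (k / m - 1) else 0.

Lemma geo_inverse (c : R) (m : nat) : (0 < m)%nat ->
  fmul (fadd fone (fmono c m)) (geom_ratio c m) = fmono 1 m.
Proof.
  intros Hm. apply functional_extensionality; intros k.
  rewrite fmul_add_l, fmul_one. unfold fadd. rewrite fmul_mono. unfold geom_ratio, fmono.
  destruct (Nat.leb_spec m k) as [H | H].
  - assert (E : (k = (k - m) + 1 * m)%nat) by lia.
    assert (Em : (k mod m = (k - m) mod m)%nat) by (rewrite E at 1; apply Nat.Div0.mod_add).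
    assert (Ed : (k / m = (k - m) / m + 1)%nat) by (rewrite E at 1; apply Nat.div_add; lia).
    destruct (Nat.eqb_spec k 0); [lia |]. rewrite Em, Ed.
    destruct (Nat.eqb_spec k m) as [-> | Hne].
    + rewrite Nat.sub_diag, Nat.Div0.mod_0_l, Nat.Div0.div_0_l. simpl. ring.
    + destruct (Nat.eqb_spec (k - m) 0); [lia |].
      destruct (Nat.eqb_spec ((k - m) mod m) 0) as [Hz | Hz]; [| ring].
      assert (Hq : (1 <= (k - m) / m)%nat).
      { apply Nat.Div0.div_exact in Hz. destruct ((k - m) / m)%nat; lia. }
      replace ((k - m) / m + 1 - 1)%nat with (S ((k - m) / m - 1)) by lia. simpl. ring.
  - destruct (Nat.eqb_spec k m); [lia |]. destruct (Nat.eqb_spec k 0); [ring |].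
    rewrite Nat.mod_small by lia. destruct (Nat.eqb_spec k 0); [lia | ring].
Qed.

Lemma geo_small (c : R) (m k : nat) : (k < m)%nat -> geom_ratio c m k = 0.
Proof.
  intros H. unfold geom_ratio. destruct (Nat.eqb_spec k 0); trivial.
  rewrite Nat.mod_small by lia. destruct (Nat.eqb_spec k 0); [lia | trivial].
Qed.

Lemma geo_abs (c : R) (m k : nat) : Rabs c = 1 ->
  Rabs (geom_ratio c m (S k)) <= if Nat.eqb (S k mod m) 0 then 1 else 0.
Proof.
  intros Hc. unfold geom_ratio. destruct (Nat.eqb_spec (S k) 0); [lia |].
  destruct (Nat.eqb (S k mod m) 0).
  - rewrite <- RPow_abs, Rabs_Ropp, Hc, pow1. lra.
  - rewrite Rabs_R0. lra.
Qed.

(** The logarithmic derivative of 1 + c X^m is m c X^m / (1 + c X^m). *)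
Lemma fD_one_plus (c : R) (m : nat) : (0 < m)%nat ->
  fD (fadd fone (fmono c m)) = fmul (fmul (fmono (INR m * c) 0) (geom_ratio c m)) (fadd fone (fmono c m)).
Proof.
  intros Hm.
  replace (fmul (fmul (fmono (INR m * c) 0) (geom_ratio c m)) (fadd fone (fmono c m)))
    with (fmul (fmono (INR m * c) 0) (fmul (fadd fone (fmono c m)) (geom_ratio c m))) by ring.
  rewrite geo_inverse, fmono_mul by assumption. unfold fone. rewrite fD_add, !fD_mono.
  apply functional_extensionality; intros n. unfold fadd, fmono. simpl (0 + m)%nat. simpl (INR 0).
  destruct (Nat.eqb n m); destruct (Nat.eqb n 0); ring.
Qed.

(** Partial products of Jacobi's product for theta: the factors are (1 - X^(2n+2)) (1 + X^(2n+1))^2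
    with X = e^(-pi x). *)
Fixpoint triple_prod (N : nat) : nat -> R :=
  match N with
  | O => fone
  | S n => fmul (fmul (triple_prod n) (fadd fone (fmono (-1) (2 * n + 2))))
                (fmul (fadd fone (fmono 1 (2 * n + 1))) (fadd fone (fmono 1 (2 * n + 1))))
  end.

Fixpoint triple_logder (N : nat) : nat -> R :=
  match N with
  | O => fzero
  | S n => fadd (fadd (triple_logder n) (fmul (fmono (INR (2 * n + 2) * -1) 0) (geom_ratio (-1) (2 * n + 2))))
                (fadd (fmul (fmono (INR (2 * n + 1) * 1) 0) (geom_ratio 1 (2 * n + 1)))
                      (fmul (fmono (INR (2 * n + 1) * 1) 0) (geom_ratio 1 (2 * n + 1))))
  end.

Lemma fD_fP (N : nat) : fD (triple_prod N) = fmul (triple_logder N) (triple_prod N).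
Proof.
  induction N as [| n IH].
  - simpl. unfold fone. rewrite fD_mono. apply functional_extensionality; intros k.
    unfold fmul. rewrite rsum_zero by (intros; unfold fzero; ring). unfold fmono. simpl. destruct (Nat.eqb k 0); ring.
  - cbn [triple_prod triple_logder]. rewrite !fD_mul, IH, !fD_one_plus by lia. ring.
Qed.

Lemma fL_stable (N n : nat) : (n <= N)%nat -> triple_logder N n = triple_logder n n.
Proof.
  intros H. replace N with (n + (N - n))%nat by lia. induction (N - n)%nat as [| d IH]; [now rewrite Nat.add_0_r |].
  rewrite Nat.add_succ_r. cbn [triple_logder]. unfold fadd. rewrite !fmul_const, !geo_small by lia. rewrite IH. ring.
Qed.

Definition theta_coef (k : nat) : R := match k with O => 1 | S _ => 2 * square_coef k end.

Lemma square_coef_sq (n : nat) : square_coef (S n * S n) = 1.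
Proof.
  unfold square_coef. rewrite Nat.sqrt_square, Nat.eqb_refl.
  destruct (S n * S n)%nat eqn:E; [lia | reflexivity].
Qed.

Lemma square_coef_gap (n i : nat) : (i < 2 * n)%nat -> square_coef (n * n + 1 + i) = 0.
Proof.
  intros H. unfold square_coef. rewrite (Nat.sqrt_unique (n * n + 1 + i) n) by lia.
  destruct (Nat.eqb_spec (n * n) (n * n + 1 + i)); [lia |].
  destruct (n * n + 1 + i)%nat; reflexivity.
Qed.

Lemma th_bound (k : nat) : Rabs (theta_coef k) <= 2.
Proof.
  destruct k as [| k]; unfold theta_coef; [rewrite Rabs_R1; lra |].
  unfold square_coef. destruct (Nat.eqb _ _); rewrite Rabs_pos_eq; lra.
Qed.

(** The coefficients between consecutive squares vanish, so a partial sum of length n^2 + 1 ends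
    exactly with the n-th Gaussian term. *)
Lemma th_partial (q : R) (n : nat) :
  rsum (fun k => theta_coef k * q ^ k) (n * n + 1) = 1 + 2 * rsum (fun j => q ^ (S j * S j)) n.
Proof.
  induction n as [| n IH]; [simpl; ring |].
  replace (S n * S n + 1)%nat with (n * n + 1 + S (2 * n))%nat by lia.
  rewrite rsum_split, IH.
  change (rsum (fun j => q ^ (S j * S j)) (S n)) with (rsum (fun j => q ^ (S j * S j)) n + q ^ (S n * S n)).
  change (rsum (fun k => theta_coef (n * n + 1 + k) * q ^ (n * n + 1 + k)) (S (2 * n)))
    with (rsum (fun k => theta_coef (n * n + 1 + k) * q ^ (n * n + 1 + k)) (2 * n) + theta_coef (n * n + 1 + 2 * n) * q ^ (n * n + 1 + 2 * n)).
  rewrite (rsum_zero (fun k => theta_coef (n * n + 1 + k) * _)).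
  - replace (n * n + 1 + 2 * n)%nat with (S n * S n)%nat by lia.
    replace (theta_coef (S n * S n)) with (2 * square_coef (S n * S n)) by reflexivity.
    rewrite square_coef_sq. ring.
  - intros k Hk. replace (theta_coef (n * n + 1 + k)) with (2 * square_coef (n * n + 1 + k)).
    + rewrite square_coef_gap by lia. ring.
    + destruct (n * n + 1 + k)%nat eqn:E; [lia | reflexivity].
Qed.

(** * Formal series that converge absolutely on (-1, 1), and comparison of coefficients *)

Definition abs_ps (a : nat -> R) (f : R -> R) : Prop :=
  forall x, Rabs x < 1 -> ex_series (fun n => Rabs (a n * x ^ n)) /\ is_series (fun n => a n * x ^ n) (f x).

(** Absolute convergence is carried along in [abs_ps] because the Cauchy product asks for it in both
    factors. *)
Lemma abs_ps_mul (a b : nat -> R) (f g : R -> R) : abs_ps a f -> abs_ps b g ->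
  abs_ps (fmul a b) (fun x => f x * g x).
Proof.
  intros Ha Hb x Hx. destruct (Ha x Hx) as [A1 A2]. destruct (Hb x Hx) as [B1 B2].
  assert (E : forall n, sum_f_R0 (fun k => (a k * x ^ k) * (b (n - k)%nat * x ^ (n - k))) n = fmul a b n * x ^ n).
  { intros n. rewrite <- sum_n_Reals, sum_n_rsum. unfold fmul. rewrite Rmult_comm, <- rsum_scal.
    apply rsum_ext. intros k Hk. replace n with (k + (n - k))%nat at 3 by lia. rewrite pow_add. ring. }
  split.
  - assert (H := is_series_mult _ _ _ _ (Series_correct _ A1) (Series_correct _ B1)).
    assert (A1' : ex_series (fun n => Rabs (Rabs (a n * x ^ n)))).
    { eapply ex_series_ext; [| exact A1]. intros n; cbn beta; now rewrite Rabs_Rabsolu. }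
    assert (B1' : ex_series (fun n => Rabs (Rabs (b n * x ^ n)))).
    { eapply ex_series_ext; [| exact B1]. intros n; cbn beta; now rewrite Rabs_Rabsolu. }
    specialize (H A1' B1'). eapply ex_series_dom; [| exact (ex_intro _ _ H)].
    intros n. rewrite Rabs_Rabsolu, <- E.
    eapply Rle_trans. apply Rsum_abs. apply Req_le. apply sum_eq. intros i _. apply Rabs_mult.
  - eapply is_series_ext; [exact E |]. exact (is_series_mult _ _ _ _ A2 B2 A1 B1).
Qed.

Lemma abs_ps_add (a b : nat -> R) (f g : R -> R) : abs_ps a f -> abs_ps b g ->
  abs_ps (fadd a b) (fun x => f x + g x).
Proof.
  intros Ha Hb x Hx. destruct (Ha x Hx) as [A1 A2]. destruct (Hb x Hx) as [B1 B2]. split.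
  - eapply ex_series_dom; [| exact (ex_series_plus _ _ A1 B1)].
    intros n. unfold fadd. rewrite Rabs_Rabsolu, Rmult_plus_distr_r. apply Rabs_triang.
  - eapply is_series_ext; [| exact (is_series_plus _ _ _ _ A2 B2)].
    intros n. unfold fadd. symmetry. apply Rmult_plus_distr_r.
Qed.

Lemma abs_ps_mono (c : R) (m : nat) : abs_ps (fmono c m) (fun x => c * x ^ m).
Proof.
  intros x _. assert (G : forall a, (forall k, k <> m -> a k = 0) -> is_series a (a m)).
  { intros a Ha. apply is_series_rsum. apply (is_lim_seq_ext_loc (fun _ => a m)); [| apply is_lim_seq_const].
    exists (S m). intros n Hn. replace n with (m + S (n - m - 1))%nat by lia.
    rewrite rsum_split, rsum_first, Nat.add_0_r, !rsum_zero; [ring | |]; intros; apply Ha; lia. }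
  assert (Hz : forall k, k <> m -> fmono c m k * x ^ k = 0).
  { intros k Hk. unfold fmono. destruct (Nat.eqb_spec k m); [contradiction | ring]. }
  split.
  - exists (Rabs (fmono c m m * x ^ m)). apply (G (fun n => Rabs (fmono c m n * x ^ n))).
    intros k Hk. rewrite Hz by assumption. apply Rabs_R0.
  - replace (c * x ^ m) with (fmono c m m * x ^ m) by (unfold fmono; rewrite Nat.eqb_refl; ring).
    apply (G (fun n => fmono c m n * x ^ n) Hz).
Qed.

Lemma abs_ps_bounded (a : nat -> R) (B : R) : (forall k, Rabs (a k) <= B) ->
  abs_ps a (fun x => Series (fun n => a n * x ^ n)).
Proof.
  intros H x Hx. assert (G : ex_series (fun n => Rabs (a n * x ^ n))).
  { apply (ex_series_dom _ (fun n => B * Rabs x ^ n)).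
    - intros n. rewrite Rabs_Rabsolu, Rabs_mult, RPow_abs. apply Rmult_le_compat_r; [apply Rabs_pos | apply H].
    - apply ex_series_geom_scal. split; [apply Rabs_pos | exact Hx]. }
  split; [exact G |]. apply Series_correct. apply ex_series_Rabs, G.
Qed.

Lemma abs_ps_ext (a : nat -> R) (f g : R -> R) : (forall x, f x = g x) -> abs_ps a f -> abs_ps a g.
Proof. intros E H x Hx. rewrite <- E. apply H, Hx. Qed.

(** The bridge from inequalities on the real line to formal identities: once the coefficients below
    k are 0, f x = a k x^k + O(x^(k+1)), so f x = O(x^N) with N > k gives a k = O(x) as x -> 0. *)
Lemma coef_vanish (a : nat -> R) (f : R -> R) (K : R) (N : nat) : abs_ps a f ->
  (forall x, 0 < x <= / 2 -> Rabs (f x) <= K * x ^ N) -> forall k, (k < N)%nat -> a k = 0.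
Proof.
  intros Ha Hf k. induction k as [k IH] using Wf_nat.lt_wf_ind. intros Hk.
  assert (Hhalf : Rabs (/ 2) < 1) by (rewrite Rabs_pos_eq; lra).
  destruct (Ha (/ 2) Hhalf) as [H1 _].
  assert (HB1 : ex_series (fun j => Rabs (a (S k + j)%nat * (/ 2) ^ (S k + j)))) by (apply (ex_series_incr_n _ (S k)) in H1; exact H1).
  (* For 0 < x <= 1/2 the tail past index k is at most (2x)^(k+1) times the absolute tail at 1/2,
     that is B x^(k+1). *)
  set (B := 2 ^ S k * Series (fun j => Rabs (a (S k + j)%nat * (/ 2) ^ (S k + j)))).
  assert (HK : forall x, 0 < x <= / 2 -> Rabs (a k) <= (Rabs K + B) * x).
  { intros x Hx. assert (Hx1 : Rabs x < 1) by (rewrite Rabs_pos_eq; lra).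
    destruct (Ha x Hx1) as [A1 A2]. assert (Ex : ex_series (fun n => a n * x ^ n)) by (exists (f x); exact A2).
    assert (E := Series_split _ (S k) Ex). rewrite (is_series_unique _ _ A2) in E.
    change (rsum (fun n => a n * x ^ n) (S k)) with (rsum (fun n => a n * x ^ n) k + a k * x ^ k) in E.
    rewrite rsum_zero in E. 2:{ intros j Hj. rewrite IH by lia. ring. }
    assert (T : Rabs (Series (fun j => a (S k + j)%nat * x ^ (S k + j))) <= B * (x ^ k * x)).
    { replace (B * (x ^ k * x)) with (Series (fun j => (2 * x) ^ S k * Rabs (a (S k + j)%nat * (/ 2) ^ (S k + j)))).
      - apply Series_le_dom; [| exact (ex_series_scal_l (K := R_AbsRing) ((2 * x) ^ S k) _ HB1)].
        intros j. rewrite !Rabs_mult, (Rabs_pos_eq (x ^ _)), (Rabs_pos_eq ((/ 2) ^ _)) by (apply pow_le; lra).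
        rewrite !(pow_add _ (S k) j), Rpow_mult_distr.
        replace (2 ^ S k * x ^ S k * (Rabs (a (S k + j)%nat) * ((/ 2) ^ S k * (/ 2) ^ j)))
          with (Rabs (a (S k + j)%nat) * (x ^ S k * (/ 2) ^ j) * (2 ^ S k * (/ 2) ^ S k)) by ring.
        rewrite <- (Rpow_mult_distr 2 (/ 2)). replace (2 * / 2) with 1 by field. rewrite pow1, Rmult_1_r.
        apply Rmult_le_compat_l; [apply Rabs_pos |]. apply Rmult_le_compat_l; [apply pow_le; lra |].
        apply pow_incr; lra.
      - rewrite Series_scal_l, Rpow_mult_distr. unfold B. simpl. ring. }
    assert (P : 0 < x ^ k) by (apply pow_lt; lra).
    assert (F := Hf x Hx).
    assert (F2 : K * x ^ N <= Rabs K * (x ^ k * x)).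
    { eapply Rle_trans. apply Rmult_le_compat_r; [apply pow_le; lra | apply Rle_abs].
      apply Rmult_le_compat_l; [apply Rabs_pos |].
      replace N with (S k + (N - S k))%nat by lia. rewrite pow_add.
      assert (P2 : x ^ (N - S k) <= 1) by (rewrite <- (pow1 (N - S k)); apply pow_incr; lra).
      assert (P3 : 0 < x ^ S k) by (apply pow_lt; lra). simpl in *. nra. }
    assert (Eak : a k * x ^ k = f x - Series (fun j => a (S k + j)%nat * x ^ (S k + j))) by lra.
    apply (Rmult_le_reg_r (x ^ k)); [exact P |].
    rewrite <- (Rabs_pos_eq (x ^ k)) at 1 by lra. rewrite <- Rabs_mult, Eak.
    eapply Rle_trans. apply Rabs_triang. rewrite Rabs_Ropp. lra. }
  assert (HB : 0 <= B).
  { apply Rmult_le_pos; [apply pow_le; lra |]. apply Series_nonneg; [intros; apply Rabs_pos | exact HB1]. }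
  apply Rabs_eq_0. apply Rle_antisym; [| apply Rabs_pos]. apply Rnot_lt_le. intros Hlt.
  assert (HKp := Rabs_pos K).
  set (x := Rmin (/ 2) (Rabs (a k) / (2 * (Rabs K + B + 1)))).
  assert (Hx0 : 0 < x) by (apply Rmin_pos; [lra | apply Rdiv_lt_0_compat; lra]).
  assert (Hx1 : x <= / 2) by apply Rmin_l.
  assert (Hx2 : x <= Rabs (a k) / (2 * (Rabs K + B + 1))) by apply Rmin_r.
  specialize (HK x (conj Hx0 Hx1)).
  assert (E : Rabs (a k) = 2 * (Rabs K + B + 1) * (Rabs (a k) / (2 * (Rabs K + B + 1)))) by (field; lra).
  nra.
Qed.

(** * The triple product at z = 1 *)

Fixpoint rprod (a : nat -> R) (n : nat) : R :=
  match n with O => 1 | S n' => rprod a n' * a n' end.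

Lemma rprod_ext (a b : nat -> R) (n : nat) : (forall k, (k < n)%nat -> a k = b k) -> rprod a n = rprod b n.
Proof. induction n as [| n IH]; intros H; simpl; trivial. rewrite IH, (H n) by (intros; auto with arith). ring. Qed.

Lemma rprod_first (a : nat -> R) (n : nat) : rprod a (S n) = a 0%nat * rprod (fun k => a (S k)) n.
Proof. induction n as [| n IH]; [simpl; ring |]. change (rprod a (S (S n))) with (rprod a (S n) * a (S n)). rewrite IH. simpl. ring. Qed.

Definition qpoch (Q : R) (n : nat) : R := rprod (fun i => 1 - Q ^ S i) n.

Fixpoint qbinom (Q : R) (n k : nat) : R :=
  match n, k with
  | _, O => 1
  | O, S _ => 0
  | S n', S k' => qbinom Q n' (S k') + Q ^ (n' - k') * qbinom Q n' k'
  end.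

Lemma qb_0 (Q : R) (n : nat) : qbinom Q n 0 = 1.
Proof. destruct n; reflexivity. Qed.

Lemma qb_out (Q : R) (n : nat) : forall k, (n < k)%nat -> qbinom Q n k = 0.
Proof.
  induction n as [| n IH]; intros [| k] Hk; try lia; simpl; trivial.
  rewrite !IH by lia. ring.
Qed.

(** The finite q-binomial theorem in base q^2, with [qbinom] the Gaussian coefficient given by the
    q-Pascal rule. *)
Lemma q_binomial (q y : R) (m : nat) :
  rprod (fun i => 1 + y * q ^ (2 * i + 1)) m = rsum (fun k => qbinom (q ^ 2) m k * q ^ (k * k) * y ^ k) (S m).
Proof.
  induction m as [| m IH]; [simpl; ring |].
  change (rprod (fun i => 1 + y * q ^ (2 * i + 1)) (S m))
    with (rprod (fun i => 1 + y * q ^ (2 * i + 1)) m * (1 + y * q ^ (2 * m + 1))).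
  rewrite (rsum_first _ (S m)).
  rewrite (rsum_ext (fun k => qbinom (q ^ 2) (S m) (S k) * q ^ (S k * S k) * y ^ S k)
    (fun k => qbinom (q ^ 2) m (S k) * q ^ (S k * S k) * y ^ S k
      + (y * q ^ (2 * m + 1)) * (qbinom (q ^ 2) m k * q ^ (k * k) * y ^ k))).
  - rewrite rsum_plus, rsum_scal, <- IH.
    change (rsum (fun k => qbinom (q ^ 2) m (S k) * q ^ (S k * S k) * y ^ S k) (S m))
      with (rsum (fun k => qbinom (q ^ 2) m (S k) * q ^ (S k * S k) * y ^ S k) m + qbinom (q ^ 2) m (S m) * q ^ (S m * S m) * y ^ S m).
    rewrite (qb_out _ m (S m)) by lia.
    rewrite rsum_first in IH. rewrite IH. rewrite !qb_0. simpl (0 * 0)%nat. rewrite !pow_O. ring.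
  - intros k Hk. cbn [qbinom]. rewrite <- !pow_mult.
    assert (E : q ^ (2 * (m - k)) * q ^ (S k * S k) = q ^ (2 * m + 1) * q ^ (k * k)).
    { rewrite <- !pow_add. f_equal. nia. }
    change (y ^ S k) with (y * y ^ k).
    replace ((qbinom (q ^ 2) m (S k) + q ^ (2 * (m - k)) * qbinom (q ^ 2) m k) * q ^ (S k * S k) * (y * y ^ k))
      with (qbinom (q ^ 2) m (S k) * q ^ (S k * S k) * (y * y ^ k)
        + (q ^ (2 * (m - k)) * q ^ (S k * S k)) * (qbinom (q ^ 2) m k * y * y ^ k)) by ring.
    rewrite E. ring.
Qed.

Lemma qb_closed (Q : R) (n : nat) : forall k, (k <= n)%nat -> qbinom Q n k * qpoch Q k * qpoch Q (n - k) = qpoch Q n.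
Proof.
  induction n as [| n IH]; intros [| k] Hk; try lia.
  - unfold qpoch; simpl; ring.
  - rewrite qb_0, Nat.sub_0_r. unfold qpoch at 1. simpl (rprod _ 0). ring.
  - cbn [qbinom]. replace (S n - S k)%nat with (n - k)%nat by lia.
    change (qpoch Q (S k)) with (qpoch Q k * (1 - Q ^ S k)). change (qpoch Q (S n)) with (qpoch Q n * (1 - Q ^ S n)).
    assert (H1 := IH k ltac:(lia)).
    destruct (Nat.eq_dec k n) as [-> | Hne].
    + rewrite qb_out by lia. rewrite Nat.sub_diag in *. rewrite pow_O.
      transitivity ((qbinom Q n n * qpoch Q n * qpoch Q 0) * (1 - Q ^ S n)); [ring | now rewrite H1].
    + assert (H2 := IH (S k) ltac:(lia)).
      change (qpoch Q (S k)) with (qpoch Q k * (1 - Q ^ S k)) in H2.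
      assert (E : qpoch Q (n - k) = qpoch Q (n - S k) * (1 - Q ^ (n - k))).
      { replace (n - k)%nat with (S (n - S k)) by lia. reflexivity. }
      replace ((qbinom Q n (S k) + Q ^ (n - k) * qbinom Q n k) * (qpoch Q k * (1 - Q ^ S k)) * qpoch Q (n - k))
        with ((qbinom Q n (S k) * (qpoch Q k * (1 - Q ^ S k))) * qpoch Q (n - k)
           + Q ^ (n - k) * (1 - Q ^ S k) * (qbinom Q n k * qpoch Q k * qpoch Q (n - k))) by ring.
      rewrite H1, E, <- Rmult_assoc, H2.
      replace (Q ^ S n) with (Q ^ (n - k) * Q ^ S k) by (rewrite <- pow_add; f_equal; lia). ring.
Qed.

(** With y = q^(-2n) and 2n factors the exponents run symmetrically through the odd numbers from
    -(2n-1) to 2n-1. Since 1 + q^(-j) = q^(-j) (1 + q^j) and the odd j < 2n add up to n^2, the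
    negative half reproduces the positive one after multiplication by q^(n^2). *)
Lemma shifted_product (q : R) (n : nat) : q <> 0 ->
  q ^ (n * n) * rprod (fun i => 1 + / q ^ (2 * n) * q ^ (2 * i + 1)) (2 * n)
  = rprod (fun i => 1 + q ^ (2 * i + 1)) n ^ 2.
Proof.
  intros Hq. induction n as [| n IH]; [simpl; ring |].
  replace (2 * S n)%nat with (S (S (2 * n))) by lia. rewrite rprod_first.
  change (rprod (fun k => 1 + / q ^ S (S (2 * n)) * q ^ (2 * S k + 1)) (S (2 * n)))
    with (rprod (fun k => 1 + / q ^ S (S (2 * n)) * q ^ (2 * S k + 1)) (2 * n)
      * (1 + / q ^ S (S (2 * n)) * q ^ (2 * S (2 * n) + 1))).
  assert (Hp : forall k, q ^ k <> 0) by (intros; apply pow_nonzero, Hq).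
  rewrite (rprod_ext _ (fun i => 1 + / q ^ (2 * n) * q ^ (2 * i + 1))).
  2:{ intros k _. f_equal. replace (2 * S k + 1)%nat with (2 + (2 * k + 1))%nat by lia.
      rewrite pow_add. change (q ^ S (S (2 * n))) with (q * (q * q ^ (2 * n))). simpl (q ^ 2).
      field. split; [apply Hp | exact Hq]. }
  change (rprod (fun i => 1 + q ^ (2 * i + 1)) (S n)) with (rprod (fun i => 1 + q ^ (2 * i + 1)) n * (1 + q ^ (2 * n + 1))).
  rewrite Rpow_mult_distr, <- IH.
  replace (S n * S n)%nat with (n * n + (2 * n + 1))%nat by lia. rewrite pow_add.
  replace (2 * 0 + 1)%nat with 1%nat by lia.
  replace (q ^ S (S (2 * n))) with (q * q ^ (2 * n + 1)) by (rewrite Nat.add_1_r; reflexivity).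
  replace (q ^ (2 * S (2 * n) + 1)) with (q * q ^ (2 * n + 1) * q ^ (2 * n + 1)).
  2:{ change (q * q ^ (2 * n + 1)) with (q ^ S (2 * n + 1)). rewrite <- pow_add. f_equal. lia. }
  field; repeat split; (exact Hq || apply Hp).
Qed.

(** Subtraction of naturals truncates at 0, so at most one of the two products survives and the
    value is (k - n)^2. *)
Definition sqdist (n k : nat) : nat := ((k - n) * (k - n) + (n - k) * (n - k))%nat.

(** The powers q^(n^2), q^(k^2) and q^(-2nk) complete the square. *)
Lemma gauss_finite_triple (q : R) (n : nat) : q <> 0 ->
  rprod (fun i => 1 + q ^ (2 * i + 1)) n ^ 2 = rsum (fun k => qbinom (q ^ 2) (2 * n) k * q ^ sqdist n k) (S (2 * n)).
Proof.
  intros Hq. rewrite <- shifted_product, q_binomial, <- rsum_scal by assumption.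
  apply rsum_ext. intros k _.
  assert (Hp : forall k, q ^ k <> 0) by (intros; apply pow_nonzero, Hq).
  rewrite pow_inv, <- pow_mult.
  assert (E : q ^ (n * n) * q ^ (k * k) = q ^ sqdist n k * q ^ (2 * n * k)).
  { rewrite <- !pow_add. f_equal. unfold sqdist. nia. }
  replace (q ^ (n * n) * (qbinom (q ^ 2) (2 * n) k * q ^ (k * k) * / q ^ (2 * n * k)))
    with (qbinom (q ^ 2) (2 * n) k * (q ^ (n * n) * q ^ (k * k)) * / q ^ (2 * n * k)) by ring.
  rewrite E. field. apply Hp.
Qed.

Lemma qp_pos (Q : R) (n : nat) : 0 <= Q <= / 4 -> 0 < qpoch Q n.
Proof.
  intros HQ. unfold qpoch. induction n as [| n IH]; simpl; [lra |].
  apply Rmult_lt_0_compat; [exact IH |].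
  assert (P : Q ^ n <= 1) by (rewrite <- (pow1 n); apply pow_incr; lra).
  assert (P2 : 0 <= Q ^ n) by (apply pow_le; lra). nra.
Qed.

(** The factor 1 - Q^d in the lower bound is what makes the induction on d close: it leaves room for
    the next factor 1 - Q^(a+d+1). Later uses bound it by 1. *)
Lemma qp_ratio (Q : R) (a d : nat) : 0 <= Q <= / 4 ->
  qpoch Q a * (1 - 2 * Q ^ S a * (1 - Q ^ d)) <= qpoch Q (a + d) <= qpoch Q a.
Proof.
  intros HQ. assert (Ha := qp_pos Q a HQ). induction d as [| d [IH1 IH2]].
  - rewrite Nat.add_0_r. simpl. lra.
  - rewrite Nat.add_succ_r. change (qpoch Q (S (a + d))) with (qpoch Q (a + d) * (1 - Q ^ S (a + d))).
    assert (Hd := qp_pos Q (a + d) HQ).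
    assert (P1 : 0 <= Q ^ S a <= / 4).
    { simpl. assert (P : Q ^ a <= 1) by (rewrite <- (pow1 a); apply pow_incr; lra).
      assert (P2 : 0 <= Q ^ a) by (apply pow_le; lra). nra. }
    assert (P2 : 0 <= Q ^ d <= 1) by (split; [apply pow_le; lra | rewrite <- (pow1 d); apply pow_incr; lra]).
    replace (Q ^ S (a + d)) with (Q ^ S a * Q ^ d) by (rewrite <- pow_add; reflexivity).
    change (Q ^ S d) with (Q * Q ^ d).
    set (u := Q ^ S a) in *. set (v := Q ^ d) in *.
    assert (Huv : 0 <= u * v <= / 4) by nra.
    split; [| nra].
    apply Rle_trans with (qpoch Q a * (1 - 2 * u * (1 - v)) * (1 - u * v)); [| apply Rmult_le_compat_r; lra].
    replace (qpoch Q a * (1 - 2 * u * (1 - v)) * (1 - u * v)) with (qpoch Q a * ((1 - 2 * u * (1 - v)) * (1 - u * v))) by ring.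
    apply Rmult_le_compat_l; [lra |].
    assert (0 <= u * (1 - v)) by (apply Rmult_le_pos; lra).
    assert (0 <= (u * (1 - v)) * (u * v)) by (apply Rmult_le_pos; lra). nra.
Qed.

(** The weight w is the product of (Q)_n / (Q)_a and (Q)_2n / (Q)_b, and each of these quotients
    lies between 1 - 2 Q^(a+1) and 1. *)
Lemma weight_bound_aux (Q w : R) (a b n : nat) : 0 <= Q <= / 4 -> (a <= n)%nat -> (n <= b)%nat -> (b <= 2 * n)%nat ->
  w * qpoch Q a * qpoch Q b = qpoch Q n * qpoch Q (2 * n) -> 1 - 4 * Q ^ S a <= w <= 1.
Proof.
  intros HQ Ha Hb Hb2 E.
  assert (Pa := qp_pos Q a HQ). assert (Pb := qp_pos Q b HQ). assert (Pn := qp_pos Q n HQ). assert (P2 := qp_pos Q (2 * n) HQ).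
  destruct (qp_ratio Q a (n - a) HQ) as [L1 U1]. replace (a + (n - a))%nat with n in * by lia.
  destruct (qp_ratio Q b (2 * n - b) HQ) as [L2 U2]. replace (b + (2 * n - b))%nat with (2 * n)%nat in * by lia.
  assert (Hpw : forall k, 0 <= Q ^ k <= 1) by (intros k; split; [apply pow_le; lra | rewrite <- (pow1 k); apply pow_incr; lra]).
  assert (Hab : Q ^ S b <= Q ^ S a).
  { replace (S b) with (S a + (b - a))%nat by lia. rewrite pow_add.
    assert (T1 := Hpw (S a)). assert (T2 := Hpw (b - a)%nat). nra. }
  assert (Hu : Q ^ S a <= / 4) by (simpl; assert (T := Hpw a); nra).
  assert (T0 := Hpw (S a)). assert (T1 := Hpw (n - a)%nat). assert (T2 := Hpw (2 * n - b)%nat). assert (T3 := Hpw (S b)).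
  set (u := Q ^ S a) in *. set (u' := Q ^ S b) in *.
  assert (M1 : qpoch Q a * (1 - 2 * u) <= qpoch Q n).
  { eapply Rle_trans; [| exact L1]. apply Rmult_le_compat_l; [lra |]. nra. }
  assert (M2 : qpoch Q b * (1 - 2 * u) <= qpoch Q (2 * n)).
  { eapply Rle_trans; [| exact L2]. apply Rmult_le_compat_l; [lra |].
    assert (u' * (1 - Q ^ (2 * n - b)) <= u * 1) by (apply Rmult_le_compat; lra). lra. }
  assert (PP : 0 < qpoch Q a * qpoch Q b) by (apply Rmult_lt_0_compat; assumption).
  split.
  - apply (Rmult_le_reg_r (qpoch Q a * qpoch Q b)); [exact PP |]. rewrite <- (Rmult_assoc w), E.
    assert (M3 : (qpoch Q a * (1 - 2 * u)) * (qpoch Q b * (1 - 2 * u)) <= qpoch Q n * qpoch Q (2 * n)).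
    { apply Rmult_le_compat; trivial; apply Rmult_le_pos; lra. }
    nra.
  - apply (Rmult_le_reg_r (qpoch Q a * qpoch Q b)); [exact PP |]. rewrite <- (Rmult_assoc w), E, Rmult_1_l.
    apply Rmult_le_compat; lra.
Qed.

Lemma weight_bound (Q : R) (n k : nat) : 0 <= Q <= / 4 -> (k <= 2 * n)%nat ->
  Rabs (qpoch Q n * qbinom Q (2 * n) k - 1) <= 4 * Q ^ S (Nat.min k (2 * n - k)).
Proof.
  intros HQ Hk. assert (E := qb_closed Q (2 * n) k Hk).
  assert (H : 1 - 4 * Q ^ S (Nat.min k (2 * n - k)) <= qpoch Q n * qbinom Q (2 * n) k <= 1).
  { destruct (Nat.le_gt_cases k n) as [H | H].
    - rewrite Nat.min_l by lia. apply (weight_bound_aux Q _ k (2 * n - k) n HQ); try lia.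
      rewrite <- E. ring.
    - rewrite Nat.min_r by lia. apply (weight_bound_aux Q _ (2 * n - k) k n HQ); try lia.
      rewrite <- E. ring. }
  assert (P : 0 <= Q ^ S (Nat.min k (2 * n - k))) by (apply pow_le; lra).
  apply Rabs_le. lra.
Qed.

Lemma sqdist_sum (q : R) (n : nat) :
  rsum (fun k => q ^ sqdist n k) (S (2 * n)) = 1 + 2 * rsum (fun j => q ^ (S j * S j)) n.
Proof.
  assert (H := rsum_center (fun k => q ^ sqdist n k) n n (le_n n)).
  rewrite Nat.add_1_r, Nat.sub_diag in H. simpl (0 + _)%nat in H. rewrite H.
  replace (sqdist n n) with 0%nat by (unfold sqdist; lia). rewrite pow_O, <- rsum_scal. f_equal.
  apply rsum_ext. intros r Hr.
  replace (sqdist n (n + S r)) with (S r * S r)%nat by (unfold sqdist; nia).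
  replace (sqdist n (n - S r)) with (S r * S r)%nat by (unfold sqdist; nia). ring.
Qed.

Lemma pow_le_pow (x : R) (m n : nat) : 0 <= x <= 1 -> (m <= n)%nat -> x ^ n <= x ^ m.
Proof.
  intros Hx H. replace n with (m + (n - m))%nat by lia. rewrite pow_add.
  assert (P : 0 <= x ^ m) by (apply pow_le; lra).
  assert (P2 : x ^ (n - m) <= 1) by (rewrite <- (pow1 (n - m)); apply pow_incr; lra). nra.
Qed.

(** With j = |k - n|, the error 4 x^(2(n-j+1)) of the weight is multiplied by x^(j^2), and 2(n - j +
    1) + j^2 = 2n + 1 + (j - 1)^2 is at least 2n + 1. There are 2n + 1 such terms. *)
Lemma triple_product_approx (x : R) (n : nat) : 0 < x <= / 2 ->
  Rabs (qpoch (x ^ 2) n * rprod (fun i => 1 + x ^ (2 * i + 1)) n ^ 2 - (1 + 2 * rsum (fun j => x ^ (S j * S j)) n))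
  <= 4 * (2 * INR n + 1) * x ^ (2 * n + 1).
Proof.
  intros Hx. assert (HQ : 0 <= x ^ 2 <= / 4) by nra.
  rewrite gauss_finite_triple, <- sqdist_sum, <- rsum_scal by lra.
  replace (rsum (fun k => qpoch (x ^ 2) n * (qbinom (x ^ 2) (2 * n) k * x ^ sqdist n k)) (S (2 * n)) - rsum (fun k => x ^ sqdist n k) (S (2 * n)))
    with (rsum (fun k => qpoch (x ^ 2) n * (qbinom (x ^ 2) (2 * n) k * x ^ sqdist n k) + -1 * x ^ sqdist n k) (S (2 * n)))
    by (rewrite rsum_plus, (rsum_scal (-1)); ring).
  eapply Rle_trans; [apply rsum_abs |].
  replace (4 * (2 * INR n + 1) * x ^ (2 * n + 1)) with (rsum (fun _ => 4 * x ^ (2 * n + 1)) (S (2 * n))).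
  - apply rsum_le. intros k Hk.
    replace (qpoch (x ^ 2) n * (qbinom (x ^ 2) (2 * n) k * x ^ sqdist n k) + -1 * x ^ sqdist n k)
      with ((qpoch (x ^ 2) n * qbinom (x ^ 2) (2 * n) k - 1) * x ^ sqdist n k) by ring.
    rewrite Rabs_mult, (Rabs_pos_eq (x ^ _)) by (apply pow_le; lra).
    assert (central_weight := weight_bound (x ^ 2) n k HQ ltac:(lia)).
    eapply Rle_trans. { apply Rmult_le_compat_r; [apply pow_le; lra | exact central_weight]. }
    rewrite <- pow_mult, Rmult_assoc, <- pow_add. apply Rmult_le_compat_l; [lra |].
    apply pow_le_pow; [lra |]. unfold sqdist.
    destruct (Nat.le_gt_cases k n) as [H | H].
    + rewrite Nat.min_l by lia. nia.
    + rewrite Nat.min_r by lia. nia.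
  - assert (G : forall c m, rsum (fun _ => c) m = INR m * c).
    { intros c m. induction m as [| m IH]; [simpl; ring |]. rewrite S_INR. simpl. rewrite IH. ring. }
    rewrite G, S_INR, mult_INR. simpl (INR 2). ring.
Qed.

Lemma abs_ps_fP (n : nat) :
  abs_ps (triple_prod n) (fun x => qpoch (x ^ 2) n * rprod (fun i => 1 + x ^ (2 * i + 1)) n ^ 2).
Proof.
  assert (Hone : forall c m, abs_ps (fadd fone (fmono c m)) (fun x => 1 * x ^ 0 + c * x ^ m)).
  { intros c m. apply abs_ps_add; apply abs_ps_mono. }
  induction n as [| n IH].
  - apply (abs_ps_ext _ (fun x => 1 * x ^ 0)); [| apply abs_ps_mono].
    intros x. unfold qpoch. simpl. ring.
  - cbn [triple_prod]. eapply abs_ps_ext; [| exact (abs_ps_mul _ _ _ _ (abs_ps_mul _ _ _ _ IH (Hone (-1) (2 * n + 2)%nat))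
      (abs_ps_mul _ _ _ _ (Hone 1 (2 * n + 1)%nat) (Hone 1 (2 * n + 1)%nat)))].
    intros x. cbn beta.
    change (qpoch (x ^ 2) (S n)) with (qpoch (x ^ 2) n * (1 - (x ^ 2) ^ S n)).
    change (rprod (fun i => 1 + x ^ (2 * i + 1)) (S n)) with (rprod (fun i => 1 + x ^ (2 * i + 1)) n * (1 + x ^ (2 * n + 1))).
    rewrite <- pow_mult. replace (2 * S n)%nat with (2 * n + 2)%nat by lia. ring.
Qed.

(** The n-th partial product and theta differ by O(x^(n+1)) for small positive x, so [coef_vanish]
    identifies their coefficients up to n. *)
Lemma fP_th (n k : nat) : (k <= n)%nat -> triple_prod n k = theta_coef k.
Proof.
  intros Hk.
  assert (Hth : abs_ps theta_coef (fun x => Series (fun j => theta_coef j * x ^ j))) by (apply (abs_ps_bounded theta_coef 2), th_bound).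
  assert (Hop : abs_ps (fmul (fmono (-1) 0) theta_coef) (fun x => (-1 * x ^ 0) * Series (fun j => theta_coef j * x ^ j))).
  { apply abs_ps_mul; [apply abs_ps_mono | exact Hth]. }
  assert (Hs := abs_ps_add _ _ _ _ (abs_ps_fP n) Hop).
  assert (E : fadd (triple_prod n) (fmul (fmono (-1) 0) theta_coef) k = 0).
  (* The product contributes 4 (2n + 1) x^(2n+1), the tail of theta 4 x^(n^2+1); both exponents are
     at least n + 1, and the constants add up to 8n + 8. *)
  { apply (coef_vanish _ _ (8 * INR n + 8) (S n) Hs); [| lia].
    intros x Hx. rewrite pow_O, !Rmult_1_r.
    assert (Hx1 : Rabs x < 1) by (rewrite Rabs_pos_eq; lra).
    destruct (Hth x Hx1) as [A1 A2].
    rewrite (Series_split _ (n * n + 1)) by (exists (Series (fun j => theta_coef j * x ^ j)); exact A2).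
    rewrite th_partial.
    assert (T : Rabs (Series (fun j => theta_coef (n * n + 1 + j) * x ^ (n * n + 1 + j))) <= 4 * x ^ (n * n + 1)).
    { apply Rle_trans with (Series (fun j => 2 * x ^ (n * n + 1) * x ^ j)).
      - apply Series_le_dom; [| apply ex_series_geom_scal; lra].
        intros j. rewrite Rabs_mult, (Rabs_pos_eq (x ^ _)) by (apply pow_le; lra).
        rewrite Rmult_assoc, <- pow_add. apply Rmult_le_compat_r; [apply pow_le; lra | apply th_bound].
      - rewrite Series_scal_l, Series_geom by exact Hx1.
        assert (P : 0 <= x ^ (n * n + 1)) by (apply pow_le; lra).
        assert (P2 : / (1 - x) <= 2) by (replace 2 with (/ / 2) by field; apply Rinv_le_contravar; lra). nra. }
    assert (A := triple_product_approx x n Hx).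
    assert (P1 : x ^ (2 * n + 1) <= x ^ S n) by (apply pow_le_pow; [lra | lia]).
    assert (P2 : x ^ (n * n + 1) <= x ^ S n) by (apply pow_le_pow; [lra | nia]).
    assert (P3 := pos_INR n).
    replace (qpoch (x ^ 2) n * rprod (fun i => 1 + x ^ (2 * i + 1)) n ^ 2 +
      -1 * (1 + 2 * rsum (fun j => x ^ (S j * S j)) n + Series (fun j => theta_coef (n * n + 1 + j) * x ^ (n * n + 1 + j))))
      with ((qpoch (x ^ 2) n * rprod (fun i => 1 + x ^ (2 * i + 1)) n ^ 2 - (1 + 2 * rsum (fun j => x ^ (S j * S j)) n))
        + - Series (fun j => theta_coef (n * n + 1 + j) * x ^ (n * n + 1 + j))) by ring.
    eapply Rle_trans. apply Rabs_triang. rewrite Rabs_Ropp.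
    assert (P4 : 4 * (2 * INR n + 1) * x ^ (2 * n + 1) <= 4 * (2 * INR n + 1) * x ^ S n) by (apply Rmult_le_compat_l; lra).
    lra. }
  unfold fadd in E. rewrite fmul_const in E. lra.
Qed.

(** The logarithmic derivative of the infinite product, read off on the diagonal: by [fL_stable] the
    n-th coefficient is final from the n-th partial product on. *)
Definition theta_logder : nat -> R := fun n => triple_logder n n.

Lemma fmul_ext (a a' b b' : nat -> R) (n : nat) : (forall k, (k <= n)%nat -> a k = a' k) ->
  (forall k, (k <= n)%nat -> b k = b' k) -> fmul a b n = fmul a' b' n.
Proof. intros H1 H2. apply rsum_ext. intros k Hk. rewrite H1, H2 by lia. reflexivity. Qed.

Lemma fD_th : fD theta_coef = fmul theta_logder theta_coef.
Proof.
  apply functional_extensionality; intros n.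
  replace (fD theta_coef n) with (fD (triple_prod n) n) by (unfold fD; rewrite fP_th by lia; reflexivity).
  rewrite fD_fP. apply fmul_ext; intros k Hk; [apply fL_stable, Hk | apply fP_th, Hk].
Qed.

(** * The coefficients of the powers of theta *)

Notation fconst c := (fmono c 0).

Lemma fk_add (c d : R) : fadd (fconst c) (fconst d) = fconst (c + d).
Proof.
  apply functional_extensionality; intros n. unfold fadd, fmono. destruct (Nat.eqb n 0); ring.
Qed.

Lemma fk_mul (c d : R) : fmul (fconst c) (fconst d) = fconst (c * d).
Proof. apply (fmono_mul c d 0 0). Qed.

Lemma fD_fk (c : R) : fD (fconst c) = fzero.
Proof.
  apply functional_extensionality; intros n. unfold fD, fmono, fzero.
  destruct (Nat.eqb_spec n 0) as [-> |]; simpl; ring.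
Qed.

Fixpoint fpow (a : nat -> R) (j : nat) : nat -> R :=
  match j with O => fone | S j' => fmul a (fpow a j') end.

Lemma fD_fpow (a : nat -> R) (j : nat) :
  fD (fpow a (S j)) = fmul (fconst (INR (S j))) (fmul (fpow a j) (fD a)).
Proof.
  induction j as [| j IH].
  - cbn [fpow]. replace (fmul a fone) with a by ring. change (fconst (INR 1)) with fone. ring.
  - change (fpow a (S (S j))) with (fmul a (fpow a (S j))). rewrite fD_mul, IH.
    rewrite (S_INR (S j)). rewrite <- fk_add. change (fconst 1) with fone.
    change (fpow a (S j)) with (fmul a (fpow a j)). ring.
Qed.

Lemma fpow_low (a : nat -> R) (j : nat) : a 0%nat = 0 -> forall n, (n < j)%nat -> fpow a j n = 0.
Proof.
  intros Ha. induction j as [| j IH]; intros n Hn; [lia |].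
  cbn [fpow]. apply rsum_zero. intros [| k] Hk; [rewrite Ha; ring |].
  rewrite IH by lia. ring.
Qed.

Definition theta_coef_tail : nat -> R := fmul (fconst 2) square_coef.

Lemma th_fH : theta_coef = fadd fone theta_coef_tail.
Proof.
  apply functional_extensionality; intros n. unfold fadd, theta_coef_tail. rewrite fmul_const.
  destruct n as [| n]; unfold fone, fmono; simpl; ring.
Qed.

Lemma fpow_fH (j n : nat) : fpow theta_coef_tail j n = 2 ^ j * PS_pow square_coef j n.
Proof.
  rewrite <- (fmul_const (2 ^ j) (PS_pow square_coef j) n). revert n.
  apply equal_f. induction j as [| j IH].
  - cbn [fpow PS_pow]. replace (fun k : nat => match k with O => 1 | S _ => 0 end) with fone.
    + change (fmono (2 ^ 0) 0) with fone. ring.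
    + apply functional_extensionality; intros [| n]; reflexivity.
  - cbn [fpow PS_pow]. rewrite PS_mult_fmul, IH. unfold theta_coef_tail.
    change (2 ^ S j) with (2 * 2 ^ j). rewrite <- (fk_mul 2 (2 ^ j)). ring.
Qed.

Fixpoint binom_partial (alpha : R) (J : nat) : nat -> R :=
  match J with
  | O => fmul (fconst (gbinom alpha 0)) (fpow theta_coef_tail 0)
  | S J' => fadd (binom_partial alpha J') (fmul (fconst (gbinom alpha (S J'))) (fpow theta_coef_tail (S J')))
  end.

Lemma fT_sum (alpha : R) (J n : nat) :
  binom_partial alpha J n = sum_f_R0 (fun j => gbinom alpha j * 2 ^ j * PS_pow square_coef j n) J.
Proof.
  induction J as [| J IH]; cbn [binom_partial].
  - rewrite fmul_const, fpow_fH. simpl. ring.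
  - unfold fadd. rewrite fmul_const, fpow_fH, IH, tech5. ring.
Qed.

Lemma fT_stable (alpha : R) (J n : nat) : (n <= J)%nat -> binom_partial alpha J n = c_theta alpha n.
Proof.
  intros H. unfold c_theta. rewrite <- fT_sum. replace J with (n + (J - n))%nat by lia.
  induction (J - n)%nat as [| d IH]; [now rewrite Nat.add_0_r |].
  rewrite Nat.add_succ_r. cbn [binom_partial]. unfold fadd. rewrite fmul_const, fpow_low, IH; [ring | | lia].
  unfold theta_coef_tail. rewrite fmul_const. simpl. ring.
Qed.

Lemma gbinom_step (alpha : R) (J : nat) : gbinom alpha (S J) * INR (S J) = gbinom alpha J * (alpha - INR J).
Proof.
  cbn [gbinom]. assert (H : INR (S J) <> 0) by (apply not_0_INR; lia). field. exact H.
Qed.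

(** Write theta = 1 + H. The binomial series truncated at J satisfies theta D T = alpha (D theta) T
    up to a multiple of H^J D theta, since (j + 1) b_(j+1) = (alpha - j) b_j makes all other terms
    telescope. *)
Lemma fT_equation (alpha : R) (J : nat) :
  fadd (fmul theta_coef (fD (binom_partial alpha J))) (fmul (fconst (gbinom alpha J * (alpha - INR J))) (fmul (fpow theta_coef_tail J) (fD theta_coef)))
  = fmul (fconst alpha) (fmul (fD theta_coef) (binom_partial alpha J)).
Proof.
  assert (HD : fD theta_coef_tail = fD theta_coef).
  { rewrite th_fH, fD_add. unfold fone. rewrite fD_fk. ring. }
  induction J as [| J IH].
  - cbn [binom_partial fpow]. change (gbinom alpha 0) with 1. change (fconst 1) with fone.
    replace (1 * (alpha - INR 0)) with alpha by (simpl; ring).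
    replace (fmul fone fone) with fone by ring.
    assert (E1 : fD fone = fzero) by apply fD_fk. rewrite E1. ring.
  - cbn [binom_partial]. rewrite fD_add, fD_mul, fD_fk, fD_fpow, HD.
    set (b' := gbinom alpha (S J)). set (P := fpow theta_coef_tail J). set (T := binom_partial alpha J) in *.
    assert (Eb : gbinom alpha J * (alpha - INR J) = b' * INR (S J)) by (symmetry; apply gbinom_step).
    rewrite Eb in IH. fold P in IH.
    replace (b' * (alpha - INR (S J))) with (b' * alpha + - (b' * INR (S J))) by ring.
    rewrite <- fk_add.
    replace (fconst (- (b' * INR (S J)))) with (fopp (fconst (b' * INR (S J)))).
    2:{ apply functional_extensionality; intros n. unfold fopp, fmono. destruct (Nat.eqb n 0); ring. }
    change (fpow theta_coef_tail (S J)) with (fmul theta_coef_tail P).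
    transitivity (fadd (fadd (fmul theta_coef (fD T)) (fmul (fconst (b' * INR (S J))) (fmul P (fD theta_coef))))
      (fmul (fconst (b' * alpha)) (fmul (fmul theta_coef_tail P) (fD theta_coef)))).
    + rewrite <- !fk_mul. generalize (fD theta_coef). intros X. rewrite th_fH. ring.
    + rewrite IH, <- (fk_mul b' alpha). ring.
Qed.

Lemma c_theta_ode (alpha : R) :
  fmul theta_coef (fD (c_theta alpha)) = fmul (fconst alpha) (fmul (fD theta_coef) (c_theta alpha)).
Proof.
  apply functional_extensionality; intros n.
  assert (E := equal_f (fT_equation alpha n) n). unfold fadd in E. rewrite !fmul_const in E.
  (* H^n starts at X^n and D theta has no constant term, so the error term does not reach degree
     n. *)
  replace (fmul (fpow theta_coef_tail n) (fD theta_coef) n) with 0 in E.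
  - rewrite Rmult_0_r, Rplus_0_r in E. rewrite fmul_const.
    rewrite (fmul_ext theta_coef theta_coef (fD (c_theta alpha)) (fD (binom_partial alpha n))); trivial.
    + rewrite E. f_equal. apply fmul_ext; trivial. intros k Hk. apply fT_stable, Hk.
    + intros k Hk. unfold fD. rewrite fT_stable by exact Hk. reflexivity.
  - symmetry. apply rsum_zero. intros k Hk. destruct (Nat.eq_dec k n) as [-> | Hne].
    + rewrite Nat.sub_diag. unfold fD. simpl. ring.
    + rewrite fpow_low by (try lia; unfold theta_coef_tail; rewrite fmul_const; simpl; ring). ring.
Qed.

Lemma fmul_th_cancel (E : nat -> R) : fmul theta_coef E = fzero -> E = fzero.
Proof.
  intros H. apply functional_extensionality; intros n.
  induction n as [n IH] using Wf_nat.lt_wf_ind.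
  assert (Hn := equal_f H n). unfold fmul in Hn. rewrite rsum_first, rsum_zero in Hn.
  - rewrite Nat.sub_0_r in Hn. simpl in Hn. unfold fzero in *. lra.
  - intros k Hk. rewrite IH by lia. unfold fzero. ring.
Qed.

(** After theta is cancelled, c_alpha(m) is expressed by the earlier coefficients and by L alone;
    the recursion bears absolute values, and only the size of L matters for the growth of
    c_alpha. *)
Lemma c_theta_recursion (alpha : R) :
  fD (c_theta alpha) = fmul (fconst alpha) (fmul theta_logder (c_theta alpha)).
Proof.
  assert (H : fsub (fD (c_theta alpha)) (fmul (fconst alpha) (fmul theta_logder (c_theta alpha))) = fzero).
  { apply fmul_th_cancel.
    replace (fmul theta_coef (fsub (fD (c_theta alpha)) (fmul (fconst alpha) (fmul theta_logder (c_theta alpha)))))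
      with (fsub (fmul theta_coef (fD (c_theta alpha))) (fmul (fconst alpha) (fmul (fmul theta_logder theta_coef) (c_theta alpha)))) by ring.
    rewrite c_theta_ode, fD_th. ring. }
  replace (fD (c_theta alpha)) with (fadd (fsub (fD (c_theta alpha)) (fmul (fconst alpha) (fmul theta_logder (c_theta alpha)))) (fmul (fconst alpha) (fmul theta_logder (c_theta alpha)))) by ring.
  rewrite H. ring.
Qed.

Lemma c_theta_0 (alpha : R) : c_theta alpha 0 = 1.
Proof. unfold c_theta. simpl. ring. Qed.

(** * A Lambert series bound for the logarithmic derivative and the growth of c_alpha *)

Lemma rsum_multiples (h : nat -> R) (d K : nat) : (0 < d)%nat ->
  rsum (fun k => if Nat.eqb (S k mod d) 0 then h (S k) else 0) (K * d) = rsum (fun j => h (S j * d)%nat) K.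
Proof.
  intros Hd. induction K as [| K IH]; [reflexivity |].
  replace (S K * d)%nat with (K * d + d)%nat by lia. rewrite rsum_split, IH.
  change (rsum (fun j => h (S j * d)%nat) (S K)) with (rsum (fun j => h (S j * d)%nat) K + h (S K * d)%nat).
  f_equal. destruct d as [| d]; [lia |].
  change (rsum ?f (S d)) with (rsum f d + f d). cbn beta.
  rewrite rsum_zero.
  - replace (S (K * S d + d)) with (S K * S d)%nat by lia. rewrite Nat.Div0.mod_mul, Nat.eqb_refl. ring.
  - intros i Hi. replace (S (K * S d + i)) with (S i + K * S d)%nat by lia.
    rewrite Nat.Div0.mod_add, Nat.mod_small by lia. destruct (Nat.eqb_spec (S i) 0); [lia | reflexivity].
Qed.

(** Apart from sign, [geom_ratio] is the indicator of the multiples k = j d, for which d / k = 1 /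
    j. Lengthening the range from M to M d admits exactly j = 1, ..., M. *)
Lemma geo_weighted (c r : R) (d M : nat) : Rabs c = 1 -> 0 <= r -> (0 < d)%nat ->
  rsum (fun k => Rabs (geom_ratio c d (S k)) * INR d * r ^ S k / INR (S k)) M
  <= rsum (fun j => r ^ (S j * d) / INR (S j)) M.
Proof.
  intros Hc Hr Hd.
  assert (Hp : forall k, 0 <= r ^ S k * INR d / INR (S k)).
  { intros k. apply Rmult_le_pos; [apply Rmult_le_pos; [apply pow_le, Hr | apply pos_INR] |].
    left; apply Rinv_0_lt_compat, lt_0_INR; lia. }
  assert (Hind : forall k, 0 <= (if Nat.eqb (S k mod d) 0 then r ^ S k * INR d / INR (S k) else 0)).
  { intros k. destruct (Nat.eqb (S k mod d) 0); [apply Hp | lra]. }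
  apply Rle_trans with (rsum (fun k => if Nat.eqb (S k mod d) 0 then r ^ S k * INR d / INR (S k) else 0) (M * d)).
  - replace (M * d)%nat with (M + (M * d - M))%nat by nia. rewrite rsum_split.
    assert (H2 : 0 <= rsum (fun k => if Nat.eqb (S (M + k) mod d) 0 then r ^ S (M + k) * INR d / INR (S (M + k)) else 0) (M * d - M)).
    { apply rsum_nonneg. intros k _. apply Hind. }
    assert (H1 : rsum (fun k => Rabs (geom_ratio c d (S k)) * INR d * r ^ S k / INR (S k)) M
      <= rsum (fun k => if Nat.eqb (S k mod d) 0 then r ^ S k * INR d / INR (S k) else 0) M); [| lra].
    apply rsum_le. intros k _. assert (G := geo_abs c d k Hc). assert (P := Hp k).
    replace (Rabs (geom_ratio c d (S k)) * INR d * r ^ S k / INR (S k))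
      with (Rabs (geom_ratio c d (S k)) * (r ^ S k * INR d / INR (S k))) by (unfold Rdiv; ring).
    destruct (Nat.eqb (S k mod d) 0); nra.
  - rewrite (rsum_multiples (fun k => r ^ k * INR d / INR k)) by exact Hd.
    apply rsum_le. intros j _. apply Req_le. rewrite mult_INR.
    assert (H1 := lt_0_INR (S j) ltac:(lia)). assert (H2 := lt_0_INR d Hd). field. lra.
Qed.

(** The odd exponents come from squared factors and count twice, the even ones once; the common
    weight 2 covers both. *)
Lemma fL_weighted (r : R) (N M : nat) : 0 <= r ->
  rsum (fun k => Rabs (triple_logder N (S k)) * r ^ S k / INR (S k)) M
  <= 2 * rsum (fun i => rsum (fun j => r ^ (S j * S i) / INR (S j)) M) (2 * N).
Proof.
  intros Hr. induction N as [| N IH].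
  - simpl (2 * 0)%nat. rewrite rsum_zero; [simpl; lra |]. intros k _. cbn [triple_logder]. unfold fzero. rewrite Rabs_R0. unfold Rdiv; ring.
  - replace (2 * S N)%nat with (S (S (2 * N))) by lia.
    change (rsum (fun i => rsum (fun j => r ^ (S j * S i) / INR (S j)) M) (S (S (2 * N))))
      with (rsum (fun i => rsum (fun j => r ^ (S j * S i) / INR (S j)) M) (2 * N)
        + rsum (fun j => r ^ (S j * S (2 * N)) / INR (S j)) M + rsum (fun j => r ^ (S j * S (S (2 * N))) / INR (S j)) M).
    assert (G1 := geo_weighted 1 r (S (2 * N)) M (Rabs_R1) Hr ltac:(lia)).
    assert (G2 := geo_weighted (-1) r (S (S (2 * N))) M ltac:(rewrite Rabs_left; lra) Hr ltac:(lia)).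
    assert (G2p : 0 <= rsum (fun k => Rabs (geom_ratio (-1) (S (S (2 * N))) (S k)) * INR (S (S (2 * N))) * r ^ S k / INR (S k)) M).
    { apply rsum_nonneg. intros k _.
      apply Rmult_le_pos; [| left; apply Rinv_0_lt_compat, lt_0_INR; lia].
      apply Rmult_le_pos; [apply Rmult_le_pos; [apply Rabs_pos | apply pos_INR] | apply pow_le, Hr]. }
    assert (B : rsum (fun k => Rabs (triple_logder (S N) (S k)) * r ^ S k / INR (S k)) M
      <= rsum (fun k => Rabs (triple_logder N (S k)) * r ^ S k / INR (S k)) M
        + (2 * rsum (fun k => Rabs (geom_ratio 1 (S (2 * N)) (S k)) * INR (S (2 * N)) * r ^ S k / INR (S k)) M
        + rsum (fun k => Rabs (geom_ratio (-1) (S (S (2 * N))) (S k)) * INR (S (S (2 * N))) * r ^ S k / INR (S k)) M)); [| lra].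
    rewrite <- rsum_scal, <- !rsum_plus. apply rsum_le. intros k _.
    cbn [triple_logder]. unfold fadd. rewrite !fmul_const.
    replace (2 * N + 2)%nat with (S (S (2 * N))) by lia. replace (2 * N + 1)%nat with (S (2 * N)) by lia.
    set (g1 := geom_ratio 1 (S (2 * N)) (S k)). set (g2 := geom_ratio (-1) (S (S (2 * N))) (S k)).
    set (i1 := INR (S (2 * N))). set (i2 := INR (S (S (2 * N)))).
    assert (H1 : 0 <= i1) by apply pos_INR. assert (H2 : 0 <= i2) by apply pos_INR.
    assert (T : Rabs (triple_logder N (S k) + i2 * -1 * g2 + (i1 * 1 * g1 + i1 * 1 * g1)) <= Rabs (triple_logder N (S k)) + (2 * (Rabs g1 * i1) + Rabs g2 * i2)).
    { replace (triple_logder N (S k) + i2 * -1 * g2 + (i1 * 1 * g1 + i1 * 1 * g1)) with (triple_logder N (S k) + (2 * (g1 * i1) + - (g2 * i2))) by ring.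
      eapply Rle_trans; [apply Rabs_triang |]. apply Rplus_le_compat_l.
      eapply Rle_trans; [apply Rabs_triang |].
      rewrite Rabs_Ropp, !Rabs_mult, (Rabs_pos_eq i1), (Rabs_pos_eq i2), (Rabs_pos_eq 2) by lra. lra. }
    assert (P : 0 <= r ^ S k / INR (S k)).
    { apply Rmult_le_pos; [apply pow_le, Hr | left; apply Rinv_0_lt_compat, lt_0_INR; lia]. }
    apply (Rmult_le_compat_r _ _ _ P) in T. unfold Rdiv in *. lra.
Qed.

Lemma geom_rsum_bound (y : R) (j N : nat) : 0 < y ->
  rsum (fun i => exp (- y) ^ (S j * S i)) N <= / (INR (S j) * y).
Proof.
  intros Hy. set (z := INR (S j) * y). assert (Hj := lt_0_INR (S j) ltac:(lia)).
  assert (Hz : 0 < z) by (apply Rmult_lt_0_compat; assumption).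
  rewrite (rsum_ext _ (fun i => exp (- z) * exp (- z) ^ i)).
  2:{ intros i _. rewrite pow_mult, <- exp_INR_pow. replace (INR (S j) * - y) with (- z) by (unfold z; ring). reflexivity. }
  rewrite rsum_scal.
  assert (Hq := exp_neg_lt_1 z Hz). assert (Hq0 := exp_pos (- z)).
  assert (G : rsum (fun i => exp (- z) ^ i) N <= / (1 - exp (- z))).
  { apply (Rmult_le_reg_r (1 - exp (- z))); [lra |]. rewrite Rinv_l by lra.
    assert (E : rsum (fun i => exp (- z) ^ i) N * (1 - exp (- z)) = 1 - exp (- z) ^ N).
    { clear. induction N as [| N IH]; [simpl; ring |]. simpl. rewrite Rmult_plus_distr_r, IH. ring. }
    rewrite E. assert (P := pow_le (exp (- z)) N ltac:(lra)). lra. }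
  apply Rle_trans with (exp (- z) * / (1 - exp (- z))). { apply Rmult_le_compat_l; [left; exact Hq0 | exact G]. }
  assert (E := exp_ineq1_le z). rewrite exp_Ropp in *. assert (Ez := exp_pos z).
  replace (/ exp z * / (1 - / exp z)) with (/ (exp z - 1)) by (field; lra).
  apply Rinv_le_contravar; lra.
Qed.

Lemma rsum_inv_sq (M : nat) : rsum (fun j => / INR (S j) ^ 2) M <= 2.
Proof.
  assert (H : rsum (fun j => / INR (S j) ^ 2) (S M) <= 2 - / INR (S M)).
  { induction M as [| M IH]; [simpl; lra |].
    change (rsum (fun j => / INR (S j) ^ 2) (S (S M))) with (rsum (fun j => / INR (S j) ^ 2) (S M) + / INR (S (S M)) ^ 2).
    assert (Hp := lt_0_INR (S M) ltac:(lia)). rewrite (S_INR (S M)) in *. set (x := INR (S M)) in *.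
    assert (E : / (x + 1) ^ 2 <= / x - / (x + 1)).
    { replace (/ x - / (x + 1)) with (/ (x * (x + 1))) by (field; lra). apply Rinv_le_contravar; nra. }
    lra. }
  change (rsum (fun j => / INR (S j) ^ 2) (S M)) with (rsum (fun j => / INR (S j) ^ 2) M + / INR (S M) ^ 2) in H.
  assert (Hp := lt_0_INR (S M) ltac:(lia)).
  assert (H1 : 0 < / INR (S M)) by (apply Rinv_0_lt_compat, Hp).
  assert (H2 : 0 < / INR (S M) ^ 2) by (apply Rinv_0_lt_compat, pow_lt, Hp). lra.
Qed.

(** The constant 4 is the weight 2 of [fL_weighted] times the bound 2 for the sum of 1 / j^2; the
    geometric sum over i gives 1 / (j y). *)
Lemma fLim_weighted (y : R) (M : nat) : 0 < y ->
  rsum (fun k => Rabs (theta_logder (S k)) * exp (- y) ^ S k / INR (S k)) M <= 4 / y.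
Proof.
  intros Hy. set (r := exp (- y)). assert (Hr : 0 <= r) by (left; apply exp_pos).
  rewrite (rsum_ext _ (fun k => Rabs (triple_logder M (S k)) * r ^ S k / INR (S k))).
  2:{ intros k Hk. unfold theta_logder. rewrite (fL_stable M (S k)) by lia. reflexivity. }
  eapply Rle_trans; [apply fL_weighted, Hr |].
  rewrite rsum_exchange.
  apply Rle_trans with (2 * rsum (fun j => / y * / INR (S j) ^ 2) M).
  - apply Rmult_le_compat_l; [lra |]. apply rsum_le. intros j _.
    rewrite (rsum_ext _ (fun i => / INR (S j) * r ^ (S j * S i))) by (intros; unfold Rdiv; ring).
    rewrite rsum_scal. assert (Hj := lt_0_INR (S j) ltac:(lia)).
    replace (/ y * / INR (S j) ^ 2) with (/ INR (S j) * / (INR (S j) * y)) by (field; lra).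
    apply Rmult_le_compat_l; [left; apply Rinv_0_lt_compat, Hj |]. apply geom_rsum_bound, Hy.
  - rewrite rsum_scal. assert (H := rsum_inv_sq M). assert (Hi : 0 < / y) by (apply Rinv_0_lt_compat, Hy).
    unfold Rdiv. nra.
Qed.

Lemma is_derive_rsum_pow (a : nat -> R) (N : nat) (r : R) :
  is_derive (fun x => rsum (fun m => a m * x ^ m) N) r (rsum (fun m => a m * (INR m * r ^ pred m)) N).
Proof.
  induction N as [| N IH]; simpl; [apply (is_derive_const (V := R_NormedModule)) |].
  apply (is_derive_plus (V := R_NormedModule)); [exact IH |].
  destruct N as [| N].
  - simpl. eapply is_derive_eq; [| apply (is_derive_const (V := R_NormedModule))]. unfold zero; simpl. ring.
  - auto_derive; trivial. change (match N with O => 1 | S _ => INR N + 1 end) with (INR (S N)). simpl pred. ring.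
Qed.

Lemma c_theta_abs_step (alpha : R) (m : nat) : 0 < alpha ->
  INR m * Rabs (c_theta alpha m) <= alpha * fmul (fun k => Rabs (theta_logder k)) (fun k => Rabs (c_theta alpha k)) m.
Proof.
  intros Ha. assert (E := equal_f (c_theta_recursion alpha) m). unfold fD in E. rewrite fmul_const in E.
  replace (INR m * Rabs (c_theta alpha m)) with (Rabs (INR m * c_theta alpha m))
    by (rewrite Rabs_mult, (Rabs_pos_eq (INR m)) by apply pos_INR; ring).
  rewrite E, Rabs_mult, (Rabs_pos_eq alpha) by lra. apply Rmult_le_compat_l; [lra |].
  unfold fmul. eapply Rle_trans; [apply rsum_abs |]. apply rsum_le. intros k _. rewrite Rabs_mult. lra.
Qed.

Lemma rsum_product_le (a b : nat -> R) (r : R) (N : nat) : (forall k, 0 <= a k) -> (forall k, 0 <= b k) -> 0 <= r ->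
  rsum (fun m => fmul a b m * r ^ m) N <= rsum (fun m => a m * r ^ m) N * rsum (fun m => b m * r ^ m) N.
Proof.
  intros Ha Hb Hr. destruct N as [| N]; [simpl; lra |].
  rewrite (rsum_ext _ (fun m => rsum (fun i => a i * b (m - i)%nat * r ^ m) (S m))).
  2:{ intros m _. unfold fmul. rewrite Rmult_comm, <- rsum_scal. apply rsum_ext. intros; ring. }
  rewrite (rsum_triangle (fun i m => a i * b (m - i)%nat * r ^ m)).
  rewrite Rmult_comm, <- rsum_scal. apply rsum_le. intros i Hi.
  rewrite (rsum_ext _ (fun j => (a i * r ^ i) * (b j * r ^ j))).
  2:{ intros j Hj. replace (i + j - i)%nat with j by lia. rewrite pow_add. ring. }
  rewrite rsum_scal, (Rmult_comm (rsum _ _)). apply Rmult_le_compat_l.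
  - apply Rmult_le_pos; [apply Ha | apply pow_le, Hr].
  - replace (S N) with (S (N - i) + i)%nat by lia. rewrite rsum_split.
    assert (H : 0 <= rsum (fun k => b (S (N - i) + k)%nat * r ^ (S (N - i) + k)) i); [| lra].
    apply rsum_nonneg. intros k _.
    apply Rmult_le_pos; [apply Hb | apply pow_le, Hr].
Qed.

(* With B(r) = sum_(m<=M) |c_m| r^m and E(r) = sum_(1<=k<=M) |L_k| r^k / k, the recursion
   D c = alpha L c gives r B' <= alpha (r E') B, so B exp (- alpha E) is nonincreasing. *)
Lemma c_theta_majorant (alpha y : R) (M : nat) : 0 < alpha -> 0 < y ->
  rsum (fun m => Rabs (c_theta alpha m) * exp (- y) ^ m) M <= exp (4 * alpha / y).
Proof.
  intros Ha Hy. destruct M as [| M]; [left; simpl; apply exp_pos |].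
  set (B := fun r => rsum (fun m => Rabs (c_theta alpha m) * r ^ m) (S M)).
  set (E := fun r => rsum (fun m => (Rabs (theta_logder m) / INR m) * r ^ m) (S M)).
  set (B' := fun r => rsum (fun m => Rabs (c_theta alpha m) * (INR m * r ^ pred m)) (S M)).
  set (E' := fun r => rsum (fun m => (Rabs (theta_logder m) / INR m) * (INR m * r ^ pred m)) (S M)).
  assert (HB : forall r, is_derive B r (B' r)) by (intros r; apply is_derive_rsum_pow).
  assert (HE : forall r, is_derive E r (E' r)) by (intros r; apply is_derive_rsum_pow).
  (* The summand m = 0 of E is a quotient by [INR 0]; it is 0 because L has no constant term. *)
  assert (HL0 : theta_logder 0 = 0) by reflexivity.
  assert (HBE : forall r, 0 < r -> B' r <= alpha * E' r * B r).
  { intros r Hr. apply (Rmult_le_reg_l r); [exact Hr |].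
    replace (r * B' r) with (rsum (fun m => INR m * Rabs (c_theta alpha m) * r ^ m) (S M)).
    2:{ unfold B'. rewrite <- rsum_scal. apply rsum_ext. intros [| m] _; simpl; ring. }
    replace (r * (alpha * E' r * B r)) with (alpha * ((r * E' r) * B r)) by ring.
    replace (r * E' r) with (rsum (fun m => Rabs (theta_logder m) * r ^ m) (S M)).
    2:{ unfold E'. rewrite <- rsum_scal. apply rsum_ext. intros [| m] _.
        - rewrite HL0, Rabs_R0. simpl (INR 0). ring.
        - assert (Hm := lt_0_INR (S m) ltac:(lia)). simpl pred. simpl (r ^ S m). field. lra. }
    eapply Rle_trans; [| apply Rmult_le_compat_l; [lra | apply rsum_product_le; [intros; apply Rabs_pos | intros; apply Rabs_pos | lra]]].
    rewrite <- rsum_scal. apply rsum_le. intros m _. rewrite <- Rmult_assoc.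
    apply Rmult_le_compat_r; [apply pow_le; lra |]. apply c_theta_abs_step, Ha. }
  set (G := fun r => B r * exp (- alpha * E r)).
  assert (HG : forall r, is_derive G r (B' r * exp (- alpha * E r) + B r * ((- alpha * E' r) * exp (- alpha * E r)))).
  { intros r. apply (is_derive_mult B (fun x => exp (- alpha * E x)) r (B' r)); [apply HB | | exact Rmult_comm].
    apply (is_derive_comp exp (fun x => - alpha * E x) r (exp (- alpha * E r)) (- alpha * E' r)).
    - apply is_derive_exp.
    - apply (is_derive_scal E r (- alpha)), HE. }
  set (r := exp (- y)). assert (Hr : 0 < r) by apply exp_pos.
  destruct (MVT_cor2 G (fun r => B' r * exp (- alpha * E r) + B r * ((- alpha * E' r) * exp (- alpha * E r))) 0 r Hr)
    as [c [Hc2 [Hc _]]].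
  { intros x _. apply is_derive_Reals, HG. }
  assert (HG0 : G 0 = 1).
  { assert (Hz : forall a : nat -> R, rsum (fun m => a m * 0 ^ m) (S M) = a 0%nat).
    { intros a. rewrite rsum_first, rsum_zero; [simpl; ring |]. intros k _. simpl. ring. }
    unfold G, B, E. rewrite !Hz, c_theta_0, HL0, Rabs_R1, Rabs_R0.
    replace (- alpha * (0 / INR 0)) with 0 by (unfold Rdiv; ring). rewrite exp_0. ring. }
  assert (HGr : G r <= 1).
  { rewrite HG0 in Hc2. assert (P := exp_pos (- alpha * E c)). assert (H := HBE c Hc).
    assert (Q : (B' c - alpha * E' c * B c) * exp (- alpha * E c) <= 0) by nra. nra. }
  assert (HEr : E r <= 4 / y).
  { unfold E. rewrite rsum_first, HL0, Rabs_R0.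
    replace (0 / INR 0 * r ^ 0) with 0 by (unfold Rdiv; ring). rewrite Rplus_0_l.
    eapply Rle_trans; [| apply (fLim_weighted y M Hy)]. apply rsum_le. intros k _. fold r. unfold Rdiv. lra. }
  change (B r <= exp (4 * alpha / y)).
  replace (B r) with (G r * exp (alpha * E r)).
  2:{ unfold G. rewrite Rmult_assoc, <- exp_plus. replace (- alpha * E r + alpha * E r) with 0 by ring. rewrite exp_0. ring. }
  apply Rle_trans with (1 * exp (alpha * E r)). { apply Rmult_le_compat_r; [left; apply exp_pos | exact HGr]. }
  rewrite Rmult_1_l. apply exp_le. replace (4 * alpha / y) with (alpha * (4 / y)) by (unfold Rdiv; ring).
  apply Rmult_le_compat_l; lra.
Qed.

(** * The expansion of theta^alpha in exponentials for every x > 0 *)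

Lemma theta_series_th (x : R) : 0 < x -> is_series (fun k => theta_coef k * exp (- (PI * x)) ^ k) (theta x).
Proof.
  intros Hx. set (q := exp (- (PI * x))).
  assert (Hc : 0 < PI * x) by (apply Rmult_lt_0_compat; [apply PI_RGT_0 | exact Hx]).
  assert (Hq : Rabs q < 1) by (rewrite Rabs_pos_eq; [apply exp_neg_lt_1, Hc | left; apply exp_pos]).
  destruct (abs_ps_bounded theta_coef 2 th_bound q Hq) as [_ H].
  replace (theta x) with (Series (fun k => theta_coef k * q ^ k)); [exact H |].
  apply is_series_rsum in H.
  (* Along the lengths n^2 + 1 the partial sums of the power series are those of theta, so the two
     limits coincide. *)
  assert (Hsub : is_lim_seq (fun n => rsum (fun k => theta_coef k * q ^ k) (n * n + 1)) (Series (fun k => theta_coef k * q ^ k))).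
  { apply (is_lim_seq_subseq (rsum (fun k => theta_coef k * q ^ k)) _ (fun n => (n * n + 1)%nat)); [| exact H].
    apply eventually_subseq. intros n. nia. }
  assert (Hg := Series_correct _ (ex_series_gauss x Hx)). apply is_series_rsum in Hg.
  assert (Hth : is_lim_seq (fun n => 1 + 2 * rsum (gauss x) n) (theta x)).
  { rewrite theta_gauss by exact Hx. apply is_lim_seq_plus'; [apply is_lim_seq_const |].
    apply is_lim_seq_mult'; [apply is_lim_seq_const | exact Hg]. }
  apply (is_lim_seq_ext _ (fun n => 1 + 2 * rsum (gauss x) n)) in Hsub.
  - apply is_lim_seq_unique in Hsub. apply is_lim_seq_unique in Hth. rewrite Hsub in Hth. injection Hth. trivial.
  - intros n. rewrite th_partial. do 2 f_equal. apply rsum_ext. intros j _.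
    rewrite gauss_eq. unfold q. rewrite <- exp_INR_pow, mult_INR. f_equal. ring.
Qed.

Lemma radius_of_bounds (a : nat -> R) :
  (forall y, 0 < y -> exists M, forall n, Rabs (a n) * exp (- y) ^ n <= M) ->
  forall x, Rabs x < 1 -> Rbar_lt (Rabs x) (CV_radius a).
Proof.
  intros H x Hx. set (r := (1 + Rabs x) / 2). assert (Hx0 := Rabs_pos x).
  assert (Hr : 0 < r < 1) by (unfold r; lra).
  apply Rbar_lt_le_trans with r; [simpl; unfold r; lra |].
  apply (proj1 (CV_radius_bounded a)).
  assert (Hl : ln r < 0) by (rewrite <- ln_1; apply ln_increasing; lra).
  destruct (H (- ln r)) as [M HM]; [lra |]. exists M. intros n. specialize (HM n).
  rewrite Ropp_involutive, exp_ln in HM by lra. rewrite Rabs_mult, (Rabs_pos_eq (r ^ n)); [exact HM | apply pow_le; lra].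
Qed.

Lemma th_radius (x : R) : Rabs x < 1 -> Rbar_lt (Rabs x) (CV_radius theta_coef).
Proof.
  apply radius_of_bounds. intros y Hy. exists (2 * 1). intros n.
  apply Rmult_le_compat; [apply Rabs_pos | apply pow_le; left; apply exp_pos | apply th_bound |].
  rewrite <- (pow1 n). apply pow_incr. split; [left; apply exp_pos | left; apply exp_neg_lt_1, Hy].
Qed.

Lemma c_theta_term (alpha y : R) (n : nat) : 0 < alpha -> 0 < y ->
  Rabs (c_theta alpha n) * exp (- y) ^ n <= exp (4 * alpha / y).
Proof.
  intros Ha Hy. eapply Rle_trans; [| apply (c_theta_majorant alpha y (S n) Ha Hy)].
  change (rsum (fun m => Rabs (c_theta alpha m) * exp (- y) ^ m) (S n))
    with (rsum (fun m => Rabs (c_theta alpha m) * exp (- y) ^ m) n + Rabs (c_theta alpha n) * exp (- y) ^ n).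
  assert (H : 0 <= rsum (fun m => Rabs (c_theta alpha m) * exp (- y) ^ m) n); [| lra].
  apply rsum_nonneg. intros k _. apply Rmult_le_pos; [apply Rabs_pos | apply pow_le; left; apply exp_pos].
Qed.

Lemma c_theta_radius (alpha x : R) : 0 < alpha -> Rabs x < 1 -> Rbar_lt (Rabs x) (CV_radius (c_theta alpha)).
Proof.
  intros Ha. apply radius_of_bounds. intros y Hy. exists (exp (4 * alpha / y)). intros n.
  apply c_theta_term; assumption.
Qed.

Lemma fD_PS (a : nat -> R) : fD a = PS_incr_1 (PS_derive a).
Proof.
  apply functional_extensionality; intros [| n]; unfold fD, PS_incr_1, PS_derive; [simpl; apply Rmult_0_l | reflexivity].
Qed.

Lemma PSeries_fD (a : nat -> R) (x : R) : PSeries (fD a) x = x * PSeries (PS_derive a) x.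
Proof. rewrite fD_PS. apply PSeries_incr_1. Qed.

Lemma fD_radius (a : nat -> R) : CV_radius (fD a) = CV_radius a.
Proof. rewrite fD_PS, CV_radius_incr_1, CV_radius_derive. reflexivity. Qed.

Lemma PSeries_fmul (a b : nat -> R) (x : R) : Rbar_lt (Rabs x) (CV_radius a) -> Rbar_lt (Rabs x) (CV_radius b) ->
  PSeries (fmul a b) x = PSeries a x * PSeries b x.
Proof. intros. rewrite <- PS_mult_fmul. apply PSeries_mult; assumption. Qed.

Lemma PSeries_th_pos (q : R) : 0 <= q < 1 -> 0 < PSeries theta_coef q.
Proof.
  intros Hq. destruct (Rle_lt_or_eq_dec 0 q (proj1 Hq)) as [H | <-].
  - assert (HPI := PI_RGT_0). assert (Hl : ln q < 0) by (rewrite <- ln_1; apply ln_increasing; lra).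
    assert (Hx : 0 < - ln q / PI) by (apply Rdiv_lt_0_compat; lra).
    assert (S := theta_series_th _ Hx). replace (- (PI * (- ln q / PI))) with (ln q) in S by (field; lra).
    rewrite exp_ln in S by exact H. apply is_pseries_R, is_pseries_unique in S. rewrite S.
    assert (T := theta_gt_1 _ Hx). lra.
  - rewrite PSeries_0. simpl. lra.
Qed.

(* theta^alpha and the power series of c_theta solve the same first-order linear equation. *)
Lemma PSeries_c_theta (alpha q : R) : 0 < alpha -> 0 < q < 1 ->
  PSeries (c_theta alpha) q = Rpower (PSeries theta_coef q) alpha.
Proof.
  intros Ha Hq.
  set (F := PSeries (c_theta alpha)). set (T := PSeries theta_coef).
  set (F' := PSeries (PS_derive (c_theta alpha))). set (T' := PSeries (PS_derive theta_coef)).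
  assert (HF : forall x, Rabs x < 1 -> is_derive F x (F' x)).
  { intros x Hx. apply is_derive_PSeries, c_theta_radius; assumption. }
  assert (HT : forall x, Rabs x < 1 -> is_derive T x (T' x)).
  { intros x Hx. apply is_derive_PSeries, th_radius; assumption. }
  set (G := fun x => F x * exp (- alpha * ln (T x))).
  assert (HG : forall x, 0 <= x < 1 -> is_derive G x (F' x * exp (- alpha * ln (T x)) + F x * ((- alpha * (T' x * / T x)) * exp (- alpha * ln (T x))))).
  { intros x Hx. assert (Hx1 : Rabs x < 1) by (rewrite Rabs_pos_eq; lra).
    assert (HTp : 0 < T x) by apply PSeries_th_pos, Hx.
    apply (is_derive_mult F (fun x => exp (- alpha * ln (T x))) x (F' x)); [apply HF, Hx1 | | exact Rmult_comm].
    apply (is_derive_comp exp (fun x => - alpha * ln (T x)) x (exp (- alpha * ln (T x))) (- alpha * (T' x * / T x))).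
    - apply is_derive_exp.
    - apply (is_derive_scal (fun x => ln (T x)) x (- alpha)).
      apply (is_derive_comp ln T x (/ T x) (T' x)); [apply is_derive_ln, HTp | apply HT, Hx1]. }
  assert (Hode : forall x, 0 < x < 1 -> T x * F' x = alpha * T' x * F x).
  { intros x Hx. assert (Hx1 : Rabs x < 1) by (rewrite Rabs_pos_eq; lra).
    assert (R1 := th_radius x Hx1). assert (R2 := c_theta_radius alpha x Ha Hx1).
    assert (E := f_equal (fun a => PSeries a x) (c_theta_ode alpha)). cbn beta in E.
    rewrite PSeries_fmul in E by (rewrite ?fD_radius; assumption).
    replace (fmul (fconst alpha) (fmul (fD theta_coef) (c_theta alpha))) with (PS_scal alpha (fmul (fD theta_coef) (c_theta alpha))) in E.
    2:{ apply functional_extensionality; intros n. rewrite fmul_const. reflexivity. }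
    rewrite PSeries_scal, PSeries_fmul, !PSeries_fD in E by (rewrite ?fD_radius; assumption).
    fold F F' T T' in E. apply (Rmult_eq_reg_l x); [| lra]. lra. }
  destruct (MVT_cor2 G (fun x => F' x * exp (- alpha * ln (T x)) + F x * ((- alpha * (T' x * / T x)) * exp (- alpha * ln (T x)))) 0 q)
    as [c [Hc2 Hc1]]; [lra | intros x Hx; apply is_derive_Reals, HG; lra |].
  assert (HG0 : G 0 = 1).
  { unfold G, F, T. rewrite !PSeries_0, c_theta_0. simpl (theta_coef 0). rewrite ln_1, Rmult_0_r, exp_0. ring. }
  assert (Hz : F' c * exp (- alpha * ln (T c)) + F c * ((- alpha * (T' c * / T c)) * exp (- alpha * ln (T c))) = 0).
  { assert (Hc : T c * F' c = alpha * T' c * F c) by (apply Hode; lra).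
    assert (HTp : 0 < T c) by (apply PSeries_th_pos; lra).
    replace (F' c) with (alpha * T' c * F c / T c) by (rewrite <- Hc; field; lra). field. lra. }
  rewrite Hz, HG0 in Hc2. unfold G in Hc2.
  assert (EG : F q * exp (- alpha * ln (T q)) = 1) by lra.
  unfold Rpower. fold T.
  replace (F q) with (F q * exp (- alpha * ln (T q)) * exp (alpha * ln (T q))).
  - rewrite EG. ring.
  - rewrite Rmult_assoc, <- exp_plus. replace (- alpha * ln (T q) + alpha * ln (T q)) with 0 by ring. rewrite exp_0. ring.
Qed.

(** With q = r^2, the tail past M is at most r^M times the sum of |c_m| r^m. Half of the decay of q
    thus gives the rate, and the other half is spent on the majorant at y = PI x / 2, which yields
    exp (8 alpha / (PI x)). *)
Lemma theta_pow_expansion (alpha x : R) (M : nat) : 0 < alpha -> 0 < x ->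
  Rabs (Rpower (theta x) alpha - rsum (fun m => c_theta alpha m * exp (- (PI * x)) ^ m) M)
  <= exp (- (PI * x / 2)) ^ M * exp (8 * alpha / (PI * x)).
Proof.
  intros Ha Hx. assert (Hc : 0 < PI * x) by (apply Rmult_lt_0_compat; [apply PI_RGT_0 | exact Hx]).
  set (q := exp (- (PI * x))). assert (Hq0 : 0 < q) by apply exp_pos. assert (Hq1 : q < 1) by (apply exp_neg_lt_1, Hc).
  set (r := exp (- (PI * x / 2))). assert (Hr0 : 0 < r) by apply exp_pos.
  assert (Eq : q = r * r) by (unfold q, r; rewrite <- exp_plus; f_equal; field).
  assert (Hq : Rabs q < 1) by (rewrite Rabs_pos_eq; lra).
  assert (S1 := theta_series_th x Hx). fold q in S1. apply is_pseries_R, is_pseries_unique in S1.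
  rewrite <- S1, <- PSeries_c_theta by (trivial; lra).
  assert (Hex : ex_series (fun m => c_theta alpha m * q ^ m)).
  { assert (H := CV_radius_inside _ _ (c_theta_radius alpha q Ha Hq)). apply ex_pseries_R in H. exact H. }
  assert (EP : PSeries (c_theta alpha) q = Series (fun m => c_theta alpha m * q ^ m)).
  { apply is_pseries_unique, is_pseries_R, Series_correct, Hex. }
  rewrite EP, (Series_split _ M Hex).
  replace (rsum (fun m => c_theta alpha m * q ^ m) M + Series (fun k => c_theta alpha (M + k) * q ^ (M + k)) - rsum (fun m => c_theta alpha m * q ^ m) M)
    with (Series (fun k => c_theta alpha (M + k) * q ^ (M + k))) by ring.
  assert (Hlim := is_series_rsum (fun k => c_theta alpha (M + k) * q ^ (M + k)) (Series (fun k => c_theta alpha (M + k) * q ^ (M + k)))).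
  destruct Hlim as [Hlim _].
  assert (HexM : ex_series (fun k => c_theta alpha (M + k)%nat * q ^ (M + k))) by (apply (ex_series_incr_n _ M) in Hex; exact Hex).
  specialize (Hlim (Series_correct _ HexM)). apply is_lim_seq_abs in Hlim. simpl in Hlim.
  refine (is_lim_seq_le _ _ _ _ _ Hlim (is_lim_seq_const _)).
  intros n. eapply Rle_trans; [apply rsum_abs |].
  assert (HM := c_theta_majorant alpha (PI * x / 2) (M + n) Ha ltac:(lra)). fold r in HM.
  replace (4 * alpha / (PI * x / 2)) with (8 * alpha / (PI * x)) in HM by (field; split; [| apply PI_neq0]; lra).
  rewrite rsum_split in HM.
  assert (H0 : 0 <= rsum (fun m => Rabs (c_theta alpha m) * r ^ m) M).
  { apply rsum_nonneg. intros k _. apply Rmult_le_pos; [apply Rabs_pos | apply pow_le; lra]. }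
  apply Rle_trans with (rsum (fun k => r ^ M * (Rabs (c_theta alpha (M + k)) * r ^ (M + k))) n).
  - apply rsum_le. intros k _. rewrite Rabs_mult, (Rabs_pos_eq (q ^ _)) by (apply pow_le; lra).
    rewrite Eq, Rpow_mult_distr.
    replace (r ^ M * (Rabs (c_theta alpha (M + k)) * r ^ (M + k))) with (Rabs (c_theta alpha (M + k)) * (r ^ M * r ^ (M + k))) by ring.
    apply Rmult_le_compat_l; [apply Rabs_pos |]. apply Rmult_le_compat_r; [apply pow_le; lra |].
    apply pow_le_pow; [| lia]. split; [lra |]. left. apply exp_neg_lt_1. lra.
  - rewrite rsum_scal. apply Rmult_le_compat_l; [apply pow_le; lra | lra].
Qed.

(** * Continuation of Z_alpha *)

Definition theta_pow (alpha u : R) : R := Rpower (theta (exp (2 * u))) alpha.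

Lemma thp_flip (alpha u : R) : theta_pow alpha (- u) = exp (alpha * u) * theta_pow alpha u.
Proof.
  unfold theta_pow. replace (exp (2 * - u)) with (/ exp (2 * u)) by (rewrite <- exp_Ropp; f_equal; ring).
  assert (H := exp_pos (2 * u)). rewrite theta_functional by exact H.
  assert (T := theta_gt_1 _ H).
  replace (exp (2 * u)) with (exp u ^ 2) at 1 by (simpl; rewrite Rmult_1_r, <- exp_plus; f_equal; ring).
  rewrite sqrt_pow2 by (left; apply exp_pos). rewrite <- Rpower_mult_distr by (try apply exp_pos; lra).
  f_equal. unfold Rpower. rewrite ln_exp. reflexivity.
Qed.

Lemma thp_ge_1 (alpha u : R) : 0 < alpha -> 1 <= theta_pow alpha u.
Proof.
  intros Ha. unfold theta_pow. assert (T := theta_gt_1 _ (exp_pos (2 * u))).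
  rewrite <- (Rpower_O (theta (exp (2 * u)))) by lra. apply Rle_Rpower; lra.
Qed.

Lemma thp_upper (alpha u : R) : 0 < alpha <= 1 -> 0 <= u -> theta_pow alpha u - 1 <= 4 * exp (- PI * exp (2 * u)).
Proof.
  intros Ha Hu. assert (T := theta_gt_1 _ (exp_pos (2 * u))).
  assert (H1 : theta_pow alpha u <= theta (exp (2 * u))).
  { unfold theta_pow. rewrite <- (Rpower_1 (theta (exp (2 * u)))) at 2 by lra. apply Rle_Rpower; lra. }
  assert (B := theta_bound _ (exp_pos (2 * u))).
  assert (He : 1 <= exp (2 * u)) by (rewrite <- exp_0; apply exp_le; lra).
  assert (HPI := PI2_3_2).
  assert (Hq : exp (- PI * exp (2 * u)) <= / 2).
  { replace (- PI * exp (2 * u)) with (- (PI * exp (2 * u))) by ring. rewrite exp_Ropp. apply Rinv_le_contravar; [lra |].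
    assert (E := exp_ineq1_le (PI * exp (2 * u))). nra. }
  assert (Hq0 := exp_pos (- PI * exp (2 * u))).
  set (q := exp (- PI * exp (2 * u))) in *.
  assert (B2 : 2 * q / (1 - q) <= 4 * q).
  { apply (Rmult_le_reg_r (1 - q)); [lra |]. unfold Rdiv. rewrite Rmult_assoc, Rinv_l by lra. nra. }
  lra.
Qed.

Lemma thp_growth (alpha u : R) : 0 < alpha <= 1 -> theta_pow alpha u <= 5 * exp (alpha * Rabs u).
Proof.
  intros Ha.
  assert (H0 : forall v, 0 <= v -> theta_pow alpha v <= 5).
  { intros v Hv. assert (H := thp_upper alpha v Ha Hv).
    assert (E : exp (- PI * exp (2 * v)) <= 1).
    { rewrite <- exp_0. apply exp_le. assert (P := PI_RGT_0). assert (Q := exp_pos (2 * v)). nra. }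
    lra. }
  destruct (Rle_dec 0 u) as [Hu | Hu].
  - rewrite Rabs_pos_eq by exact Hu. assert (E : 1 <= exp (alpha * u)) by (rewrite <- exp_0; apply exp_le; nra).
    specialize (H0 u Hu). lra.
  - assert (Hv : 0 <= - u) by lra. rewrite Rabs_left by lra.
    replace u with (- - u) at 1 by ring. rewrite thp_flip, Rmult_comm.
    apply Rmult_le_compat_r; [left; apply exp_pos | apply H0, Hv].
Qed.

(** As a power series in e^(-pi x), theta is differentiable for x > 0, and it is positive, so its
    real powers are continuous. *)
Lemma contR_thp (alpha : R) : contR (theta_pow alpha).
Proof.
  set (T := fun u => PSeries theta_coef (exp (- (PI * exp (2 * u))))).
  assert (Hrad : forall u, Rabs (exp (- (PI * exp (2 * u)))) < 1).
  { intros u. rewrite Rabs_pos_eq by (left; apply exp_pos). apply exp_neg_lt_1.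
    apply Rmult_lt_0_compat; [apply PI_RGT_0 | apply exp_pos]. }
  assert (ET : forall u, theta (exp (2 * u)) = T u).
  { intros u. symmetry. apply is_pseries_unique, is_pseries_R, theta_series_th, exp_pos. }
  intros u. apply (continuous_ext (fun u => exp (alpha * ln (T u)))).
  { intros x. unfold theta_pow, Rpower. rewrite ET. reflexivity. }
  assert (HTp : 0 < T u) by (rewrite <- ET; assert (H := theta_gt_1 _ (exp_pos (2 * u))); lra).
  apply (ex_derive_continuous (V := R_NormedModule) (fun u => exp (alpha * ln (T u)))).
  assert (HdT : ex_derive T u).
  { apply (ex_derive_comp (PSeries theta_coef) (fun u => exp (- (PI * exp (2 * u)))) u).
    - apply ex_derive_PSeries, th_radius, Hrad.
    - auto_derive; trivial. }
  apply (ex_derive_comp (fun y => exp (alpha * ln y)) T u); [| exact HdT].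
  auto_derive. exact HTp.
Qed.

Lemma exp_quad_le (v : R) : 0 <= v -> 2 * v ^ 2 <= exp (2 * v).
Proof.
  intros Hv. assert (H := exp_ge_taylor (2 * v) 2 ltac:(lra)). simpl in H. simpl. nra.
Qed.

(** By e^(2v) >= 2 v^2 the exponent is at most (c + sigma) v - 2 d v^2, and completing the square
    bounds it by (c + sigma)^2 / (8d). *)
Lemma rapid_intro (phi : R -> R) (K c d : R) : contR phi -> 0 < d ->
  (forall u, Rabs (phi u) <= K * (exp (c * Rabs u) * exp (- d * exp (2 * Rabs u)))) -> rapid phi.
Proof.
  intros Hc Hd H. split; [exact Hc |]. intros sigma.
  assert (HK : 0 <= K).
  { specialize (H 0). assert (P := Rabs_pos (phi 0)).
    assert (Q : 0 < exp (c * Rabs 0) * exp (- d * exp (2 * Rabs 0))) by (apply Rmult_lt_0_compat; apply exp_pos). nra. }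
  exists (K * exp ((c + sigma) ^ 2 / (8 * d))). intros u.
  eapply Rle_trans. { apply Rmult_le_compat_r; [left; apply exp_pos | apply H]. }
  rewrite Rmult_assoc. apply Rmult_le_compat_l; [exact HK |].
  rewrite <- !exp_plus. apply exp_le. assert (P := Rabs_pos u). assert (E := exp_quad_le (Rabs u) P).
  set (v := Rabs u) in *.
  assert (E2 : d * (2 * v ^ 2) <= d * exp (2 * v)) by (apply Rmult_le_compat_l; lra).
  assert (E3 : (c + sigma) * v - 2 * d * v ^ 2 <= (c + sigma) ^ 2 / (8 * d)).
  { assert (Q : 0 <= (4 * d * v - (c + sigma)) ^ 2 / (8 * d)).
    { apply Rmult_le_pos; [apply pow2_ge_0 | left; apply Rinv_0_lt_compat; lra]. }
    replace ((4 * d * v - (c + sigma)) ^ 2 / (8 * d)) with (2 * d * v ^ 2 - (c + sigma) * v + (c + sigma) ^ 2 / (8 * d)) in Q by (field; lra).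
    lra. }
  lra.
Qed.

(* The non-decaying part of theta(t^2)^alpha - 1, t = exp u: it is t^(-alpha) - 1 for t < 1 and 0 for t >= 1. *)
Definition cutoff (alpha u : R) : R := Rmax (exp (- alpha * u) - 1) 0.

Definition theta_rem (alpha u : R) : R := theta_pow alpha u - 1 - cutoff alpha u.

Lemma wcut_nonneg (alpha u : R) : 0 < alpha -> 0 <= u -> cutoff alpha u = 0.
Proof.
  intros Ha Hu. unfold cutoff. apply Rmax_right.
  assert (E : exp (- alpha * u) <= 1) by (rewrite <- exp_0; apply exp_le; nra). lra.
Qed.

Lemma wcut_nonpos (alpha u : R) : 0 < alpha -> u <= 0 -> cutoff alpha u = exp (- alpha * u) - 1.
Proof.
  intros Ha Hu. unfold cutoff. apply Rmax_left.
  assert (E : 1 <= exp (- alpha * u)) by (rewrite <- exp_0; apply exp_le; nra). lra.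
Qed.

Lemma contR_abs : contR Rabs.
Proof. apply contR_of_continuity, Rcontinuity_abs. Qed.

Lemma contR_exp_lin (a : R) : contR (fun u => exp (a * u)).
Proof. apply (contR_comp (fun u => a * u) exp); [apply contR_mult; [apply contR_const | apply contR_id] | apply contR_exp]. Qed.

Lemma contR_wcut (alpha : R) : contR (cutoff alpha).
Proof.
  intros u. apply (continuous_ext (fun u => (exp (- alpha * u) - 1 + Rabs (exp (- alpha * u) - 1)) * / 2)).
  - intros x. unfold cutoff, Rmax. destruct (Rle_dec _ 0).
    + rewrite Rabs_left1 by lra. lra.
    + rewrite Rabs_pos_eq by lra. lra.
  - assert (H : contR (fun u => exp (- alpha * u) - 1)) by (apply contR_minus; [apply contR_exp_lin | apply contR_const]).
    apply (contR_mult (fun u => exp (- alpha * u) - 1 + Rabs (exp (- alpha * u) - 1)) (fun _ => / 2)); [| apply contR_const].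
    apply contR_plus; [exact H |]. apply (contR_comp (fun u => exp (- alpha * u) - 1) Rabs); [exact H | apply contR_abs].
Qed.

(** The cutoff is made so that the remainder inherits the functional equation of theta^alpha; decay
    for u < 0 then follows from decay for u >= 0. *)
Lemma Rem_flip (alpha u : R) : 0 < alpha -> theta_rem alpha (- u) = exp (alpha * u) * theta_rem alpha u.
Proof.
  intros Ha. unfold theta_rem. rewrite thp_flip.
  assert (E : exp (alpha * u) * exp (- alpha * u) = 1).
  { rewrite <- exp_plus. replace (alpha * u + - alpha * u) with 0 by ring. apply exp_0. }
  destruct (Rle_dec 0 u) as [Hu | Hu].
  - rewrite (wcut_nonneg alpha u), (wcut_nonpos alpha (- u)) by lra.
    replace (- alpha * - u) with (alpha * u) by ring. ring.
  - rewrite (wcut_nonpos alpha u), (wcut_nonneg alpha (- u)) by lra. lra.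
Qed.

Lemma rapid_Rem (alpha : R) : 0 < alpha <= 1 -> rapid (theta_rem alpha).
Proof.
  intros Ha. apply (rapid_intro _ 4 alpha PI).
  - apply contR_minus; [apply contR_minus; [apply contR_thp | apply contR_const] | apply contR_wcut].
  - apply PI_RGT_0.
  - assert (H0 : forall u, 0 <= u -> Rabs (theta_rem alpha u) <= 4 * exp (- PI * exp (2 * u))).
    { intros u Hu. unfold theta_rem. rewrite wcut_nonneg by lra. rewrite Rminus_0_r.
      assert (H1 := thp_ge_1 alpha u ltac:(lra)). rewrite Rabs_pos_eq by lra. apply thp_upper; lra. }
    intros u. destruct (Rle_dec 0 u) as [Hu | Hu].
    + rewrite (Rabs_pos_eq u) by exact Hu. eapply Rle_trans; [apply H0, Hu |].
      assert (E : 1 <= exp (alpha * u)) by (rewrite <- exp_0; apply exp_le; nra).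
      assert (P := exp_pos (- PI * exp (2 * u))). nra.
    + rewrite (Rabs_left u) by lra. replace u with (- - u) at 1 by ring.
      rewrite Rem_flip by lra. rewrite Rabs_mult, (Rabs_pos_eq (exp _)) by (left; apply exp_pos).
      assert (H1 := H0 (- u) ltac:(lra)). assert (P := exp_pos (alpha * - u)). nra.
Qed.

Lemma RI_Cexp (z : C) (a b : R) : (z * CRInt (fun u => Cexp (z * RtoC u)) a b)%C = (Cexp (z * RtoC b) - Cexp (z * RtoC a))%C.
Proof.
  rewrite <- RI_Cmult by apply contC_Cexp. apply RI_unique.
  assert (Hc : contC (fun u => z * Cexp (z * RtoC u))%C) by (apply contC_mult; [apply contC_const | apply contC_Cexp]).
  apply (is_RInt_fct_extend_pair (U := R_NormedModule) (V := R_NormedModule)).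
  - apply (is_RInt_derive (V := R_CompleteNormedModule) (fun u => Re (Cexp (z * RtoC u))) (fun u => Re (z * Cexp (z * RtoC u)))).
    + intros x _. apply (isD_Cexp z x).
    + intros x _. apply (contC_Re _ Hc x).
  - apply (is_RInt_derive (V := R_CompleteNormedModule) (fun u => Im (Cexp (z * RtoC u))) (fun u => Im (z * Cexp (z * RtoC u)))).
    + intros x _. apply (isD_Cexp z x).
    + intros x _. apply (contC_Im _ Hc x).
Qed.

Lemma exp_left_tail (c K eps : R) : 0 < c -> 0 <= K -> 0 < eps ->
  exists M, 0 <= M /\ forall a, a < - M -> K * exp (c * a) < eps.
Proof.
  intros Hc HK He. exists (K / (c * eps)).
  assert (Hce : 0 < c * eps) by (apply Rmult_lt_0_compat; assumption).
  split; [apply Rmult_le_pos; [exact HK | left; apply Rinv_0_lt_compat, Hce] |].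
  intros a Ha. assert (E := exp_ineq1_le (- (c * a))).
  assert (Hka : K < - a * (c * eps)).
  { apply (Rmult_lt_reg_r (/ (c * eps))); [apply Rinv_0_lt_compat, Hce |]. rewrite Rmult_assoc, Rinv_r by lra. unfold Rdiv in Ha. lra. }
  rewrite exp_Ropp in E. assert (P := exp_pos (c * a)).
  assert (E2 : (1 + - (c * a)) * exp (c * a) <= 1).
  { apply (Rmult_le_compat_r (exp (c * a))) in E; [| lra]. rewrite Rinv_l in E by lra. exact E. }
  nra.
Qed.

(** The cutoff lives on u < 0, where it is a difference of two exponentials; Re s > alpha > 0 makes
    both primitives vanish at -infinity. *)
Lemma isI_wcut (alpha : R) (s : C) : 0 < alpha -> alpha < Re s ->
  is_line_int (fun u => RtoC (cutoff alpha u) * Cexp (s * RtoC u))%C (/ (s - RtoC alpha) - / s)%C.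
Proof.
  intros Ha Hs. set (z := (s - RtoC alpha)%C).
  assert (Hrz : Re z = Re s - alpha) by (unfold z, Re, Cminus, Cplus, Copp, RtoC; simpl; ring).
  assert (Hz0 : z <> 0) by (intros E; rewrite E in Hrz; simpl in Hrz; lra).
  assert (Hs0 : s <> 0) by (intros E; rewrite E in Hs; simpl in Hs; lra).
  assert (Hc : contC (fun u => RtoC (cutoff alpha u) * Cexp (s * RtoC u))%C).
  { apply contC_mult; [apply contC_RtoC, contR_wcut | apply contC_Cexp]. }
  split; [exact Hc |]. intros eps He.
  assert (Kz : 0 <= / Cmod z) by (left; apply Rinv_0_lt_compat, Cmod_gt_0, Hz0).
  assert (Ks : 0 <= / Cmod s) by (left; apply Rinv_0_lt_compat, Cmod_gt_0, Hs0).
  destruct (exp_left_tail (Re z) (/ Cmod z) (eps / 2)) as [M1 [HM1 H1]]; [lra | exact Kz | lra |].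
  destruct (exp_left_tail (Re s) (/ Cmod s) (eps / 2)) as [M2 [HM2 H2]]; [lra | exact Ks | lra |].
  exists (Rmax M1 M2). intros a b Hab1 Hab2.
  assert (T1 := Rmax_l M1 M2). assert (T2 := Rmax_r M1 M2).
  rewrite <- (RI_Chasles _ a 0 b Hc).
  assert (Eb : CRInt (fun u => RtoC (cutoff alpha u) * Cexp (s * RtoC u))%C 0 b = 0).
  { apply RI_unique. apply (is_RInt_ext (V := C_R_NormedModule) (fun _ => RtoC 0)).
    - intros x Hx. rewrite Rmin_left, Rmax_right in Hx by lra. rewrite wcut_nonneg by lra.
      match goal with |- ?p = ?q => change (@eq C p q) end. ring.
    - assert (H := is_RInt_const (V := C_R_NormedModule) 0 b (RtoC 0)).
      rewrite scal_C_R, Cmult_0_r in H. exact H. }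
  assert (Ea : CRInt (fun u => RtoC (cutoff alpha u) * Cexp (s * RtoC u))%C a 0
     = CRInt (fun u => Cexp (z * RtoC u) + RtoC (-1) * Cexp (s * RtoC u))%C a 0).
  { apply RI_unique. apply (is_RInt_ext (V := C_R_NormedModule) (fun u => Cexp (z * RtoC u) + RtoC (-1) * Cexp (s * RtoC u))%C).
    - intros x Hx. rewrite Rmin_left, Rmax_right in Hx by lra. rewrite wcut_nonpos by lra.
      match goal with |- ?p = ?q => change (@eq C p q) end.
      replace (z * RtoC x)%C with (s * RtoC x + RtoC (- alpha * x))%C.
      + rewrite Cexp_plus, Cexp_RtoC, RtoC_minus. ring.
      + unfold z. rewrite RtoC_mult, RtoC_opp. ring.
    - apply is_RI. apply contC_plus; [apply contC_Cexp | apply contC_mult; [apply contC_const | apply contC_Cexp]]. }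
  rewrite Ea, Eb, RI_plus, RI_Cmult.
  2: apply contC_Cexp. 2: apply contC_Cexp.
  2: apply contC_mult; [apply contC_const | apply contC_Cexp].
  assert (Iz := RI_Cexp z a 0). assert (Is := RI_Cexp s a 0). rewrite !Cmult_0_r, Cexp_0 in Iz, Is.
  set (X := CRInt (fun u => Cexp (z * RtoC u)) a 0) in *. set (Y := CRInt (fun u => Cexp (s * RtoC u)) a 0) in *.
  replace X with ((1 - Cexp (z * RtoC a)) / z)%C by (rewrite <- Iz; field; exact Hz0).
  replace Y with ((1 - Cexp (s * RtoC a)) / s)%C by (rewrite <- Is; field; exact Hs0).
  replace ((1 - Cexp (z * RtoC a)) / z + RtoC (-1) * ((1 - Cexp (s * RtoC a)) / s) + 0 - (/ z - / s))%C
    with (- (/ z * Cexp (z * RtoC a)) + / s * Cexp (s * RtoC a))%C by (field; split; assumption).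
  eapply Rle_lt_trans; [apply Cmod_triangle |].
  assert (Ere : forall y : C, Re (y * RtoC a) = Re y * a) by (intros y; unfold Re, Cmult, RtoC; simpl; ring).
  rewrite Cmod_opp, !Cmod_mult, !Cmod_inv, !Cmod_Cexp, !Ere by assumption.
  specialize (H1 a ltac:(lra)). specialize (H2 a ltac:(lra)). lra.
Qed.

Lemma isI_thp (alpha : R) (s : C) : 0 < alpha <= 1 -> alpha < Re s ->
  is_line_int (fun u => RtoC (theta_pow alpha u - 1) * Cexp (s * RtoC u))%C (mellin (theta_rem alpha) s + (/ (s - RtoC alpha) - / s))%C.
Proof.
  intros Ha Hs. eapply isI_ext; [| apply isI_plus; [apply (Mel_spec _ s (rapid_Rem alpha Ha)) | apply (isI_wcut alpha s); lra]].
  intros u. cbn beta. unfold theta_rem. rewrite !RtoC_minus. ring.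
Qed.

(* The explicit continuation of Z_alpha, with the dummy value 0 at its poles. *)
Definition Z_explicit (alpha : R) (s : C) : C :=
  if excluded_middle_informative (s = RtoC 0 \/ s = RtoC alpha) then RtoC 0
  else (mellin (theta_rem alpha) s + (/ (s - RtoC alpha) - / s))%C.

Lemma EZ_regular (alpha : R) (s : C) : s <> RtoC 0 -> s <> RtoC alpha ->
  Z_explicit alpha s = (mellin (theta_rem alpha) s + (/ (s - RtoC alpha) - / s))%C.
Proof.
  intros H0 Ha. unfold Z_explicit. destruct (excluded_middle_informative _) as [[H | H] | _]; [contradiction .. | reflexivity].
Qed.

Lemma Cmod_sub_sym (z w : C) : Cmod (z - w) = Cmod (w - z).
Proof. rewrite <- Cmod_opp. f_equal. ring. Qed.

Lemma far_neq (z s c : C) : Cmod (z - s) < Cmod (s - c) -> z <> c.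
Proof. intros H E. rewrite E, Cmod_sub_sym in H. lra. Qed.

Lemma Cmod_sub_pos (s c : C) : s <> c -> 0 < Cmod (s - c).
Proof. intros H. apply Cmod_gt_0, Csub_neq_0, H. Qed.

Lemma EZ_pole_0 (alpha : R) : 0 < alpha <= 1 -> pole_at (Z_explicit alpha) (RtoC 0).
Proof.
  intros Ha. assert (Hne : RtoC 0 <> RtoC alpha) by (intros E; apply RtoC_inj in E; lra).
  apply (pole_intro _ (fun z => mellin (theta_rem alpha) z + / (z - RtoC alpha))%C (RtoC 0) (RtoC (-1)) (Cmod (RtoC 0 - RtoC alpha))).
  - apply Cmod_sub_pos, Hne.
  - intros E; apply RtoC_inj in E; lra.
  - apply analytic_plus; [apply Mel_entire, rapid_Rem, Ha | apply analytic_inv, Hne].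
  - intros z Hz Hd. rewrite EZ_regular by (trivial; apply (far_neq z (RtoC 0)), Hd).
    replace (z - RtoC 0)%C with z by ring. unfold Cdiv. ring.
Qed.

Lemma EZ_pole_alpha (alpha : R) : 0 < alpha <= 1 -> pole_at (Z_explicit alpha) (RtoC alpha).
Proof.
  intros Ha. assert (Hne : RtoC alpha <> RtoC 0) by (intros E; apply RtoC_inj in E; lra).
  apply (pole_intro _ (fun z => mellin (theta_rem alpha) z + - / (z - RtoC 0))%C (RtoC alpha) (RtoC 1) (Cmod (RtoC alpha - RtoC 0))).
  - apply Cmod_sub_pos, Hne.
  - intros E; apply RtoC_inj in E; lra.
  - apply analytic_plus; [apply Mel_entire, rapid_Rem, Ha | apply analytic_opp, analytic_inv, Hne].
  - intros z Hz Hd. rewrite EZ_regular by (trivial; apply (far_neq z (RtoC alpha)), Hd).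
    replace (z - RtoC 0)%C with z by ring. unfold Cdiv. ring.
Qed.

Lemma EZ_meromorphic (alpha : R) : 0 < alpha <= 1 -> meromorphic (Z_explicit alpha).
Proof.
  intros Ha s.
  destruct (excluded_middle_informative (s = RtoC 0 \/ s = RtoC alpha)) as [H | H].
  - right. split.
    + destruct H as [-> | ->]; [apply EZ_pole_0, Ha | apply EZ_pole_alpha, Ha].
    + unfold Z_explicit. destruct (excluded_middle_informative _); [reflexivity | contradiction].
  - left. assert (H0 : s <> RtoC 0) by tauto. assert (H1 : s <> RtoC alpha) by tauto.
    apply (analytic_local (fun z => mellin (theta_rem alpha) z + (/ (z - RtoC alpha) + - / (z - RtoC 0)))%C _ s
      (Rmin (Cmod (s - RtoC 0)) (Cmod (s - RtoC alpha)))).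
    + apply Rmin_pos; apply Cmod_sub_pos; assumption.
    + intros z Hz. assert (T1 := Rmin_l (Cmod (s - RtoC 0)) (Cmod (s - RtoC alpha))).
      assert (T2 := Rmin_r (Cmod (s - RtoC 0)) (Cmod (s - RtoC alpha))).
      rewrite EZ_regular by (apply (far_neq z s); lra). replace (z - RtoC 0)%C with z by ring. ring.
    + apply analytic_plus; [apply Mel_entire, rapid_Rem, Ha |].
      apply analytic_plus; [| apply analytic_opp]; apply analytic_inv; assumption.
Qed.

Lemma Re_gt_regular (alpha : R) (s : C) : 0 < alpha -> alpha < Re s -> s <> RtoC 0 /\ s <> RtoC alpha.
Proof. intros Ha Hs. split; intros E; rewrite E in Hs; simpl in Hs; lra. Qed.

Lemma Z_theta_EZ (alpha : R) : 0 < alpha <= 1 -> forall s, Z_theta alpha s = Z_explicit alpha s.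
Proof.
  intros Ha. apply mero_continuation_eq; [apply EZ_meromorphic, Ha |].
  intros s Hs. destruct (Re_gt_regular alpha s ltac:(lra) Hs) as [H0 H1]. rewrite EZ_regular by assumption.
  symmetry. eapply CInt0oo_isI; [apply (isI_thp alpha s Ha Hs) |].
  intros t Ht. cbn beta. unfold theta_pow. rewrite cpow_Cexp.
  replace (exp (2 * ln t)) with (t ^ 2); [reflexivity |].
  replace (2 * ln t) with (ln t + ln t) by ring. rewrite exp_plus, exp_ln by exact Ht. ring.
Qed.

(** * The completed zeta function *)

Lemma exp_abs_dom (e : R) : 0 < e -> exists K, forall u, exp (- e * Rabs u) <= K * / (1 + u ^ 2).
Proof.
  intros He. exists (2 * (1 + / e ^ 2)). intros u.
  assert (Q := exp_quad (e * u)). rewrite Rabs_mult, (Rabs_pos_eq e) in Q by lra.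
  replace (- e * Rabs u) with (- (e * Rabs u)) by ring. rewrite exp_Ropp.
  assert (P := exp_pos (e * Rabs u)). assert (Hi : 0 < / e ^ 2) by (apply Rinv_0_lt_compat, pow_lt, He).
  assert (E : u ^ 2 = / e ^ 2 * (e * u) ^ 2) by (field; lra).
  assert (P2 : 0 <= (e * u) ^ 2) by apply pow2_ge_0. assert (P3 : 0 <= u ^ 2) by apply pow2_ge_0.
  apply (Rmult_le_reg_r (exp (e * Rabs u) * (1 + u ^ 2))); [apply Rmult_lt_0_compat; lra |].
  replace (/ exp (e * Rabs u) * (exp (e * Rabs u) * (1 + u ^ 2))) with (1 + u ^ 2) by (field; lra).
  replace (2 * (1 + / e ^ 2) * / (1 + u ^ 2) * (exp (e * Rabs u) * (1 + u ^ 2))) with ((1 + / e ^ 2) * (2 * exp (e * Rabs u))) by (field; lra).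
  apply Rle_trans with ((1 + / e ^ 2) * (1 + (e * u) ^ 2)); [| apply Rmult_le_compat_l; lra].
  rewrite E. nra.
Qed.

Lemma Gamma_isI (s : C) : 0 < Re s -> is_line_int (fun u => RtoC (exp (- exp u)) * Cexp (s * RtoC u))%C (Gamma_integral s).
Proof.
  intros Hs. set (e := Rmin (Re s) 1).
  assert (He : 0 < e) by (apply Rmin_pos; lra).
  assert (He1 : e <= Re s) by apply Rmin_l. assert (He2 : e <= 1) by apply Rmin_r.
  destruct (exp_abs_dom e He) as [K HK].
  (* For u >= 0, e^u >= 1 + u + u^2 / 2 reduces the exponent to a quadratic polynomial, and (Re s +
     1) u - u^2 / 2 is at most (Re s + 1)^2 / 2. *)
  set (B := exp ((Re s + 1) ^ 2 / 2)).
  assert (HB : 1 <= B) by (apply Rle_trans with (exp 0); [rewrite exp_0; lra | apply exp_le; assert (T := pow2_ge_0 (Re s + 1)); lra]).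
  destruct (isI_exists (fun u => RtoC (exp (- exp u)) * Cexp (s * RtoC u))%C (B * K)) as [l Hl].
  - apply contC_mult; [| apply contC_Cexp]. apply contC_RtoC.
    intros u. apply (ex_derive_continuous (V := R_NormedModule)). auto_derive; trivial.
  - intros u. rewrite Rmult_assoc. apply Rle_trans with (B * exp (- e * Rabs u)); [| apply Rmult_le_compat_l; [lra | apply HK]].
    rewrite Cmod_mult, Cmod_R, Rabs_pos_eq by (left; apply exp_pos). rewrite Cmod_Cexp.
    replace (Re (s * RtoC u)) with (Re s * u) by (unfold Re, Cmult, RtoC; simpl; ring).
    rewrite <- exp_plus. destruct (Rle_dec 0 u) as [Hu | Hu].
    + unfold B. rewrite <- exp_plus. apply exp_le. rewrite Rabs_pos_eq by exact Hu.
      assert (E := exp_ge_taylor u 2 Hu). simpl in E.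
      assert (Q : 0 <= (u - (Re s + 1)) ^ 2) by apply pow2_ge_0. simpl in *. nra.
    + apply Rle_trans with (1 * exp (- e * Rabs u)); [| apply Rmult_le_compat_r; [left; apply exp_pos | exact HB]].
      rewrite Rmult_1_l. apply exp_le. rewrite Rabs_left by lra. assert (P := exp_pos u). nra.
  - replace (Gamma_integral s) with l; [exact Hl |]. symmetry. unfold Gamma_integral.
    eapply CInt0oo_isI; [exact Hl |]. intros t Ht. cbn beta.
    rewrite exp_ln by exact Ht. rewrite cpow_Cexp.
    replace ((s - 1) * RtoC (ln t))%C with (s * RtoC (ln t) + RtoC (- ln t))%C by (rewrite RtoC_opp; ring).
    rewrite Cexp_plus, Cexp_RtoC, (exp_Ropp (ln t)), exp_ln, RtoC_inv by (try exact Ht; lra). unfold Cdiv. ring.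
Qed.

(** The substitution u = 2v + ln (PI (n+1)^2) in Euler's integral for Gamma(s/2); the factor 2 is
    its Jacobian. *)
Lemma gauss_term_isI (s : C) (n : nat) : 0 < Re s ->
  is_line_int (fun v => RtoC (2 * gauss (exp (2 * v)) n) * Cexp (s * RtoC v))%C
      (cpow PI (- s / 2) * Gamma_integral (s / 2) * cpow (INR (S n)) (- s))%C.
Proof.
  intros Hs. assert (Hn := lt_0_INR (S n) ltac:(lia)). assert (HPI := PI_RGT_0).
  assert (Hs2 : 0 < Re (s / 2)).
  { replace (Re (s / 2)) with (Re s / 2); [lra |]. unfold Cdiv. rewrite <- RtoC_inv by lra.
    unfold Re, Cmult, RtoC; simpl. field. }
  set (d := ln (PI * INR (S n) ^ 2)).
  assert (Hd : exp d = PI * INR (S n) ^ 2).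
  { apply exp_ln. apply Rmult_lt_0_compat; [lra | apply pow_lt, Hn]. }
  assert (H := isI_Cmult (Cexp (- (s / 2) * RtoC d)) _ _ (isI_comp_lin _ _ 2 d Rlt_0_2 (Gamma_isI (s / 2) Hs2))).
  cbn beta in H.
  replace (cpow PI (- s / 2) * Gamma_integral (s / 2) * cpow (INR (S n)) (- s))%C
    with (Cexp (- (s / 2) * RtoC d) * Gamma_integral (s / 2))%C.
  - eapply isI_ext; [| exact H]. intros v. cbn beta.
    rewrite exp_plus, Hd.
    replace (s / 2 * RtoC (2 * v + d))%C with (s * RtoC v + s / 2 * RtoC d)%C by (rewrite RtoC_plus, RtoC_mult; field).
    rewrite Cexp_plus.
    replace (Cexp (- (s / 2) * d) * (2 * (RtoC (exp (- (exp (2 * v) * (PI * INR (S n) ^ 2)))) * (Cexp (s * v) * Cexp (s / 2 * d)))))%C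
      with (2 * RtoC (exp (- (exp (2 * v) * (PI * INR (S n) ^ 2)))) * Cexp (s * v) * (Cexp (- (s / 2) * d) * Cexp (s / 2 * d)))%C by ring.
    rewrite <- Cexp_plus. replace (- (s / 2) * d + s / 2 * d)%C with (RtoC 0) by ring. rewrite Cexp_0.
    rewrite RtoC_mult. unfold gauss. replace (- PI * INR (S n) ^ 2 * exp (2 * v)) with (- (exp (2 * v) * (PI * INR (S n) ^ 2))) by ring.
    ring.
  - rewrite !cpow_Cexp.
    replace (- (s / 2) * RtoC d)%C with (- s / 2 * RtoC (ln PI) + - s * RtoC (ln (INR (S n))))%C.
    + rewrite Cexp_plus. ring.
    + unfold d. rewrite ln_mult by (trivial; apply pow_lt, Hn). replace (INR (S n) ^ 2) with (INR (S n) * INR (S n)) by ring. rewrite ln_mult by exact Hn.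
      rewrite !RtoC_plus. field.
Qed.

Lemma CSeries_unique (a : nat -> C) (l : C) :
  is_Cseries a l -> CSeries a = l.
Proof.
  intros H. assert (Hl := is_series_C_elim a l H).
  assert (G : forall p : C -> R, (forall z w, p (z + w)%C = p z + p w) -> (forall z w, Rabs (p z - p w) <= Cmod (z - w)) ->
    Series (fun n => p (a n)) = p l).
  { intros p Hp1 Hp2. apply is_series_unique.
    assert (Hlim : is_lim_seq (sum_n (fun n => p (a n))) (p l)); [| exact Hlim].
    apply is_lim_seq_spec. intros eps. destruct (Hl eps (cond_pos eps)) as [N HN]. exists N. intros n Hn.
    assert (E : sum_n (fun n => p (a n)) n = p (Csum a n)).
    { clear - Hp1. induction n as [| n IH]; [exact (sum_O _) |]. rewrite sum_Sn, IH. cbn [Csum]. rewrite Hp1. reflexivity. }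
    rewrite E. eapply Rle_lt_trans; [apply Hp2 | apply HN, Hn]. }
  unfold CSeries. rewrite (G Re), (G Im).
  - destruct l; reflexivity.
  - reflexivity.
  - intros z w. eapply Rle_trans; [| apply Rmax_Cmod]. eapply Rle_trans; [| apply Rmax_r]. apply Req_le. reflexivity.
  - reflexivity.
  - intros z w. apply (re_le_Cmod (z - w)).
Qed.

(** Since PI (M + k)^2 >= M^2 + PI k^2, the tail is compared with the whole series itself, so that
    the domination of theta - 1 can be reused. *)
Lemma gauss_tail (x : R) (M : nat) : 0 < x ->
  Series (fun k => gauss x (M + k)) <= exp (- (INR M ^ 2 * x)) * Series (gauss x).
Proof.
  intros Hx. rewrite <- Series_scal_l. apply Series_le.
  - intros k. split; [left; apply exp_pos |]. unfold gauss. rewrite <- exp_plus. apply exp_le.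
    replace (INR (S (M + k))) with (INR M + INR (S k)) by (rewrite !S_INR, plus_INR; ring).
    assert (P1 := pos_INR M). assert (P2 := pos_INR (S k)). assert (HPI := PI2_3_2).
    assert (Q : INR M ^ 2 * x + PI * INR (S k) ^ 2 * x <= PI * (INR M + INR (S k)) ^ 2 * x); [| lra].
    assert (Q1 : 0 <= INR M * INR (S k)) by nra. assert (Q2 : 0 <= INR M ^ 2) by apply pow2_ge_0.
    replace (PI * (INR M + INR (S k)) ^ 2 * x) with (PI * (INR M ^ 2 + 2 * (INR M * INR (S k))) * x + PI * INR (S k) ^ 2 * x) by ring.
    apply Rplus_le_compat_r, Rmult_le_compat_r; [lra |]. nra.
  - exact (ex_series_scal_l (K := R_AbsRing) _ _ (ex_series_gauss x Hx)).
Qed.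

(** That is, e^(-y) <= y^(-eta). With y = M^2 x it separates a rate M^(-2 eta) from a factor
    x^(-eta), at the price of a small loss in the exponent of x. *)
Lemma exp_neg_le_power (y eta : R) : 0 < y -> 0 <= eta <= 1 -> exp (- y) <= exp (- (eta * ln y)).
Proof.
  intros Hy He. apply exp_le. assert (L : ln y <= y - 1).
  { assert (E := exp_ineq1_le (ln y)). rewrite exp_ln in E by exact Hy. lra. }
  destruct (Rle_dec 0 (ln y)); nra.
Qed.

Lemma thp_1 (u : R) : theta_pow 1 u = theta (exp (2 * u)).
Proof. unfold theta_pow. apply Rpower_1. assert (T := theta_gt_1 _ (exp_pos (2 * u))). lra. Qed.

Lemma theta_weight_dom (tau : R) : 1 < tau -> exists K, forall v, (theta_pow 1 v - 1) * exp (tau * v) <= K * / (1 + v ^ 2).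
Proof.
  intros Ht. destruct (rapid_dom (theta_rem 1) tau (rapid_Rem 1 ltac:(lra))) as [K1 H1].
  destruct (exp_abs_dom (tau - 1) ltac:(lra)) as [K2 H2].
  exists (K1 + K2). intros v. specialize (H1 v). specialize (H2 v).
  replace (theta_pow 1 v - 1) with (theta_rem 1 v + cutoff 1 v) by (unfold theta_rem; ring). rewrite !Rmult_plus_distr_r.
  apply Rplus_le_compat.
  - eapply Rle_trans; [| exact H1].
    apply Rle_trans with (Rabs (theta_rem 1 v) * exp (tau * v)).
    + apply Rmult_le_compat_r; [left; apply exp_pos | apply Rle_abs].
    + apply Rmult_le_compat_l; [apply Rabs_pos |]. apply exp_le, Rmult_le_compat_l; [lra | apply Rle_abs].
  - eapply Rle_trans; [| exact H2]. destruct (Rle_dec 0 v) as [Hv | Hv].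
    + rewrite wcut_nonneg by lra. rewrite Rmult_0_l. left; apply exp_pos.
    + rewrite wcut_nonpos, Rabs_left by lra.
      apply Rle_trans with (exp (- (1) * v) * exp (tau * v)).
      * apply Rmult_le_compat_r; [left; apply exp_pos | lra].
      * rewrite <- exp_plus. apply exp_le. lra.
Qed.

Lemma Csum_RtoC (a : nat -> R) (z : C) (n : nat) : Csum (fun k => RtoC (a k) * z)%C n = (RtoC (rsum a (S n)) * z)%C.
Proof.
  induction n as [| n IH]; cbn [Csum].
  - simpl. rewrite Rplus_0_l. reflexivity.
  - rewrite IH. change (rsum a (S (S n))) with (rsum a (S n) + a (S n)). rewrite RtoC_plus. ring.
Qed.

Lemma isI_Csum (f : nat -> R -> C) (l : nat -> C) (n : nat) : (forall k, is_line_int (f k) (l k)) ->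
  is_line_int (fun u => Csum (fun k => f k u) n) (Csum l n).
Proof. intros H. induction n as [| n IH]; cbn [Csum]; [apply H | apply isI_plus; auto]. Qed.

Lemma is_lim_seq_exp_opp_INR (c : R) : 0 < c -> is_lim_seq (fun n => exp (- (c * ln (INR (S n))))) 0.
Proof.
  intros Hc. apply (is_lim_seq_ext (fun n => Rpower (INR (S n)) (- c))).
  - intros n. unfold Rpower. f_equal. ring.
  - apply is_lim_seq_spec. intros eps. assert (He := cond_pos eps).
    destruct (exp_left_tail c 1 eps Hc Rle_0_1 He) as [M [HM H]].
    destruct (nfloor_ex (exp M)) as [N [HN1 HN2]]; [left; apply exp_pos |].
    exists (S N). intros n Hn. rewrite Rminus_0_r, Rabs_pos_eq by (left; apply exp_pos).
    assert (Hlt : exp M < INR (S n)).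
    { apply Rlt_le_trans with (INR N + 1); [exact HN2 |]. rewrite <- S_INR. apply le_INR. lia. }
    assert (HM2 : M < ln (INR (S n))).
    { rewrite <- (ln_exp M). apply ln_increasing; [apply exp_pos | exact Hlt]. }
    specialize (H (- ln (INR (S n))) ltac:(lra)). unfold Rpower.
    replace (- c * ln (INR (S n))) with (c * - ln (INR (S n))) by ring. lra.
Qed.

(** Riemann's computation: integrating the Gaussian terms of theta - 1 one by one gives the terms of
    the Dirichlet series, and [isI_limit] supplies the limit. *)
Lemma zeta_product (s : C) : 1 < Re s ->
  (cpow PI (- s / 2) * Gamma_integral (s / 2) * zeta_series s)%C = (mellin (theta_rem 1) s + (/ (s - RtoC 1) - / s))%C.
Proof.
  intros Hs. set (L := (mellin (theta_rem 1) s + (/ (s - RtoC 1) - / s))%C).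
  set (c0 := (cpow PI (- s / 2) * Gamma_integral (s / 2))%C).
  set (a := fun n => cpow (INR (S n)) (- s)%C).
  (* Giving up x^(-eta) = e^(-2 eta u) leaves the exponent Re s - 2 eta >= (Re s + 1) / 2 > 1, for
     which theta - 1 is still dominated. *)
  set (eta := Rmin ((Re s - 1) / 4) 1).
  assert (He0 : 0 < eta) by (apply Rmin_pos; lra).
  assert (He1 : eta <= (Re s - 1) / 4) by apply Rmin_l. assert (He2 : eta <= 1) by apply Rmin_r.
  destruct (theta_weight_dom (Re s - 2 * eta)) as [K HK]; [lra |].
  assert (HL : is_line_int (fun u => RtoC (theta_pow 1 u - 1) * Cexp (s * RtoC u))%C L) by (apply isI_thp; lra).
  set (eps := fun n => exp (- (2 * eta * ln (INR (S n))))).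
  assert (Heps : is_lim_seq eps 0) by (apply is_lim_seq_exp_opp_INR; lra).
  assert (Hsum : forall n, Cmod (c0 * Csum a n - L) <= eps n * (K * PI)).
  { destruct (isI_limit (fun n u => Csum (fun k => RtoC (2 * gauss (exp (2 * u)) k) * Cexp (s * RtoC u))%C n)
      (fun n => Csum (fun k => c0 * a k)%C n) (fun u => RtoC (theta_pow 1 u - 1) * Cexp (s * RtoC u))%C eps K) as [L' [HL' H]].
    - intros n. apply (isI_Csum (fun k u => RtoC (2 * gauss (exp (2 * u)) k) * Cexp (s * RtoC u))%C (fun k => c0 * a k)%C).
      intros k. apply gauss_term_isI. lra.
    - apply HL.
    - intros n u. rewrite Csum_RtoC, rsum_scal. set (x := exp (2 * u)). assert (Hx : 0 < x) by apply exp_pos.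
      replace (RtoC (theta_pow 1 u - 1) * Cexp (s * RtoC u) - RtoC (2 * rsum (gauss x) (S n)) * Cexp (s * RtoC u))%C
        with (RtoC (theta_pow 1 u - 1 - 2 * rsum (gauss x) (S n)) * Cexp (s * RtoC u))%C by (rewrite (RtoC_minus (theta_pow 1 u - 1)); ring).
      rewrite Cmod_mult, Cmod_R, Cmod_Cexp.
      replace (Re (s * RtoC u)) with (Re s * u) by (unfold Re, Cmult, RtoC; simpl; ring).
      assert (Eth : theta_pow 1 u - 1 = 2 * Series (gauss x)) by (rewrite thp_1; fold x; rewrite theta_gauss by exact Hx; ring).
      assert (Esp := Series_split _ (S n) (ex_series_gauss x Hx)).
      assert (Htail := gauss_tail x (S n) Hx).
      assert (Hnn : 0 <= Series (fun k => gauss x (S n + k))).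
      { apply Series_nonneg; [intros; left; apply exp_pos |].
        apply (ex_series_incr_n (gauss x) (S n)), ex_series_gauss, Hx. }
      assert (HSn := lt_0_INR (S n) ltac:(lia)).
      assert (Hy : 0 < INR (S n) ^ 2 * x) by (apply Rmult_lt_0_compat; [apply pow_lt; lra | exact Hx]).
      assert (Hpw := exp_neg_le_power _ eta Hy ltac:(lra)).
      assert (Eln : eta * ln (INR (S n) ^ 2 * x) = 2 * eta * ln (INR (S n)) + 2 * eta * u).
      { rewrite ln_mult by (try exact Hx; apply pow_lt, HSn). unfold x. rewrite ln_exp.
        replace (INR (S n) ^ 2) with (INR (S n) * INR (S n)) by ring. rewrite ln_mult by exact HSn. ring. }
      rewrite Eln, Ropp_plus_distr, exp_plus in Hpw. change (exp (- (2 * eta * ln (INR (S n))))) with (eps n) in Hpw.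
      assert (Hth : 0 <= theta_pow 1 u - 1) by (assert (T := thp_ge_1 1 u ltac:(lra)); lra).
      rewrite Rabs_pos_eq by lra.
      assert (B1 : theta_pow 1 u - 1 - 2 * rsum (gauss x) (S n) <= eps n * exp (- (2 * eta * u)) * (theta_pow 1 u - 1)).
      { apply Rle_trans with (exp (- (INR (S n) ^ 2 * x)) * (theta_pow 1 u - 1)); [rewrite Eth; lra |]. apply Rmult_le_compat_r; assumption. }
      apply Rle_trans with (eps n * exp (- (2 * eta * u)) * (theta_pow 1 u - 1) * exp (Re s * u)).
      + apply Rmult_le_compat_r; [left; apply exp_pos | exact B1].
      + specialize (HK u). replace ((Re s - 2 * eta) * u) with (- (2 * eta * u) + Re s * u) in HK by ring. rewrite exp_plus in HK.
        replace (eps n * exp (- (2 * eta * u)) * (theta_pow 1 u - 1) * exp (Re s * u))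
          with (eps n * ((theta_pow 1 u - 1) * (exp (- (2 * eta * u)) * exp (Re s * u)))) by ring.
        apply Rmult_le_compat_l; [left; apply exp_pos | exact HK].
    - rewrite (isI_unique _ _ _ HL' HL) in H. intros n. rewrite <- Csum_Cmult. apply H. }
  assert (HepsK : is_lim_seq (fun n => eps n * (K * PI)) 0).
  { replace (Finite 0) with (Rbar_mult 0 (K * PI)) by (simpl; f_equal; ring). apply is_lim_seq_scal_r, Heps. }
  (* If the prefactor were 0, the estimate [Hsum] would force L = 0 and both sides would vanish;
     otherwise dividing by it gives the sum of the Dirichlet series. *)
  destruct (excluded_middle_informative (c0 = RtoC 0)) as [E0 | E0].
  - rewrite E0, Cmult_0_l. symmetry. apply C_eq_of_small. intros e Hepos.
    apply is_lim_seq_spec in HepsK. destruct (HepsK (mkposreal e Hepos)) as [N HN]. specialize (HN N (le_n N)). simpl in HN.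
    specialize (Hsum N). rewrite E0 in Hsum.
    replace (RtoC 0 * Csum a N - L)%C with (- (L - 0))%C in Hsum by ring. rewrite Cmod_opp in Hsum.
    rewrite Rminus_0_r in HN. apply Rabs_def2 in HN. lra.
  - replace (zeta_series s) with (L / c0)%C; [field; exact E0 |]. symmetry. apply CSeries_unique.
    apply (is_series_C _ _ (fun n => / Cmod c0 * (eps n * (K * PI)))).
    + intros n. fold a. replace (Csum a n - L / c0)%C with (/ c0 * (c0 * Csum a n - L))%C by (field; exact E0).
      rewrite Cmod_mult, Cmod_inv by exact E0. apply Rmult_le_compat_l; [| apply Hsum].
      left. apply Rinv_0_lt_compat, Cmod_gt_0, E0.
    + replace (Finite 0) with (Rbar_mult (/ Cmod c0) 0) by (simpl; f_equal; ring). apply is_lim_seq_scal_l, HepsK.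
Qed.

Lemma zeta_star_EZ (s : C) : zeta_star s = Z_explicit 1 s.
Proof.
  apply mero_continuation_eq; [apply EZ_meromorphic; lra |].
  intros z Hz. destruct (Re_gt_regular 1 z Rlt_0_1 Hz) as [H0 H1]. rewrite EZ_regular by assumption.
  symmetry. apply zeta_product, Hz.
Qed.

(** * The double series *)

Lemma two_sided_exp (u : R) : exp (2 * Rabs u) <= exp (2 * u) + exp (- (2 * u)).
Proof.
  assert (P1 := exp_pos (2 * u)). assert (P2 := exp_pos (- (2 * u))).
  unfold Rabs. destruct (Rcase_abs u).
  - replace (2 * - u) with (- (2 * u)) by ring. lra.
  - lra.
Qed.

(** PI > 3 and alpha <= 1 turn 8 alpha / PI into 8/3 and PI / 2 into 1. The bound blows up doubly
    exponentially as v -> -infinity, and the other factor of the integrand has to absorb this. *)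
Lemma thp_expansion_tail (alpha v : R) (M : nat) : 0 < alpha <= 1 ->
  Rabs (theta_pow alpha v - rsum (fun m => c_theta alpha m * exp (- (PI * exp (2 * v) * INR m))) M)
  <= exp (- (INR M * exp (2 * v)) + (8 / 3) * exp (- (2 * v))).
Proof.
  intros Ha. assert (HX := exp_pos (2 * v)).
  assert (H := theta_pow_expansion alpha (exp (2 * v)) M ltac:(lra) HX).
  rewrite (rsum_ext _ (fun m => c_theta alpha m * exp (- (PI * exp (2 * v))) ^ m)).
  2:{ intros k _. rewrite <- exp_INR_pow. do 2 f_equal. ring. }
  eapply Rle_trans; [exact H |]. rewrite <- exp_INR_pow, <- exp_plus. apply exp_le.
  assert (HPI := PI2_3_2). assert (Hn := pos_INR M). rewrite exp_Ropp.
  apply Rplus_le_compat.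
  - assert (Q : INR M * exp (2 * v) * 1 <= INR M * exp (2 * v) * (PI / 2)).
    { apply Rmult_le_compat_l; [apply Rmult_le_pos; lra | lra]. }
    lra.
  - replace (8 * alpha / (PI * exp (2 * v))) with ((8 * alpha / PI) * / exp (2 * v)) by (field; lra).
    apply Rmult_le_compat_r; [left; apply Rinv_0_lt_compat, HX |].
    apply (Rmult_le_reg_r PI); [lra |]. unfold Rdiv. rewrite Rmult_assoc, Rinv_l by lra. lra.
Qed.

Definition gterm (phi : R -> R) (n : nat) : R -> R := fun v => exp (- (PI * exp (2 * v) * INR n)) * phi v.

(** The function phi decays doubly exponentially at -infinity and may grow exponentially at
    +infinity, where the decay comes from e^(-pi n e^(2v)) or from theta^alpha - 1. The instances
    are phi = e^(-pi m e^(-2v)) for the inner sum and phi = theta^beta - 1 reflected for the outer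
    sum. *)
Section TwoSided.

Context (phi : R -> R) (K c : R) (Hphi : contR phi)
  (Hbound : forall v, Rabs (phi v) <= K * (exp (c * Rabs v) * exp (- PI * exp (- (2 * v))))).

Lemma two_sided_K : 0 <= K.
Proof.
  assert (H := Hbound 0). assert (P := Rabs_pos (phi 0)).
  assert (Q : 0 < exp (c * Rabs 0) * exp (- PI * exp (- (2 * 0)))) by (apply Rmult_lt_0_compat; apply exp_pos). nra.
Qed.

Lemma contR_gterm (n : nat) : contR (gterm phi n).
Proof.
  apply contR_mult; [| exact Hphi].
  intros u. apply (ex_derive_continuous (V := R_NormedModule)). auto_derive; trivial.
Qed.

Lemma rapid_gterm (n : nat) : rapid (gterm phi (S n)).
Proof.
  apply (rapid_intro _ K c PI); [apply contR_gterm | apply PI_RGT_0 |].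
  intros v. unfold gterm. rewrite Rabs_mult, (Rabs_pos_eq (exp _)) by (left; apply exp_pos).
  assert (H1 := Hbound v). assert (T := two_sided_exp v). assert (HPI := PI_RGT_0).
  assert (P := exp_pos (- (PI * exp (2 * v) * INR (S n)))).
  apply Rle_trans with (exp (- (PI * exp (2 * v) * INR (S n))) * (K * (exp (c * Rabs v) * exp (- PI * exp (- (2 * v)))))).
  - apply Rmult_le_compat_l; lra.
  - replace (exp (- (PI * exp (2 * v) * INR (S n))) * (K * (exp (c * Rabs v) * exp (- PI * exp (- (2 * v))))))
      with (K * (exp (c * Rabs v) * (exp (- (PI * exp (2 * v) * INR (S n))) * exp (- PI * exp (- (2 * v)))))) by ring.
    apply Rmult_le_compat_l; [apply two_sided_K |]. apply Rmult_le_compat_l; [left; apply exp_pos |].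
    rewrite <- exp_plus. apply exp_le. assert (HX := exp_pos (2 * v)).
    assert (Hn : 1 <= INR (S n)) by (rewrite S_INR; assert (T2 := pos_INR n); lra).
    assert (Q : PI * exp (2 * v) * 1 <= PI * exp (2 * v) * INR (S n)) by (apply Rmult_le_compat_l; [apply Rmult_le_pos; lra | exact Hn]).
    assert (Q2 : PI * exp (2 * Rabs v) <= PI * (exp (2 * v) + exp (- (2 * v)))) by (apply Rmult_le_compat_l; lra).
    lra.
Qed.

Lemma rapid_thp_mult (alpha : R) : 0 < alpha <= 1 -> rapid (fun v => (theta_pow alpha v - 1) * phi v).
Proof.
  intros Ha. apply (rapid_intro _ (5 * K) (c + 1) PI); [| apply PI_RGT_0 |].
  - apply contR_mult; [apply contR_minus; [apply contR_thp | apply contR_const] | exact Hphi].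
  - intros v. assert (HK := two_sided_K). assert (H1 := Hbound v). assert (T := thp_ge_1 alpha v ltac:(lra)).
    rewrite Rabs_mult, (Rabs_pos_eq (theta_pow alpha v - 1)) by lra.
    assert (P1 := exp_pos (c * Rabs v)). assert (Pv := Rabs_pos v). assert (HPI := PI_RGT_0).
    assert (E1 : 1 <= exp (1 * Rabs v)) by (apply Rle_trans with (exp 0); [rewrite exp_0; lra | apply exp_le; lra]).
    rewrite Rmult_plus_distr_r, exp_plus.
    destruct (Rle_dec 0 v) as [Hv | Hv].
    + assert (U := thp_upper alpha v Ha Hv). rewrite (Rabs_pos_eq v) in * by exact Hv.
      assert (E2 : exp (- PI * exp (- (2 * v))) <= 1).
      { apply Rle_trans with (exp 0); [| rewrite exp_0; lra]. apply exp_le. assert (Q := exp_pos (- (2 * v))). nra. }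
      assert (B : Rabs (phi v) <= K * exp (c * v)).
      { eapply Rle_trans; [exact H1 |]. apply Rmult_le_compat_l; [exact HK |]. nra. }
      assert (P2 := exp_pos (- PI * exp (2 * v))).
      apply Rle_trans with ((4 * exp (- PI * exp (2 * v))) * (K * exp (c * v))).
      * apply Rmult_le_compat; [lra | apply Rabs_pos | exact U | exact B].
      * assert (Q : 0 <= K * exp (c * v) * exp (- PI * exp (2 * v))) by (repeat apply Rmult_le_pos; lra).
        replace (5 * K * (exp (c * v) * exp (1 * v) * exp (- PI * exp (2 * v)))) with (5 * (K * exp (c * v) * exp (- PI * exp (2 * v))) * exp (1 * v)) by ring.
        nra.
    + assert (G := thp_growth alpha v Ha). rewrite (Rabs_left v) in * by lra.
      replace (- (2 * v)) with (2 * - v) in H1 by ring.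
      assert (E2 : exp (alpha * - v) <= exp (1 * - v)) by (apply exp_le; nra).
      assert (P2 := exp_pos (- PI * exp (2 * - v))).
      apply Rle_trans with ((5 * exp (1 * - v)) * (K * (exp (c * - v) * exp (- PI * exp (2 * - v))))).
      * apply Rmult_le_compat; [lra | apply Rabs_pos | lra | exact H1].
      * apply Req_le. ring.
Qed.

(** The error of the expansion of theta^alpha, multiplied by phi, is split into a rate depending on
    n alone and a rapidly decaying weight in v, so that [isI_limit] applies. *)
Lemma theta_sum_exchange (alpha : R) (z : C) : 0 < alpha <= 1 ->
  is_Cseries
    (fun n => RtoC (c_theta alpha (S n)) * mellin (gterm phi (S n)) z)%C
    (mellin (fun v => (theta_pow alpha v - 1) * phi v) z).
Proof.
  intros Ha. set (psi := fun v => (theta_pow alpha v - 1) * phi v).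
  assert (Hpsi : rapid psi) by exact (rapid_thp_mult alpha Ha).
  set (sigma := Cmod z).
  (* This weight is what remains of the decay of phi once the error of the expansion and the rate in
     n have been paid for. *)
  assert (Hw : rapid (fun v => K * (exp (c * Rabs v) * exp (- (/ 6) * exp (2 * Rabs v))))).
  { apply (rapid_intro _ K c (/ 6)); [| lra |].
    - apply contR_mult; [apply contR_const |]. apply contR_mult.
      + apply (contR_comp Rabs (fun x => exp (c * x))); [apply contR_abs | apply contR_exp_lin].
      + apply (contR_comp Rabs (fun x => exp (- (/ 6) * exp (2 * x)))); [apply contR_abs |].
        intros u. apply (ex_derive_continuous (V := R_NormedModule)). auto_derive; trivial.
    - intros u. rewrite Rabs_pos_eq; [lra |]. apply Rmult_le_pos; [apply two_sided_K |].
      apply Rmult_le_pos; left; apply exp_pos. }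
  destruct (rapid_dom _ sigma Hw) as [K2 HK2].
  set (eps := fun n => exp (- (sqrt (INR (S n)) / 3))).
  assert (HP := Mel_spec psi z Hpsi).
  set (l := fun n => (RtoC (c_theta alpha (S n)) * mellin (gterm phi (S n)) z)%C).
  destruct (isI_limit (fun n v => Csum (fun k => RtoC (c_theta alpha (S k)) * (RtoC (gterm phi (S k) v) * Cexp (z * RtoC v)))%C n)
    (Csum l) (fun v => RtoC (psi v) * Cexp (z * RtoC v))%C eps K2) as [L [HL1 HL2]].
  - intros n. apply (isI_Csum (fun k v => RtoC (c_theta alpha (S k)) * (RtoC (gterm phi (S k) v) * Cexp (z * RtoC v)))%C).
    intros k. apply isI_Cmult, Mel_spec, rapid_gterm.
  - apply HP.
  - intros n v.
    rewrite (Csum_ext _ (fun k => RtoC (c_theta alpha (S k) * gterm phi (S k) v) * Cexp (z * RtoC v))%C) by (intros; rewrite RtoC_mult; ring).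
    rewrite Csum_RtoC.
    replace (RtoC (psi v) * Cexp (z * RtoC v) - RtoC (rsum (fun k => c_theta alpha (S k) * gterm phi (S k) v)%R (S n)) * Cexp (z * RtoC v))%C
      with (RtoC (psi v - rsum (fun k => c_theta alpha (S k) * gterm phi (S k) v)%R (S n)) * Cexp (z * RtoC v))%C by (rewrite RtoC_minus; ring).
    (* The term m = 0 of the expansion is c_0 = 1, the constant subtracted in psi; hence n + 1 terms
       here correspond to length n + 2 there. *)
    assert (Efac : psi v - rsum (fun k => c_theta alpha (S k) * gterm phi (S k) v) (S n)
      = (theta_pow alpha v - rsum (fun m => c_theta alpha m * exp (- (PI * exp (2 * v) * INR m))) (S (S n))) * phi v).
    { rewrite (rsum_first _ (S n)), c_theta_0. simpl (INR 0). rewrite Rmult_0_r, Ropp_0, exp_0.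
      unfold psi, gterm. rewrite (rsum_ext _ (fun k => phi v * (c_theta alpha (S k) * exp (- (PI * exp (2 * v) * INR (S k)))))) by (intros; ring).
      rewrite rsum_scal. ring. }
    rewrite Efac, Cmod_mult, Cmod_R, Rabs_mult.
    assert (T := thp_expansion_tail alpha v (S (S n)) Ha).
    set (X := exp (2 * v)) in *. set (Y := exp (- (2 * v))) in *.
    assert (HX : 0 < X) by apply exp_pos. assert (HY : 0 < Y) by apply exp_pos.
    assert (HXY : X * Y = 1) by (unfold X, Y; rewrite <- exp_plus; replace (2 * v + - (2 * v)) with 0 by ring; apply exp_0).
    assert (HPI := PI2_3_2). assert (Ht := two_sided_exp v). fold X Y in Ht.
    assert (Hs0 := pos_INR (S n)). assert (Hs := sqrt_pos (INR (S n))). assert (Hs2 := sqrt_sqrt (INR (S n)) Hs0).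
    set (sq := sqrt (INR (S n))) in *.
    (* X Y = 1 keeps X and Y from being small together, so INR (S n) X + Y / 6 has a lower bound of
       order sqrt n, uniform in v. *)
    assert (Hamgm : sq / 3 <= INR (S n) * X + Y / 6).
    { rewrite <- Hs2. assert (Q : 0 <= (sq * X - / 6) ^ 2 * Y).
      { apply Rmult_le_pos; [apply pow2_ge_0 | lra]. }
      replace ((sq * X - / 6) ^ 2 * Y) with (sq * sq * X * (X * Y) - / 3 * sq * (X * Y) + / 36 * Y) in Q by field.
      rewrite HXY in Q. lra. }
    (* The budget for Y: 8/3 from the expansion, 1/6 for the rate and 1/6 for the weight make 3 <
       PI. The extra X in INR (S (S n)) X pays for the weight at the other end. *)
    assert (Hexp : exp (- (INR (S (S n)) * X) + 8 / 3 * Y) * exp (- PI * Y) <= eps n * exp (- (/ 6) * exp (2 * Rabs v))).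
    { unfold eps. fold sq. rewrite <- !exp_plus. apply exp_le. rewrite (S_INR (S n)). nra. }
    assert (Hb := Hbound v). fold Y in Hb.
    assert (HK := two_sided_K). assert (E1 := exp_pos (c * Rabs v)).
    assert (Hprod : Rabs (theta_pow alpha v - rsum (fun m => c_theta alpha m * exp (- (PI * X * INR m))) (S (S n))) * Rabs (phi v)
      <= eps n * (K * (exp (c * Rabs v) * exp (- (/ 6) * exp (2 * Rabs v))))).
    { eapply Rle_trans. { apply Rmult_le_compat; [apply Rabs_pos | apply Rabs_pos | exact T | exact Hb]. }
      replace (exp (- (INR (S (S n)) * X) + 8 / 3 * Y) * (K * (exp (c * Rabs v) * exp (- PI * Y))))
        with (K * exp (c * Rabs v) * (exp (- (INR (S (S n)) * X) + 8 / 3 * Y) * exp (- PI * Y))) by ring.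
      replace (eps n * (K * (exp (c * Rabs v) * exp (- (/ 6) * exp (2 * Rabs v)))))
        with (K * exp (c * Rabs v) * (eps n * exp (- (/ 6) * exp (2 * Rabs v)))) by ring.
      apply Rmult_le_compat_l; [apply Rmult_le_pos; lra | exact Hexp]. }
    specialize (HK2 v). rewrite Rabs_pos_eq in HK2.
    2:{ apply Rmult_le_pos; [exact HK |]. apply Rmult_le_pos; left; apply exp_pos. }
    eapply Rle_trans. { apply Rmult_le_compat; [apply Rmult_le_pos; apply Rabs_pos | apply Cmod_ge_0 | exact Hprod | apply Cexp_bound]. }
    rewrite Rmult_assoc. apply Rmult_le_compat_l; [left; apply exp_pos | exact HK2].
  - rewrite (isI_unique _ _ _ HL1 HP) in HL2.
    apply (is_series_C _ _ (fun n => eps n * (K2 * PI))); [exact HL2 |].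
    replace (Finite 0) with (Rbar_mult 0 (K2 * PI)) by (simpl; f_equal; ring). apply is_lim_seq_scal_r.
    apply is_lim_seq_spec. intros e. assert (He := cond_pos e).
    destruct (exp_left_tail (/ 3) 1 e ltac:(lra) Rle_0_1 He) as [M [HM H]].
    destruct (nfloor_ex ((M + 1) ^ 2)) as [N [HN1 HN2]]; [apply pow2_ge_0 |].
    exists N. intros n Hn. rewrite Rminus_0_r, Rabs_pos_eq by (left; apply exp_pos).
    assert (Hlt : (M + 1) ^ 2 <= INR (S n)).
    { left. eapply Rlt_le_trans; [exact HN2 |]. rewrite <- S_INR. apply le_INR. lia. }
    assert (Hsq : M + 1 <= sqrt (INR (S n))).
    { rewrite <- (sqrt_pow2 (M + 1)) by lra. apply sqrt_le_1_alt, Hlt. }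
    specialize (H (- sqrt (INR (S n))) ltac:(lra)). unfold eps.
    replace (- (sqrt (INR (S n)) / 3)) with (/ 3 * - sqrt (INR (S n))) by field. lra.
Qed.

End TwoSided.

Lemma Mel_flip (phi : R -> R) (z : C) : rapid phi -> rapid (fun v => phi (- v)) ->
  mellin (fun v => phi (- v)) z = mellin phi (- z).
Proof.
  intros H1 H2. apply Mel_unique; [exact H2 |].
  eapply isI_ext; [| exact (isI_flip _ _ (Mel_spec phi (- z) H1))].
  intros u. cbn beta. do 2 f_equal. rewrite RtoC_opp. ring.
Qed.

(** * Bessel functions as Mellin transforms, and the double series *)

Definition gpair (m n : nat) : R -> R := fun v => exp (- (PI * exp (2 * v) * INR m)) * exp (- (PI * exp (- (2 * v)) * INR n)).

Lemma gpair_bound (m : nat) (v : R) :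
  Rabs (exp (- (PI * exp (- (2 * v)) * INR (S m)))) <= 1 * (exp (0 * Rabs v) * exp (- PI * exp (- (2 * v)))).
Proof.
  rewrite Rabs_pos_eq by (left; apply exp_pos). rewrite Rmult_0_l, exp_0, !Rmult_1_l. apply exp_le.
  assert (HY := exp_pos (- (2 * v))). assert (HPI := PI_RGT_0). rewrite S_INR. assert (T := pos_INR m).
  assert (Q : 0 <= PI * exp (- (2 * v)) * INR m) by (apply Rmult_le_pos; [apply Rmult_le_pos; lra | exact T]).
  lra.
Qed.

Lemma contR_gauss_neg (m : nat) : contR (fun v => exp (- (PI * exp (- (2 * v)) * INR m))).
Proof. intros u. apply (ex_derive_continuous (V := R_NormedModule)). auto_derive; trivial. Qed.

Lemma rapid_gpair (m n : nat) : rapid (gpair (S m) (S n)).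
Proof.
  exact (rapid_gterm (fun v => exp (- (PI * exp (- (2 * v)) * INR (S n)))) 1 0 (contR_gauss_neg (S n)) (gpair_bound n) m).
Qed.

(** The substitution v = d - (ln t) / 2 with e^(4d) = n / m balances the two exponents: m e^(2d) = n
    e^(-2d) = sqrt (mn). The shift d produces the power (n/m)^(z/4), and the scaling the factor 1/2
    in front of the Bessel integral. *)
Lemma bessel_term (m n : nat) (z : C) :
  (cpow (INR (S n) / INR (S m)) (z / 4) * BesselK (z / 2) (2 * PI * sqrt (INR (S m) * INR (S n))))%C
  = mellin (gpair (S m) (S n)) z.
Proof.
  assert (Hm := lt_0_INR (S m) ltac:(lia)). assert (Hn := lt_0_INR (S n) ltac:(lia)).
  set (m' := INR (S m)) in *. set (n' := INR (S n)) in *.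
  assert (Hnm : 0 < n' / m') by (apply Rdiv_lt_0_compat; assumption).
  set (d := / 4 * ln (n' / m')).
  assert (Ed : cpow (n' / m') (z / 4) = Cexp (z * RtoC d)).
  { rewrite cpow_Cexp. f_equal. unfold d. rewrite RtoC_mult, RtoC_inv by lra. field. }
  rewrite Ed.
  set (S0 := sqrt (m' * n')).
  assert (Hd2 : exp (2 * d) = sqrt (n' / m')).
  { assert (E := exp_pos (2 * d)). rewrite <- (sqrt_pow2 (exp (2 * d))) by lra. f_equal.
    replace (exp (2 * d) ^ 2) with (exp (2 * d + 2 * d)) by (rewrite exp_plus; ring).
    replace (2 * d + 2 * d) with (ln (n' / m')) by (unfold d; field; lra). apply exp_ln, Hnm. }
  assert (E1 : m' * exp (2 * d) = S0).
  { rewrite Hd2. unfold S0. rewrite <- (sqrt_pow2 m') at 1 by lra. rewrite <- sqrt_mult by nra. f_equal. field. lra. }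
  assert (HS : 0 < S0) by (apply sqrt_lt_R0; nra).
  assert (E2 : n' * exp (- (2 * d)) = S0).
  { assert (Hss : S0 * S0 = m' * n') by (apply sqrt_sqrt; nra). rewrite exp_Ropp.
    assert (Hd := exp_pos (2 * d)). apply (Rmult_eq_reg_r (exp (2 * d))); [| lra]. rewrite Rmult_assoc, Rinv_l by lra.
    apply (Rmult_eq_reg_l m'); [| lra]. rewrite Rmult_1_r, <- Hss, <- E1 at 1. ring. }
  assert (HI := Mel_spec (gpair (S m) (S n)) z (rapid_gpair m n)).
  set (I0 := mellin (gpair (S m) (S n)) z) in *.
  assert (HJ := isI_comp_lin _ _ (/ 2) (- d) ltac:(lra) (isI_flip _ _ HI)). cbn beta in HJ.
  (* This factor removes the Jacobian 1/2 and the constant e^(zd) that the substitution leaves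
     inside the integral. *)
  assert (HB := isI_Cmult (RtoC 2 / Cexp (z * RtoC d)) _ _ HJ). cbn beta in HB.
  assert (Hne := Cexp_neq_0 (z * RtoC d)).
  unfold BesselK.
  rewrite (CInt0oo_isI _ _ _ HB).
  - rewrite RtoC_div by lra. field. exact Hne.
  - intros t Ht. f_equal. rewrite cpow_Cexp.
    replace (z * RtoC (- (/ 2 * ln t + - d)))%C with (- (z / 2) * RtoC (ln t) + z * RtoC d)%C.
    2:{ rewrite RtoC_opp, RtoC_plus, RtoC_mult, RtoC_opp, RtoC_inv by lra. field. }
    rewrite Cexp_plus.
    replace (gpair (S m) (S n) (- (/ 2 * ln t + - d))) with (exp (- (2 * PI * S0 / 2) * (t + 1 / t))).
    + rewrite (RtoC_inv 2) by lra. field. exact Hne.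
    + unfold gpair. fold m' n'. rewrite <- exp_plus. f_equal.
      replace (2 * - (/ 2 * ln t + - d)) with (2 * d + - ln t) by (field; lra).
      replace (- (2 * d + - ln t)) with (- (2 * d) + ln t) by ring.
      rewrite !exp_plus, (exp_Ropp (ln t)), exp_ln by exact Ht.
      replace (- (PI * (exp (2 * d) * / t) * m') + - (PI * (exp (- (2 * d)) * t) * n'))
        with (- PI * (m' * exp (2 * d)) * / t + - PI * (n' * exp (- (2 * d))) * t) by ring.
      rewrite E1, E2. field. lra.
Qed.

Definition Dkernel (alpha beta u : R) : R := (theta_pow alpha u - 1) * (theta_pow beta (- u) - 1).

(** For v > 0 the last factor on the right is at least e^(-PI), which [exp PI] compensates; there
    the functional equation gives the growth e^(beta v). For v <= 0 the decay is that of theta - 1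
    at infinity. *)
Lemma thp_reflected_bound (beta v : R) : 0 < beta <= 1 ->
  Rabs (theta_pow beta (- v) - 1) <= 5 * exp PI * (exp (1 * Rabs v) * exp (- PI * exp (- (2 * v)))).
Proof.
  intros Hb. assert (T := thp_ge_1 beta (- v) ltac:(lra)). rewrite Rabs_pos_eq by lra.
  assert (HPI := PI_RGT_0).
  assert (EP : 1 <= exp PI) by (apply Rle_trans with (exp 0); [rewrite exp_0; lra | apply exp_le; lra]).
  assert (P := Rabs_pos v).
  assert (E1 : 1 <= exp (1 * Rabs v)) by (apply Rle_trans with (exp 0); [rewrite exp_0; lra | apply exp_le; lra]).
  destruct (Rle_dec v 0) as [Hv | Hv].
  - assert (U := thp_upper beta (- v) Hb ltac:(lra)). replace (2 * - v) with (- (2 * v)) in U by ring.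
    assert (Q := exp_pos (- PI * exp (- (2 * v)))).
    assert (Q2 : 1 <= exp PI * exp (1 * Rabs v)) by nra.
    replace (5 * exp PI * (exp (1 * Rabs v) * exp (- PI * exp (- (2 * v)))))
      with ((exp PI * exp (1 * Rabs v)) * (5 * exp (- PI * exp (- (2 * v))))) by ring. nra.
  - assert (G := thp_growth beta (- v) Hb). rewrite Rabs_Ropp in G.
    assert (E2 : exp (beta * Rabs v) <= exp (1 * Rabs v)) by (apply exp_le; nra).
    assert (E3 : 1 <= exp PI * exp (- PI * exp (- (2 * v)))).
    { rewrite <- exp_plus. apply Rle_trans with (exp 0); [rewrite exp_0; lra | apply exp_le].
      assert (E4 : exp (- (2 * v)) <= 1) by (apply Rle_trans with (exp 0); [apply exp_le; lra | rewrite exp_0; lra]). nra. }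
    replace (5 * exp PI * (exp (1 * Rabs v) * exp (- PI * exp (- (2 * v)))))
      with (5 * exp (1 * Rabs v) * (exp PI * exp (- PI * exp (- (2 * v))))) by ring. nra.
Qed.

Lemma contR_thp_reflected (beta : R) : contR (fun v => theta_pow beta (- v) - 1).
Proof.
  apply contR_minus; [| apply contR_const]. apply (contR_comp (fun v => - v) (theta_pow beta)); [| apply contR_thp].
  intros u. apply (continuous_opp (V := R_NormedModule)), continuous_id.
Qed.

Lemma rapid_Dkernel (alpha beta : R) : 0 < alpha <= 1 -> 0 < beta <= 1 -> rapid (Dkernel alpha beta).
Proof.
  intros Ha Hb.
  exact (rapid_thp_mult _ _ 1 (contR_thp_reflected beta) (fun v => thp_reflected_bound beta v Hb) alpha Ha).
Qed.

(** The kernel is expanded twice by [theta_sum_exchange]: theta^alpha - 1 in the sum over m, then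
    theta^beta - 1 in the sum over n with m fixed. *)
Lemma double_series_Dkernel (alpha beta : R) (z : C) : 0 < alpha <= 1 -> 0 < beta <= 1 ->
  is_double_series (fun m n => RtoC (c_theta alpha m) * RtoC (c_theta beta n)
     * cpow (INR n / INR m) (z / 4) * BesselK (z / 2) (2 * PI * sqrt (INR m * INR n)))%C (mellin (Dkernel alpha beta) z).
Proof.
  intros Ha Hb.
  set (psi := fun v => theta_pow beta (- v) - 1).
  exists (fun m => RtoC (c_theta alpha (S m)) * mellin (gterm psi (S m)) z)%C. split.
  - intros m. set (phi := fun v => exp (- (PI * exp (- (2 * v)) * INR (S m)))).
    (* The inner expansion concerns the reflected factor, so v is replaced by -v and z by -z. *)
    assert (H := theta_sum_exchange phi 1 0 (contR_gauss_neg (S m)) (gpair_bound m) beta (- z) Hb).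
    apply (is_series_scal_l (K := C_AbsRing) (V := C_NormedModule) (RtoC (c_theta alpha (S m)))) in H.
    assert (Er := rapid_thp_mult phi 1 0 (contR_gauss_neg (S m)) (gpair_bound m) beta Hb).
    assert (Efl : (fun v => (theta_pow beta (- v) - 1) * phi (- v)) = gterm psi (S m)).
    { apply functional_extensionality; intros v. unfold gterm, psi, phi.
      replace (- (2 * - v)) with (2 * v) by ring. ring. }
    assert (Eg : mellin (gterm psi (S m)) z = mellin (fun v => (theta_pow beta v - 1) * phi v) (- z)).
    { rewrite <- Efl. apply (Mel_flip (fun v => (theta_pow beta v - 1) * phi v)); [exact Er |].
      rewrite Efl. apply (rapid_gterm psi _ 1 (contR_thp_reflected beta) (fun v => thp_reflected_bound beta v Hb)). }
    rewrite Eg. eapply is_series_ext; [| exact H].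
    intros n. change (RtoC (c_theta alpha (S m)) * (RtoC (c_theta beta (S n)) * mellin (gterm phi (S n)) (- z))
      = RtoC (c_theta alpha (S m)) * RtoC (c_theta beta (S n)) * cpow (INR (S n) / INR (S m)) (z / 4)
       * BesselK (z / 2) (2 * PI * sqrt (INR (S m) * INR (S n))))%C.
    assert (Eb := bessel_term m n z).
    assert (Ep : (fun v => gterm phi (S n) (- v)) = gpair (S m) (S n)).
    { apply functional_extensionality; intros v. unfold gterm, gpair, phi.
      replace (- (2 * - v)) with (2 * v) by ring. replace (2 * - v) with (- (2 * v)) by ring. ring. }
    rewrite <- (Mel_flip (gterm phi (S n))), Ep, <- Eb; [ring | |].
    + apply (rapid_gterm phi 1 0 (contR_gauss_neg (S m)) (gpair_bound m)).
    + rewrite Ep. apply rapid_gpair.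
  - exact (theta_sum_exchange psi _ 1 (contR_thp_reflected beta) (fun v => thp_reflected_bound beta v Hb) alpha z Ha).
Qed.

(** * The Mellin transform of the pointwise identity between the remainders *)

Lemma rapid_mult_exp (phi : R -> R) (a : R) : rapid phi -> rapid (fun u => phi u * exp (a * u)).
Proof.
  intros [Hc H]. split; [apply contR_mult; [exact Hc | apply contR_exp_lin] |].
  intros sigma. destruct (H (Rabs a + sigma)) as [K HK]. exists K. intros u. eapply Rle_trans; [| apply HK].
  rewrite Rabs_mult, (Rabs_pos_eq (exp _)), Rmult_assoc, <- exp_plus by (left; apply exp_pos).
  apply Rmult_le_compat_l; [apply Rabs_pos |]. apply exp_le. rewrite Rmult_plus_distr_r, <- Rabs_mult.
  apply Rplus_le_compat_r, Rle_abs.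
Qed.

Lemma Mel_shift (phi : R -> R) (a : R) (s : C) : rapid phi ->
  mellin (fun u => phi u * exp (a * u)) s = mellin phi (s + RtoC a).
Proof.
  intros H. apply Mel_unique; [apply rapid_mult_exp, H |].
  eapply isI_ext; [| apply (Mel_spec phi (s + RtoC a) H)].
  intros u. cbn beta. replace ((s + RtoC a) * RtoC u)%C with (s * RtoC u + RtoC (a * u))%C by (rewrite RtoC_mult; ring).
  rewrite Cexp_plus, Cexp_RtoC, RtoC_mult. ring.
Qed.

(** Besides the factorization of theta, the cutoffs have to match: for t < 1, t^(-1) - 1 =
    (t^(-beta) - 1) + t^(-beta) (t^(-alpha) - 1) because alpha + beta = 1. *)
Lemma Rem_decomposition (alpha beta u : R) : 0 < alpha -> 0 < beta -> alpha + beta = 1 ->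
  theta_rem 1 u = theta_rem beta u + (theta_rem alpha u + Dkernel alpha beta u) * exp (- beta * u).
Proof.
  intros Ha Hb Hab. unfold Dkernel. rewrite thp_flip.
  assert (E1 : theta_pow 1 u = theta_pow alpha u * theta_pow beta u) by (unfold theta_pow; rewrite <- Rpower_plus, Hab; reflexivity).
  assert (E2 : exp (beta * u) * exp (- beta * u) = 1).
  { rewrite <- exp_plus. replace (beta * u + - beta * u) with 0 by ring. apply exp_0. }
  unfold theta_rem. rewrite E1.
  replace ((theta_pow alpha u - 1 - cutoff alpha u + (theta_pow alpha u - 1) * (exp (beta * u) * theta_pow beta u - 1)) * exp (- beta * u))
    with ((theta_pow alpha u - 1 - cutoff alpha u) * exp (- beta * u) + (theta_pow alpha u - 1) * ((exp (beta * u) * exp (- beta * u)) * theta_pow beta u - exp (- beta * u))) by ring.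
  rewrite E2. destruct (Rle_dec 0 u) as [Hu | Hu].
  - rewrite !wcut_nonneg by lra. ring.
  - rewrite !wcut_nonpos by lra.
    replace (exp (- (1) * u)) with (exp (- alpha * u) * exp (- beta * u)) by (rewrite <- exp_plus; f_equal; rewrite <- Hab; ring).
    ring.
Qed.

(** The argument 1 - s arises from [Rem_flip]: e^(-beta u) times the remainder of alpha at u is
    e^(-u) times that remainder at -u. *)
Lemma Mel_Rem_identity (alpha beta : R) (s : C) : 0 < alpha -> 0 < beta -> alpha + beta = 1 ->
  mellin (theta_rem 1) s = (mellin (theta_rem beta) s + mellin (theta_rem alpha) (1 - s) + mellin (Dkernel alpha beta) (s - RtoC beta))%C.
Proof.
  intros Ha Hb Hab.
  assert (Ra := rapid_Rem alpha ltac:(lra)). assert (Rb := rapid_Rem beta ltac:(lra)).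
  assert (RD := rapid_Dkernel alpha beta ltac:(lra) ltac:(lra)).
  assert (Efl : mellin (theta_rem alpha) (1 - s) = mellin (fun u => theta_rem alpha u * exp (- beta * u)) s).
  { assert (Ef : (fun u => theta_rem alpha (- u) * exp (- (1) * u)) = (fun u => theta_rem alpha u * exp (- beta * u))).
    { apply functional_extensionality; intros u. rewrite Rem_flip by exact Ha.
      replace (exp (- beta * u)) with (exp (alpha * u) * exp (- (1) * u)) by (rewrite <- exp_plus; f_equal; rewrite <- Hab; ring). ring. }
    assert (Rf : rapid (fun u => theta_rem alpha (- u))).
    { replace (fun u => theta_rem alpha (- u)) with (fun u => theta_rem alpha u * exp (alpha * u)).
      - apply rapid_mult_exp, Ra.
      - apply functional_extensionality; intros u. rewrite Rem_flip by exact Ha. ring. }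
    rewrite <- Ef, (Mel_shift (fun u => theta_rem alpha (- u))), Mel_flip by assumption. f_equal.
    rewrite RtoC_opp. ring. }
  rewrite Efl. replace (s - RtoC beta)%C with (s + RtoC (- beta))%C by (rewrite RtoC_opp; ring).
  rewrite <- (Mel_shift (Dkernel alpha beta)) by exact RD.
  apply Mel_unique; [apply rapid_Rem; lra |].
  eapply isI_ext; [| apply isI_plus; [apply isI_plus |]; apply Mel_spec; [exact Rb | apply rapid_mult_exp, Ra | apply rapid_mult_exp, RD]].
  intros u. cbn beta. rewrite (Rem_decomposition alpha beta u Ha Hb Hab).
  rewrite RtoC_plus, (RtoC_mult (_ + _)), RtoC_plus, !RtoC_mult. ring.
Qed.

Theorem theorem1 :
  (forall alpha beta : R, 0 < alpha -> 0 < beta -> alpha + beta = 1 ->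
     exists D : C -> C,
       (forall s : C,
          is_double_series
            (fun m n : nat =>
               (RtoC (c_theta alpha m) * RtoC (c_theta beta n)
                * cpow (INR n / INR m) ((s - RtoC beta) / 4)
                * BesselK ((s - RtoC beta) / 2) (2 * PI * sqrt (INR m * INR n)))%C)
            (D s)) /\
       entire D /\
       (forall s : C,
          ~ pole_at zeta_star s ->
          ~ pole_at (Z_theta beta) s ->
          ~ pole_at (fun z : C => Z_theta alpha (1 - z)%C) s ->
          zeta_star s = (Z_theta beta s + Z_theta alpha (1 - s) + D s)%C)) /\
  (exists D : C -> C,
     (forall s : C,
        is_double_series
          (fun m n : nat =>
             (RtoC (c_theta (1 / 2) m) * RtoC (c_theta (1 / 2) n)
              * cpow (INR n / INR m) (s / 4 - 1 / 8)
              * BesselK (s / 2 - 1 / 4) (2 * PI * sqrt (INR m * INR n)))%C)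
          (D s)) /\
     entire D /\
     (forall s : C,
        ~ pole_at zeta_star s ->
        ~ pole_at (Z_theta (1 / 2)) s ->
        ~ pole_at (fun z : C => Z_theta (1 / 2) (1 - z)%C) s ->
        zeta_star s = (Z_theta (1 / 2) s + Z_theta (1 / 2) (1 - s) + D s)%C)).
Proof.
  match goal with |- ?P /\ _ => assert (H : P) end.
  { intros alpha beta Ha Hb Hab. assert (Ha1 : 0 < alpha <= 1) by lra. assert (Hb1 : 0 < beta <= 1) by lra.
    assert (RD := rapid_Dkernel alpha beta Ha1 Hb1).
    exists (fun s => mellin (Dkernel alpha beta) (s - RtoC beta)). split; [| split].
    - intros s. apply (double_series_Dkernel alpha beta (s - RtoC beta)%C Ha1 Hb1).
    (* The shift of s by beta is absorbed into the kernel, so that D is itself the transform of a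
       rapidly decaying function. *)
    - replace (fun s => mellin (Dkernel alpha beta) (s - RtoC beta)%C) with (mellin (fun u => Dkernel alpha beta u * exp (- beta * u))).
      + apply Mel_entire, rapid_mult_exp, RD.
      + apply functional_extensionality; intros s. rewrite Mel_shift by exact RD. f_equal. rewrite RtoC_opp. ring.
    - intros s H1 H2 _.
      assert (Ez : zeta_star = Z_explicit 1) by (apply functional_extensionality; intros z; apply zeta_star_EZ).
      assert (Eb : Z_theta beta = Z_explicit beta) by (apply functional_extensionality, Z_theta_EZ, Hb1).
      rewrite Ez in *. rewrite Eb in *. rewrite (Z_theta_EZ alpha Ha1).
      assert (N0 : s <> RtoC 0) by (intros ->; apply H1, EZ_pole_0; lra).
      assert (N1 : s <> RtoC 1) by (intros ->; apply H1, EZ_pole_alpha; lra).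
      assert (Nb : s <> RtoC beta) by (intros ->; apply H2, EZ_pole_alpha, Hb1).
      (* The poles of Z_alpha(1 - s) lie at s = 1 and at s = 1 - alpha = beta, which are poles of
         zeta^* and of Z_beta. *)
      assert (N2 : (1 - s)%C <> RtoC 0).
      { intros E. apply N1. replace s with (RtoC 1 - (1 - s))%C by ring. rewrite E. ring. }
      assert (N3 : (1 - s)%C <> RtoC alpha).
      { intros E. apply Nb. replace s with (RtoC 1 - (1 - s))%C by ring. rewrite E, <- RtoC_minus. f_equal. lra. }
      (* Only the polar parts remain: 1 - s - alpha = -(s - beta), so the two terms with a pole at
         beta cancel and 1/(s - 1) - 1/s is left on both sides. *)
      rewrite !EZ_regular by assumption. rewrite (Mel_Rem_identity alpha beta s Ha Hb Hab).
      replace (RtoC alpha) with (RtoC 1 - RtoC beta)%C by (rewrite <- RtoC_minus; f_equal; lra).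
      assert (D0 := Csub_neq_0 _ _ N1). assert (D1 := Csub_neq_0 _ _ Nb).
      replace (1 - s - (RtoC 1 - RtoC beta))%C with (- (s - RtoC beta))%C by ring.
      replace (1 - s)%C with (- (s - RtoC 1))%C in * by ring.
      field. repeat split; try assumption.
      all: intros E; apply D0 || apply D1; rewrite <- E; ring. }
  split; [exact H |].
  destruct (H (1 / 2) (1 / 2)) as [D [H1 H2]]; [lra | lra | lra |].
  exists D. split; [| exact H2].
  intros s. specialize (H1 s).
  replace (s / 4 - 1 / 8)%C with ((s - RtoC (1 / 2)) / 4)%C by (rewrite RtoC_div by lra; field).
  replace (s / 2 - 1 / 4)%C with ((s - RtoC (1 / 2)) / 2)%C by (rewrite RtoC_div by lra; field).
  exact H1.
Qed.
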